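(* Let $p=2$. For every $\mathbf r=(r_1,r_2)\in\mathbb Z^2$, \[ {\rm coeff}_{\left[\zeta_1^{r_1},\,\zeta_{2}^{r_2}\right]} F\left(\zeta_1,\zeta_2;q\right)=q^{2Q(\mathbf r)} \frac{\eta(\tau)^5}{\eta(2\tau)}\, {\rm coeff}_{\left[\zeta_1^{2r_1-r_2},\,\zeta_{2}^{r_1+r_2}\right]} f\left(\mathbf{z};\tau\right), \] where on the right the coefficient is taken in the Laurent expansion of $f$ in the region $|q|<|\zeta_j|<1$ ($j\in\{1,2\}$), $|q|<|\zeta_1\zeta_2|<1$.
   Context: $q:=e^{2\pi i\tau}$ with $\tau\in\mathbb H$, $\zeta_j:=e^{2\pi i z_j}$, $\mathbf z=(z_1,z_2)$. $Q(\mathbf n):=n_1^2+n_2^2-n_1n_2$. For an integer $p\ge2$, \begin{align*} F(\zeta_1,\zeta_2;q)&:=\sum_{n_1,n_2\in\mathbb Z}\frac{q^{p\left(\left(n_1-\frac{1}{p}\right)^2+\left(n_2-\frac{1}{p}\right)^2-\left(n_1-\frac{1}{p}\right)\left(n_2-\frac{1}{p}\right)\right)}}{\left(1-\zeta_1^{-1}\right)\left(1-\zeta_2^{-1}\right)\left(1-\zeta_1^{-1}\zeta_2^{-1}\right)}\Big(\zeta_1^{n_1-1} \zeta_2^{n_2-1} -\zeta_1^{-n_1+n_2-1}\zeta_2^{n_2-1}\\ &\qquad-\zeta_1^{n_1-1}\zeta_2^{-n_2+n_1-1}+\zeta_1^{-n_2-1} \zeta_2^{-n_2+n_1-1}+\zeta_1^{-n_1+n_2-1}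 \zeta_2^{-n_1-1}-\zeta_1^{-n_2-1}\zeta_2^{-n_1-1}\Big); \end{align*} each rational function of $\zeta_1,\zeta_2$ appearing as a summand is a Laurent polynomial, so $F$ is a $q$-series (in rational powers of $q$) with Laurent polynomial coefficients, and ${\rm coeff}_{[\zeta_1^{r_1},\zeta_2^{r_2}]}$ denotes the coefficient of $\zeta_1^{r_1}\zeta_2^{r_2}$. $\vartheta(z;\tau):=\sum_{n\in\frac12+\mathbb Z}q^{\frac{n^2}{2}}e^{2\pi in(z+\frac12)}$, $\eta(\tau):=q^{\frac1{24}}\prod_{n\ge1}(1-q^n)$, and $f(\mathbf z;\tau):=\frac{\vartheta(z_1;2\tau)\vartheta(z_2;2\tau)\vartheta(z_1+z_2;2\tau)}{\vartheta(z_1;\tau)\vartheta(z_2;\tau)\vartheta(z_1+z_2;\tau)}$. *)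

(* Defs.v *)
From Stdlib Require Import Reals ZArith ClassicalEpsilon.
From Coquelicot Require Import Coquelicot.
Open Scope R_scope.

Definition cexp (w : C) : C :=
  (exp (Re w) * cos (Im w), exp (Re w) * sin (Im w)).

Definition ee (w : C) : C := cexp (Cmult (Cmult (RtoC (2 * PI)) Ci) w).

Definition qpow (tau : C) (x : R) : C := ee (Cmult (RtoC x) tau).

(* Limit of a complex sequence (componentwise; meaningful when it converges). *)
Definition Clim (u : nat -> C) : C :=
  (real (Lim_seq (fun N => Re (u N))), real (Lim_seq (fun N => Im (u N)))).

Definition Cconv (u : nat -> C) (l : C) : Prop :=
  filterlim u eventually (locally l).

Definition Zpartial (a : Z -> C) (N : nat) : C :=
  sum_n (fun i => a (Z.of_nat i - Z.of_nat N)%Z) (2 * N).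

Definition Z2partial (a : Z -> Z -> C) (N : nat) : C :=
  sum_n (fun i => sum_n (fun j =>
     a (Z.of_nat i - Z.of_nat N)%Z (Z.of_nat j - Z.of_nat N)%Z) (2 * N)) (2 * N).

Definition Zsum (a : Z -> C) : C := Clim (Zpartial a).
Definition Z2sum (a : Z -> Z -> C) : C := Clim (Z2partial a).

Definition has_Z2sum (a : Z -> Z -> C) (l : C) : Prop :=
  (exists M : R, forall N, sum_n (fun i => sum_n (fun j =>
     Cmod (a (Z.of_nat i - Z.of_nat N)%Z (Z.of_nat j - Z.of_nat N)%Z)) (2 * N)) (2 * N) <= M)
  /\ Cconv (Z2partial a) l.

Definition vartheta (z tau : C) : C :=
  Zsum (fun m => let n := IZR m + / 2 in
     Cmult (qpow tau (n * n / 2)) (ee (Cmult (RtoC n) (Cplus z (RtoC (/ 2)))))).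

Fixpoint eta_partial (tau : C) (N : nat) : C :=
  match N with
  | O => RtoC 1
  | S M => Cmult (eta_partial tau M) (Cminus (RtoC 1) (qpow tau (INR (S M))))
  end.

Definition eta (tau : C) : C :=
  Cmult (qpow tau (/ 24))
    (Clim (fun N => eta_partial tau N)).

Definition fF (z1 z2 tau : C) : C :=
  Cdiv (Cmult (Cmult (vartheta z1 (Cmult (RtoC 2) tau)) (vartheta z2 (Cmult (RtoC 2) tau)))
              (vartheta (Cplus z1 z2) (Cmult (RtoC 2) tau)))
       (Cmult (Cmult (vartheta z1 tau) (vartheta z2 tau)) (vartheta (Cplus z1 z2) tau)).

Definition Qf (x1 x2 : R) : R := x1 * x1 + x2 * x2 - x1 * x2.

(* ---- Laurent polynomials in (zeta1, zeta2), as coefficient functions Z -> Z -> C ---- *)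
Definition finsupp (c : Z -> Z -> C) : Prop :=
  exists M : Z, forall k1 k2 : Z, (M < Z.abs k1 \/ M < Z.abs k2)%Z -> c k1 k2 = RtoC 0.

Definition delta2 (a1 a2 k1 k2 : Z) : C :=
  if (Z.eqb k1 a1 && Z.eqb k2 a2)%bool then RtoC 1 else RtoC 0.

(* numerator of the n-th summand of F (coefficient of zeta1^k1 zeta2^k2) *)
Definition numer (n1 n2 k1 k2 : Z) : C :=
  let '(a, b) := (n1, n2) in
  Cplus (Cplus (Cplus (Cplus (Cplus
    (delta2 (a - 1) (b - 1) k1 k2)
    (Copp (delta2 (- a + b - 1) (b - 1) k1 k2)))
    (Copp (delta2 (a - 1) (- b + a - 1) k1 k2)))
    (delta2 (- b - 1) (- b + a - 1) k1 k2))
    (delta2 (- a + b - 1) (- a - 1) k1 k2))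
    (Copp (delta2 (- b - 1) (- a - 1) k1 k2)).

(* coefficients of c * (1 - zeta1^{-1})(1 - zeta2^{-1})(1 - zeta1^{-1} zeta2^{-1}),
   the denominator expanding to 1 - z1^-1 - z2^-1 + z1^-2 z2^-1 + z1^-1 z2^-2 - z1^-2 z2^-2 *)
Definition mul_denom (c : Z -> Z -> C) (k1 k2 : Z) : C :=
  Cplus (Cplus (Cplus (Cplus (Cplus
    (c k1 k2) (Copp (c (k1 + 1) k2)%Z)) (Copp (c k1 (k2 + 1))%Z))
    (c (k1 + 2) (k2 + 1))%Z) (c (k1 + 1) (k2 + 2))%Z) (Copp (c (k1 + 2) (k2 + 2))%Z).

(* The Laurent polynomial (numerator)/(denominator) of the n-th summand:
   the finitely supported c with c * denominator = numerator. *)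
Definition summand_poly (n1 n2 : Z) : Z -> Z -> C :=
  epsilon (inhabits (fun _ _ => RtoC 0))
    (fun c => finsupp c /\ forall k1 k2, mul_denom c k1 k2 = numer n1 n2 k1 k2).

Definition coeffF (p : nat) (tau : C) (r1 r2 : Z) : C :=
  Z2sum (fun n1 n2 =>
    Cmult (qpow tau (INR p * Qf (IZR n1 - / INR p) (IZR n2 - / INR p)))
          (summand_poly n1 n2 r1 r2)).

Definition region (tau z1 z2 : C) : Prop :=
  Cmod (ee tau) < Cmod (ee z1) < 1 /\
  Cmod (ee tau) < Cmod (ee z2) < 1 /\
  Cmod (ee tau) < Cmod (Cmult (ee z1) (ee z2)) < 1.

Definition is_laurent_expansion (tau : C) (g : C -> C -> C) (c : Z -> Z -> C) : Prop :=
  forall z1 z2, region tau z1 z2 ->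
    has_Z2sum (fun k1 k2 => Cmult (c k1 k2)
                 (ee (Cplus (Cmult (RtoC (IZR k1)) z1) (Cmult (RtoC (IZR k2)) z2))))
              (g z1 z2).

Definition laurent_coeff_f (tau : C) : Z -> Z -> C :=
  epsilon (inhabits (fun _ _ => RtoC 0))
    (is_laurent_expansion tau (fun z1 z2 => fF z1 z2 tau)).

(* Main.v *)
Require Import Defs.
From Stdlib Require Import Reals ZArith Lra Lia List Permutation Classical ClassicalEpsilon.
From Coquelicot Require Import Coquelicot.
Import ListNotations.
Local Open Scope C_scope.

(** The theta quotient factors as f = q^(3/8) (q^2;q^2)/(q;q)^5 K U, where, with x = ζ1, w = ζ2,
    K = sum over n of (xq)^n / (1 - q^(2n+1)/(xw)) is Kronecker's function in base q^2 and
    U = sum over n of (-1)^n q^(n(n+1)/2) / (1 - w q^n).  Both identities K θ(z) = U(a) θ(az) and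
    U(a) θ(a) = (q;q)^3 come from comparing Laurent coefficients, together with the triple product.
    Expanding geometrically gives every Laurent coefficient of f as an absolutely convergent sum
    over a rank-two lattice of q to a positive definite quadratic form with bounded integer weights.
    The coefficient of F is such a sum too, the weights now coming from Kostant's partition function;
    after symmetrising under the reflection (n1, n2) -> (1 - n2, 1 - n1), which fixes the quadratic
    form, the two families of weights agree pointwise. *)

(** * Unordered sums *)

(** Both [coeffF] and [laurent_coeff_f] are built from [epsilon] and from limits over square boxes.
    Boxes are not preserved by the reindexings needed here, hence the passage to unordered sums,
    where convergence already implies absolute convergence. As [laurent_coeff_f] is merely some
    expansion of f, exhibiting one is not enough: uniqueness is proved too, by averaging over roots
    of unity in place of contour integrals. The factorisation of f starts from θ_q(x) being
    proportional to θ_{q^2}(x) θ_{q^2}(xq). This turns the quotients in x and xw into 1/θ_{q^2}(xq)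
    and 1/θ_{q^2}(xwq); with θ_{q^2}(w) they form K for a = q/(xw), z = xq, since then az = q^2/w.
    The remaining 1/θ_q(w) gives U, in base q instead of q^2. Because of this mismatch the lattice
    of f is split by the parity of the index of U before its form becomes that of F. Single weights
    of F and f differ: Kostant values grow, while products of signs do not. Adding the reflected
    weight leaves only differences of Kostant values at neighbouring points, and these are products
    of half-plane indicators. *)

Definition Csum {I : Type} (f : I -> C) (L : list I) : C :=
  fold_right (fun i s => f i + s) 0 L.

Definition Rsum {I : Type} (g : I -> R) (L : list I) : R :=
  fold_right (fun i s => (g i + s)%R) 0%R L.

(** Convergence along the net of finite sets, a finite set being a duplicate-free list. Invariance
    under bijections of the index type is built in. *)
Definition has_sum {I : Type} (f : I -> C) (l : C) : Prop :=
  forall eps : R, (0 < eps)%R -> exists L : list I, forall L' : list I,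
    NoDup L' -> incl L L' -> (Cmod (Csum f L' - l) < eps)%R.

Definition Rsummable {I : Type} (g : I -> R) : Prop :=
  exists M : R, forall L : list I, NoDup L -> (Rsum g L <= M)%R.

Definition summable {I : Type} (f : I -> C) : Prop := Rsummable (fun i => Cmod (f i)).

Definition Cto (u : nat -> C) (l : C) : Prop :=
  forall eps : R, (0 < eps)%R ->
    exists N0 : nat, forall N : nat, (N0 <= N)%nat -> (Cmod (u N - l) < eps)%R.

Lemma Csum_app {I} (f : I -> C) L1 L2 : Csum f (L1 ++ L2) = Csum f L1 + Csum f L2.
Proof. induction L1 as [|x L1 IH]; simpl; [|rewrite IH]; ring. Qed.

Lemma Rsum_app {I} (f : I -> R) L1 L2 : Rsum f (L1 ++ L2) = (Rsum f L1 + Rsum f L2)%R.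
Proof. induction L1 as [|x L1 IH]; simpl; [|rewrite IH]; ring. Qed.

Lemma Csum_ext {I} (f g : I -> C) L :
  (forall i, In i L -> f i = g i) -> Csum f L = Csum g L.
Proof.
  induction L as [|x L IH]; simpl; intros H; [reflexivity|].
  rewrite (H x) by auto. rewrite IH by auto. reflexivity.
Qed.

Lemma Csum_plus {I} (f g : I -> C) L : Csum (fun i => f i + g i) L = Csum f L + Csum g L.
Proof. induction L as [|x L IH]; simpl; [|rewrite IH]; ring. Qed.

Lemma Csum_scal {I} (c : C) (f : I -> C) L : Csum (fun i => c * f i) L = c * Csum f L.
Proof. induction L as [|x L IH]; simpl; [|rewrite IH]; ring. Qed.

Lemma Csum_map {I J} (phi : I -> J) (f : J -> C) L :
  Csum f (map phi L) = Csum (fun i => f (phi i)) L.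
Proof. induction L as [|x L IH]; simpl; [|rewrite IH]; reflexivity. Qed.

Lemma Rsum_map {I J} (phi : I -> J) (f : J -> R) L :
  Rsum f (map phi L) = Rsum (fun i => f (phi i)) L.
Proof. induction L as [|x L IH]; simpl; [|rewrite IH]; reflexivity. Qed.

Lemma Csum_perm {I} (f : I -> C) L1 L2 : Permutation L1 L2 -> Csum f L1 = Csum f L2.
Proof.
  induction 1; simpl; [reflexivity|now rewrite IHPermutation|ring|congruence].
Qed.

Lemma Rsum_perm {I} (f : I -> R) L1 L2 : Permutation L1 L2 -> Rsum f L1 = Rsum f L2.
Proof.
  induction 1; simpl; [reflexivity|now rewrite IHPermutation|ring|congruence].
Qed.

Lemma Rsum_le {I} (f g : I -> R) L :
  (forall i, In i L -> (f i <= g i)%R) -> (Rsum f L <= Rsum g L)%R.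
Proof.
  induction L as [|x L IH]; simpl; intros H; [lra|].
  pose proof (H x (or_introl eq_refl)). pose proof (IH (fun i h => H i (or_intror h))). lra.
Qed.

Lemma Rsum_nonneg {I} (f : I -> R) L :
  (forall i, (0 <= f i)%R) -> (0 <= Rsum f L)%R.
Proof.
  intros H; induction L as [|x L IH]; simpl; [lra|]. pose proof (H x). lra.
Qed.

Lemma Rsum_scal {I} (c : R) (f : I -> R) L :
  Rsum (fun i => (c * f i)%R) L = (c * Rsum f L)%R.
Proof. induction L as [|x L IH]; simpl; [|rewrite IH]; ring. Qed.

Lemma Rsum_plus {I} (f g : I -> R) L :
  Rsum (fun i => (f i + g i)%R) L = (Rsum f L + Rsum g L)%R.
Proof. induction L as [|x L IH]; simpl; [|rewrite IH]; ring. Qed.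

Lemma Cmod_Csum {I} (f : I -> C) L : (Cmod (Csum f L) <= Rsum (fun i => Cmod (f i)) L)%R.
Proof.
  induction L as [|x L IH]; simpl; [rewrite Cmod_0; lra|].
  pose proof (Cmod_triangle (f x) (Csum f L)). lra.
Qed.

Lemma incl_split {I} (L0 L : list I) :
  NoDup L0 -> NoDup L -> incl L0 L ->
  exists K, Permutation L (L0 ++ K) /\ NoDup K /\ (forall i, In i K -> ~ In i L0).
Proof.
  intros H0; revert L. induction H0 as [|x L0 Hx H0 IH]; intros L HL Hi.
  - exists L. repeat split; auto.
  - destruct (in_split x L) as [A [B E]]; [apply Hi; left; auto|]. subst L.
    assert (HAB : NoDup (A ++ B) /\ ~ In x (A ++ B)).
    { split; [eapply NoDup_remove_1; eauto|eapply NoDup_remove_2; eauto]. }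
    destruct (IH (A ++ B)) as [K [P [HK D]]]; [tauto| |].
    { intros y Hy. assert (In y (A ++ x :: B)) by (apply Hi; right; auto).
      rewrite in_app_iff in H |- *. simpl in H. destruct H as [|[|]]; auto. subst; tauto. }
    exists K. split; [|split; auto].
    + rewrite <- Permutation_middle. simpl. now constructor.
    + intros i Hi2 [E|E]; [|eapply D; eauto]. subst i. apply (proj2 HAB).
      eapply Permutation_in; [symmetry; eauto|]. apply in_or_app; auto.
Qed.

Lemma Rsum_incl {I} (g : I -> R) L0 L :
  (forall i, (0 <= g i)%R) -> NoDup L0 -> NoDup L -> incl L0 L -> (Rsum g L0 <= Rsum g L)%R.
Proof.
  intros Hg H0 HL Hi. destruct (incl_split L0 L H0 HL Hi) as [K [P _]].
  rewrite (Rsum_perm g _ _ P), Rsum_app. pose proof (Rsum_nonneg g K Hg). lra.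
Qed.

Lemma NoDup_same_elements {I} (L : list I) :
  exists L', NoDup L' /\ (forall i, In i L <-> In i L').
Proof.
  induction L as [|x L [L' [H1 H2]]].
  - exists []. split; [constructor|tauto].
  - destruct (classic (In x L')) as [Hx|Hx].
    + exists L'. split; auto. intros i. simpl. rewrite H2. intuition (subst; auto).
    + exists (x :: L'). split; [constructor; auto|]. intros i; simpl. rewrite H2. tauto.
Qed.

Lemma NoDup_upper_bound {I} (L1 L2 : list I) :
  exists L, NoDup L /\ incl L1 L /\ incl L2 L.
Proof.
  destruct (NoDup_same_elements (L1 ++ L2)) as [L [H1 H2]]. exists L. split; auto.
  split; intros i Hi; apply H2; apply in_or_app; auto.
Qed.

Lemma Cmod_sub_triangle (x y z : C) : (Cmod (x - z) <= Cmod (x - y) + Cmod (y - z))%R.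
Proof. replace (x - z) with ((x - y) + (y - z)) by ring. apply Cmod_triangle. Qed.

Lemma Cmod_sub_sym (x y : C) : Cmod (x - y) = Cmod (y - x).
Proof. rewrite <- Cmod_opp. f_equal. ring. Qed.

Lemma Cmod_small_0 (x : C) : (forall eps, (0 < eps)%R -> (Cmod x <= eps)%R) -> x = 0.
Proof.
  intros H. apply Cmod_eq_0. pose proof (Cmod_ge_0 x).
  destruct (Rle_lt_or_eq_dec _ _ H0) as [H1|H1]; auto.
  assert (H2 : (0 < Cmod x / 2)%R) by lra. pose proof (H _ H2). lra.
Qed.

Lemma Cmod_small_eq (x y : C) : (forall eps, (0 < eps)%R -> (Cmod (x - y) <= eps)%R) -> x = y.
Proof. intros H. apply Ceq_minus. now apply Cmod_small_0. Qed.

Lemma has_sum_unique {I} (f : I -> C) l1 l2 : has_sum f l1 -> has_sum f l2 -> l1 = l2.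
Proof.
  intros H1 H2. apply Cmod_small_eq. intros eps He.
  destruct (H1 (eps / 2)%R) as [L1 A1]; [lra|]. destruct (H2 (eps / 2)%R) as [L2 A2]; [lra|].
  destruct (NoDup_upper_bound L1 L2) as [L [HL [B1 B2]]].
  pose proof (A1 L HL B1). pose proof (A2 L HL B2).
  pose proof (Cmod_sub_triangle l1 (Csum f L) l2). rewrite (Cmod_sub_sym l1 (Csum f L)) in H3. lra.
Qed.

Lemma has_sum_ext {I} (f g : I -> C) l : (forall i, f i = g i) -> has_sum f l -> has_sum g l.
Proof.
  intros E H eps He. destruct (H eps He) as [L HL]. exists L. intros L' N' J.
  rewrite <- (Csum_ext f g L'); auto.
Qed.

Lemma has_sum_plus {I} (f g : I -> C) a b :
  has_sum f a -> has_sum g b -> has_sum (fun i => f i + g i) (a + b).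
Proof.
  intros H1 H2 eps He.
  destruct (H1 (eps / 2)%R) as [L1 A1]; [lra|]. destruct (H2 (eps / 2)%R) as [L2 A2]; [lra|].
  exists (L1 ++ L2). intros L HL Hi.
  assert (B1 : incl L1 L) by (intros i ?; apply Hi, in_or_app; auto).
  assert (B2 : incl L2 L) by (intros i ?; apply Hi, in_or_app; auto).
  pose proof (A1 L HL B1). pose proof (A2 L HL B2). rewrite Csum_plus.
  replace (Csum f L + Csum g L - (a + b)) with ((Csum f L - a) + (Csum g L - b)) by ring.
  pose proof (Cmod_triangle (Csum f L - a) (Csum g L - b)). lra.
Qed.

Lemma has_sum_scal {I} (c : C) (f : I -> C) l :
  has_sum f l -> has_sum (fun i => c * f i) (c * l).
Proof.
  intros H eps He. pose proof (Cmod_ge_0 c).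
  destruct (H (eps / (Cmod c + 1))%R) as [L A]; [apply Rdiv_lt_0_compat; lra|].
  exists L. intros L' HL Hi. pose proof (A L' HL Hi). rewrite Csum_scal.
  replace (c * Csum f L' - c * l) with (c * (Csum f L' - l)) by ring. rewrite Cmod_mult.
  apply Rle_lt_trans with (Cmod c * (eps / (Cmod c + 1)))%R.
  - apply Rmult_le_compat_l; lra.
  - apply Rmult_lt_reg_r with (Cmod c + 1)%R; [lra|].
    replace (Cmod c * (eps / (Cmod c + 1)) * (Cmod c + 1))%R with (Cmod c * eps)%R by (field; lra).
    nra.
Qed.

Lemma has_sum_zero {I} : has_sum (fun _ : I => 0) 0.
Proof.
  intros eps He. exists []. intros L _ _.
  replace (Csum (fun _ : I => RtoC 0) L) with (RtoC 0).
  - replace (0 - 0) with (RtoC 0) by ring. rewrite Cmod_0; auto.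
  - induction L as [|x L IH]; simpl; [|rewrite <- IH]; ring.
Qed.

Lemma has_sum_single {I} (f : I -> C) i0 :
  (forall i, i <> i0 -> f i = 0) -> has_sum f (f i0).
Proof.
  intros H eps He. exists [i0]. intros L HL Hi.
  destruct (incl_split [i0] L) as [K [P [HK D]]]; auto.
  { constructor; [simpl; tauto|constructor]. }
  rewrite (Csum_perm f _ _ P), Csum_app. simpl.
  replace (Csum f K) with (RtoC 0).
  - replace (f i0 + 0 + 0 - f i0) with (RtoC 0) by ring. rewrite Cmod_0; auto.
  - symmetry. rewrite (Csum_ext f (fun _ => 0 * 0)).
    + rewrite Csum_scal. ring.
    + intros i Hi2. rewrite H; [ring|]. intros ->. apply (D i0 Hi2). left; auto.
Qed.

Lemma Rsummable_le {I} (g h : I -> R) :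
  (forall i, (g i <= h i)%R) -> Rsummable h -> Rsummable g.
Proof.
  intros H [M HM]. exists M. intros L HL. apply Rle_trans with (Rsum h L); auto.
  apply Rsum_le; auto.
Qed.

Lemma Rsummable_scal {I} (c : R) (g : I -> R) :
  (0 <= c)%R -> Rsummable g -> Rsummable (fun i => (c * g i)%R).
Proof.
  intros Hc [M HM]. exists (c * M)%R. intros L HL. rewrite Rsum_scal.
  apply Rmult_le_compat_l; auto.
Qed.

Lemma Rsummable_plus {I} (g h : I -> R) :
  Rsummable g -> Rsummable h -> Rsummable (fun i => (g i + h i)%R).
Proof.
  intros [M HM] [M' HM']. exists (M + M')%R. intros L HL. rewrite Rsum_plus.
  specialize (HM L HL); specialize (HM' L HL); lra.
Qed.

Lemma Rsummable_sup {I} (g : I -> R) :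
  Rsummable g -> exists S : R,
    (forall L, NoDup L -> (Rsum g L <= S)%R) /\
    (forall eps, (0 < eps)%R -> exists L, NoDup L /\ (S - eps < Rsum g L)%R).
Proof.
  intros [M HM].
  destruct (completeness (fun x => exists L, NoDup L /\ x = Rsum g L)) as [S [U V]].
  - exists M. intros x [L [HL ->]]. auto.
  - exists 0%R, []. split; [constructor|reflexivity].
  - exists S. split.
    + intros L HL. apply U. eauto.
    + intros eps He. apply NNPP. intros N.
      assert (S <= S - eps)%R; [|lra]. apply V. intros x [L [HL ->]].
      destruct (Rle_dec (Rsum g L) (S - eps)) as [|Hn]; auto.
      exfalso; apply N; exists L; split; auto; lra.
Qed.

Lemma Rsummable_tail {I} (g : I -> R) :
  Rsummable g -> forall eps, (0 < eps)%R ->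
  exists L0, NoDup L0 /\ forall L, NoDup L -> (forall i, In i L -> ~ In i L0) -> (Rsum g L <= eps)%R.
Proof.
  intros H eps He. destruct (Rsummable_sup g H) as [S [U V]].
  destruct (V eps He) as [L0 [H0 E]]. exists L0. split; auto. intros L HL D.
  assert (NoDup (L0 ++ L)).
  { apply NoDup_app; auto. intros i A B. eapply D; eauto. }
  pose proof (U _ H1). rewrite Rsum_app in H2. lra.
Qed.

Lemma Csum_RtoC {I} (g : I -> R) L : Csum (fun i => RtoC (g i)) L = RtoC (Rsum g L).
Proof. induction L as [|x L IH]; simpl; [|rewrite IH, <- RtoC_plus]; reflexivity. Qed.

Lemma Rsummable_nonneg_has_sum {I} (g : I -> R) :
  (forall i, (0 <= g i)%R) -> Rsummable g -> exists l, has_sum (fun i => RtoC (g i)) l.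
Proof.
  intros Hg H. destruct (Rsummable_sup g H) as [S [U V]]. exists (RtoC S).
  intros eps He. destruct (V eps He) as [L0 [H0 E]]. exists L0. intros L HL Hi.
  rewrite Csum_RtoC, <- RtoC_minus, Cmod_R. pose proof (U L HL).
  pose proof (Rsum_incl g L0 L Hg H0 HL Hi). apply Rabs_def1; lra.
Qed.

(** Real and imaginary parts are handled separately, each as a difference of positive and negative
    parts; a nonnegative family with bounded finite sums converges to their supremum. *)
Lemma summable_has_sum {I} (f : I -> C) : summable f -> exists l, has_sum f l.
Proof.
  intros H.
  assert (A : forall g : I -> R, (forall i, Rabs (g i) <= Cmod (f i))%R ->
              exists l, has_sum (fun i => RtoC (g i)) l).
  { intros g Hg.
    destruct (Rsummable_nonneg_has_sum (fun i => Rmax (g i) 0)) as [l1 H1].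
    { intros i. apply Rmax_r. }
    { eapply Rsummable_le; [|exact H]. intros i. simpl. apply Rmax_lub.
      - eapply Rle_trans; [apply Rle_abs|apply Hg].
      - apply Cmod_ge_0. }
    destruct (Rsummable_nonneg_has_sum (fun i => Rmax (- g i) 0)%R) as [l2 H2].
    { intros i. apply Rmax_r. }
    { eapply Rsummable_le; [|exact H]. intros i. simpl. apply Rmax_lub.
      - eapply Rle_trans; [apply Rle_abs|]. rewrite Rabs_Ropp. apply Hg.
      - apply Cmod_ge_0. }
    exists (l1 + (-(1)) * l2).
    refine (has_sum_ext _ _ _ _ (has_sum_plus _ _ _ _ H1 (has_sum_scal (-(1)) _ _ H2))).
    intros i. simpl.
    rewrite <- (RtoC_opp 1), <- RtoC_mult, <- RtoC_plus. f_equal.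
    unfold Rmax. destruct (Rle_dec (g i) 0), (Rle_dec (- g i) 0); lra. }
  destruct (A (fun i => Re (f i))) as [l1 H1]; [intros i; apply re_le_Cmod|].
  destruct (A (fun i => Im (f i))) as [l2 H2].
  { intros i. eapply Rle_trans; [apply Rmax_r|apply Rmax_Cmod]. }
  exists (l1 + Ci * l2).
  refine (has_sum_ext _ _ _ _ (has_sum_plus _ _ _ _ H1 (has_sum_scal Ci _ _ H2))).
  intros i. simpl. destruct (f i) as [x y]. unfold RtoC, Ci, Cplus, Cmult, Re, Im. simpl.
  f_equal; ring.
Qed.

(** Separating the list by the sign of [g] writes the absolute sum as a difference of two signed
    sums; this costs the factor 2. *)
Lemma Rsum_abs_le {I} (g : I -> R) (B : R) :
  (forall L, NoDup L -> (Rabs (Rsum g L) <= B)%R) ->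
  forall L, NoDup L -> (Rsum (fun i => Rabs (g i)) L <= 2 * B)%R.
Proof.
  intros H L HL.
  assert (A : exists P N, NoDup P /\ NoDup N /\ incl P L /\ incl N L /\
            Rsum (fun i => Rabs (g i)) L = (Rsum g P - Rsum g N)%R).
  { clear H. induction HL as [|x L Hx HL (P & N & H1 & H2 & H3 & H4 & E)].
    - exists [], []. repeat split; try constructor; try (intros y []). simpl; ring.
    - simpl. rewrite E. destruct (Rle_dec 0 (g x)) as [Hg|Hg].
      + exists (x :: P), N. repeat split; auto.
        * constructor; auto.
        * intros y [->|Hy]; [left|right]; auto.
        * intros y Hy; right; auto.
        * simpl. rewrite Rabs_pos_eq; auto. ring.
      + exists P, (x :: N). repeat split; auto.
        * constructor; auto.
        * intros y Hy; right; auto.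
        * intros y [->|Hy]; [left|right]; auto.
        * simpl. rewrite Rabs_left; [ring|lra]. }
  destruct A as (P & N & H1 & H2 & _ & _ & ->).
  pose proof (H P H1). pose proof (H N H2).
  pose proof (Rle_abs (Rsum g P)). pose proof (Rle_abs (- Rsum g N)).
  rewrite Rabs_Ropp in H5. lra.
Qed.

Lemma Re_Csum {I} (f : I -> C) L : Re (Csum f L) = Rsum (fun i => Re (f i)) L.
Proof. induction L as [|x L IH]; simpl; [|rewrite <- IH]; reflexivity. Qed.

Lemma Im_Csum {I} (f : I -> C) L : Im (Csum f L) = Rsum (fun i => Im (f i)) L.
Proof. induction L as [|x L IH]; simpl; [|rewrite <- IH]; reflexivity. Qed.

Lemma Cmod_le_Re_Im (c : C) : (Cmod c <= Rabs (Re c) + Rabs (Im c))%R.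
Proof.
  replace c with (RtoC (Re c) + Ci * RtoC (Im c)) at 1.
  - eapply Rle_trans; [apply Cmod_triangle|]. rewrite Cmod_mult, Cmod_Ci, !Cmod_R. lra.
  - destruct c as [x y]. unfold RtoC, Ci, Cplus, Cmult, Re, Im. simpl. f_equal; ring.
Qed.

(** Beyond [L0] all finite sums lie within 1 of [l]. Any list can be completed by the elements of
    [L0] that it misses, whose contribution is bounded, so all finite sums are bounded; then
    [Rsum_abs_le] applies to both components. *)
Lemma has_sum_summable {I} (f : I -> C) l : has_sum f l -> summable f.
Proof.
  intros H. destruct (H 1%R) as [L0' A]; [lra|].
  destruct (NoDup_same_elements L0') as [L0 [H0 E0]].
  assert (A' : forall L, NoDup L -> incl L0 L -> (Cmod (Csum f L - l) < 1)%R).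
  { intros L HL Hi. apply A; auto. intros i Hi2. apply Hi, E0; auto. }
  set (B := (Rsum (fun i => Cmod (f i)) L0 + Cmod l + 1)%R).
  assert (HB : forall L, NoDup L -> (Cmod (Csum f L) <= B + Rsum (fun i => Cmod (f i)) L0)%R).
  { intros L HL.
    assert (exists K, NoDup K /\ incl K L0 /\ NoDup (L ++ K) /\ incl L0 (L ++ K)) as (K & HK & HKL & N & J).
    { clear -HL H0. induction H0 as [|x L0 Hx H0 (K & H1 & H2 & H3 & H4)].
      - exists []. rewrite app_nil_r. repeat split; auto; try constructor; intros y [].
      - destruct (classic (In x L)) as [Hi|Hi].
        + exists K. repeat split; auto.
          * intros y Hy; right; auto.
          * intros y [->|Hy]; [apply in_or_app; auto|auto].
        + exists (x :: K). repeat split; auto.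
          * constructor; auto.
          * intros y [->|Hy]; [left|right]; auto.
          * eapply Permutation_NoDup; [apply Permutation_middle|]. constructor; auto.
            intros Hy; apply in_app_or in Hy. destruct Hy; auto.
          * intros y [->|Hy]; [apply in_or_app; right; left; auto|].
            apply H4 in Hy. apply in_app_or in Hy. apply in_or_app. simpl. tauto. }
    pose proof (A' _ N J). rewrite Csum_app in H1.
    pose proof (Cmod_Csum f K).
    pose proof (Rsum_incl (fun i => Cmod (f i)) K L0 (fun i => Cmod_ge_0 _) HK H0 HKL).
    replace (Csum f L) with ((Csum f L + Csum f K - l) + l + - Csum f K) by ring.
    eapply Rle_trans; [apply Cmod_triangle|]. rewrite Cmod_opp.
    pose proof (Cmod_triangle (Csum f L + Csum f K - l) l).
    pose proof (Rsum_nonneg (fun i => Cmod (f i)) L0 (fun i => Cmod_ge_0 _)). unfold B. lra. }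
  set (B' := (B + Rsum (fun i => Cmod (f i)) L0)%R) in *.
  exists (2 * B' + 2 * B')%R. intros L HL.
  apply Rle_trans with (Rsum (fun i => Rabs (Re (f i)) + Rabs (Im (f i)))%R L).
  { apply Rsum_le. intros; apply Cmod_le_Re_Im. }
  rewrite Rsum_plus. apply Rplus_le_compat.
  - apply (Rsum_abs_le (fun i => Re (f i))); auto. intros K HK.
    rewrite <- Re_Csum. eapply Rle_trans; [apply re_le_Cmod|]. auto.
  - apply (Rsum_abs_le (fun i => Im (f i))); auto. intros K HK.
    rewrite <- Im_Csum. eapply Rle_trans; [|apply (HB K HK)].
    eapply Rle_trans; [apply Rmax_r|apply Rmax_Cmod].
Qed.

Lemma Rsummable_inj {I J} (phi : J -> I) (g : I -> R) :
  (forall a b, phi a = phi b -> a = b) -> Rsummable g -> Rsummable (fun j => g (phi j)).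
Proof.
  intros Hphi [M HM]. exists M. intros L HL. rewrite <- Rsum_map. apply HM.
  apply FinFun.Injective_map_NoDup; auto.
Qed.

Lemma has_sum_bij {I J} (phi : J -> I) (psi : I -> J) (f : I -> C) l :
  (forall j, psi (phi j) = j) -> (forall i, phi (psi i) = i) ->
  has_sum f l -> has_sum (fun j => f (phi j)) l.
Proof.
  intros H1 H2 H eps He. destruct (H eps He) as [L A]. exists (map psi L).
  intros L' HL Hi. rewrite <- Csum_map. apply A.
  - apply FinFun.Injective_map_NoDup; auto. intros a b E. rewrite <- (H1 a), <- (H1 b), E; auto.
  - intros i Hi2. rewrite <- (H2 i). apply in_map. apply Hi. apply in_map; auto.
Qed.

(** Rows are added one at a time, each using half of the error still allowed. Keeping the points of
    [L] above [K] is what lets [has_sum_rows] invoke the convergence of the double sum. *)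
Lemma Csum_rows_approx {I J} (F : I * J -> C) (g : I -> C) (L : list (I * J)) :
  (forall i, has_sum (fun j => F (i, j)) (g i)) ->
  forall K, NoDup K -> forall delta, (0 < delta)%R ->
  exists L', NoDup L' /\ (forall p, In p L -> In (fst p) K -> In p L') /\
    (forall p, In p L' -> In (fst p) K) /\ (Cmod (Csum F L' - Csum g K) < delta)%R.
Proof.
  intros Hg K HK. induction HK as [|x K Hx HK IH]; intros delta Hd.
  - exists []. repeat split; try constructor; try (intros p []); simpl; auto.
    replace (0 - 0) with (RtoC 0) by ring. rewrite Cmod_0; auto.
  - destruct (IH (delta / 2)%R) as (L1 & N1 & A1 & B1 & C1); [lra|].
    destruct (Hg x (delta / 2)%R) as [Lx Ax]; [lra|].
    destruct (NoDup_upper_bound Lx (map snd L)) as [Lj [Nj [Ij1 Ij2]]].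
    pose proof (Ax Lj Nj Ij1).
    exists (map (fun j => (x, j)) Lj ++ L1). repeat split.
    + apply NoDup_app; auto.
      * apply FinFun.Injective_map_NoDup; auto. intros a b E; congruence.
      * intros p Hp Hp1. apply in_map_iff in Hp. destruct Hp as [j [<- _]].
        apply B1 in Hp1. simpl in Hp1. auto.
    + intros [i j] Hp [E|E]; apply in_or_app.
      * left. simpl in E; subst i. apply in_map. apply Ij2. apply (in_map snd L (x, j)); auto.
      * right; auto.
    + intros p Hp. apply in_app_or in Hp. destruct Hp as [Hp|Hp]; [left|right; auto].
      apply in_map_iff in Hp. destruct Hp as [j [<- _]]; auto.
    + rewrite Csum_app, Csum_map. simpl.
      match goal with |- (Cmod (?a + ?b - (?c + ?d)) < _)%R =>
        replace (a + b - (c + d)) with ((a - c) + (b - d)) by ring end.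
      eapply Rle_lt_trans; [apply Cmod_triangle|]. lra.
Qed.

(** Summation by rows: the device by which [kron_theta] and [fF_laurent] collect coefficients. *)
Lemma has_sum_rows {I J} (F : I * J -> C) (g : I -> C) l :
  has_sum F l -> (forall i, has_sum (fun j => F (i, j)) (g i)) -> has_sum g l.
Proof.
  intros H Hg eps He. destruct (H (eps / 2)%R) as [L A]; [lra|].
  exists (map fst L). intros K HK Hi.
  destruct (Csum_rows_approx F g L Hg K HK (eps / 2)%R) as (L' & N' & A' & _ & C'); [lra|].
  assert (B : incl L L') by (intros p Hp; apply A'; auto; apply Hi, in_map; auto).
  pose proof (A L' N' B).
  pose proof (Cmod_sub_triangle (Csum g K) (Csum F L') l).
  rewrite (Cmod_sub_sym (Csum g K) (Csum F L')) in H1. lra.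
Qed.

Lemma summable_row {I J} (F : I * J -> C) i : summable F -> summable (fun j => F (i, j)).
Proof.
  intros H. apply (Rsummable_inj (fun j => (i, j)) (fun p => Cmod (F p))); auto.
  intros a b E; congruence.
Qed.

Lemma Rsum_list_prod {I J} (g : I -> R) (h : J -> R) L1 L2 :
  Rsum (fun p => (g (fst p) * h (snd p))%R) (list_prod L1 L2) = (Rsum g L1 * Rsum h L2)%R.
Proof.
  induction L1 as [|x L1 IH]; simpl; [ring|]. rewrite Rsum_app, Rsum_map, IH. simpl.
  rewrite Rsum_scal. ring.
Qed.

Lemma NoDup_list_prod {I J} (L1 : list I) (L2 : list J) :
  NoDup L1 -> NoDup L2 -> NoDup (list_prod L1 L2).
Proof.
  intros H1 H2. induction H1 as [|x L1 Hx H1 IH]; simpl; [constructor|].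
  apply NoDup_app; auto.
  - apply FinFun.Injective_map_NoDup; auto. intros a b E; congruence.
  - intros p Hp Hq. apply in_map_iff in Hp. destruct Hp as [j [<- _]].
    apply in_prod_iff in Hq. tauto.
Qed.

Lemma Rsummable_prod {I J} (g : I -> R) (h : J -> R) :
  (forall i, (0 <= g i)%R) -> (forall j, (0 <= h j)%R) -> Rsummable g -> Rsummable h ->
  Rsummable (fun p : I * J => (g (fst p) * h (snd p))%R).
Proof.
  intros Hg Hh [M HM] [M' HM']. exists (M * M')%R. intros L HL.
  destruct (NoDup_same_elements (map fst L)) as [L1 [N1 E1]].
  destruct (NoDup_same_elements (map snd L)) as [L2 [N2 E2]].
  apply Rle_trans with (Rsum (fun p => (g (fst p) * h (snd p))%R) (list_prod L1 L2)).
  - apply Rsum_incl; auto.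
    + intros i. apply Rmult_le_pos; auto.
    + apply NoDup_list_prod; auto.
    + intros [i j] Hp. apply in_prod_iff. split; [apply E1|apply E2].
      * apply (in_map fst L (i, j)); auto.
      * apply (in_map snd L (i, j)); auto.
  - rewrite Rsum_list_prod. apply Rmult_le_compat; auto using Rsum_nonneg.
Qed.

(** Absolute summability of the factors yields the existence of the double sum; its value is then
    read off by summing rows. *)
Lemma has_sum_mult {I J} (f : I -> C) (g : J -> C) a b :
  has_sum f a -> has_sum g b -> has_sum (fun p : I * J => f (fst p) * g (snd p)) (a * b).
Proof.
  intros Hf Hg.
  destruct (summable_has_sum (fun p : I * J => f (fst p) * g (snd p))) as [l Hl].
  { eapply Rsummable_le; [|apply (Rsummable_prod (fun i => Cmod (f i)) (fun j => Cmod (g j)))].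
    - intros p. rewrite Cmod_mult. simpl. lra.
    - intros; apply Cmod_ge_0.
    - intros; apply Cmod_ge_0.
    - eapply has_sum_summable; eauto.
    - eapply has_sum_summable; eauto. }
  assert (H : has_sum (fun i => f i * b) l).
  { eapply has_sum_rows; [exact Hl|]. intros i. simpl. now apply has_sum_scal. }
  replace (a * b) with l; auto. apply (has_sum_unique _ _ _ H).
  rewrite Cmult_comm. eapply has_sum_ext; [|apply has_sum_scal; exact Hf].
  intros i; simpl; ring.
Qed.

(** Any duplicate-free list over [J] is, up to permutation, an image under [phi1] followed by one
    under [phi2]. Applied to cut the integers at 0 and to separate even from odd indices. *)
Lemma has_sum_cover {I1 I2 J} (phi1 : I1 -> J) (phi2 : I2 -> J) (f : J -> C) a b :
  (forall x y, phi1 x = phi1 y -> x = y) -> (forall x y, phi2 x = phi2 y -> x = y) ->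
  (forall x y, phi1 x <> phi2 y) -> (forall j, (exists x, phi1 x = j) \/ (exists y, phi2 y = j)) ->
  has_sum (fun i => f (phi1 i)) a -> has_sum (fun i => f (phi2 i)) b -> has_sum f (a + b).
Proof.
  intros I1' I2' D Cv Ha Hb eps He.
  destruct (Ha (eps / 2)%R) as [L1 A1]; [lra|]. destruct (Hb (eps / 2)%R) as [L2 A2]; [lra|].
  exists (map phi1 L1 ++ map phi2 L2). intros L HL Hi.
  assert (S : exists K1 K2, NoDup K1 /\ NoDup K2 /\ Permutation L (map phi1 K1 ++ map phi2 K2)).
  { clear Hi A1 A2. induction HL as [|x L Hx HL (K1 & K2 & N1 & N2 & P)].
    - exists [], []. repeat split; constructor.
    - assert (Hx' : ~ In x (map phi1 K1 ++ map phi2 K2)).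
      { intros Hq; apply Hx. eapply Permutation_in; [symmetry; eauto|auto]. }
      rewrite in_app_iff in Hx'.
      destruct (Cv x) as [[i <-]|[i <-]].
      + exists (i :: K1), K2. repeat split; auto.
        * constructor; auto. intros Hq; apply Hx'. left. now apply in_map.
        * simpl. now constructor.
      + exists K1, (i :: K2). repeat split; auto.
        * constructor; auto. intros Hq; apply Hx'. right. now apply in_map.
        * simpl. rewrite <- Permutation_middle. now constructor. }
  destruct S as (K1 & K2 & N1 & N2 & P).
  assert (B1 : incl L1 K1).
  { intros i Hi1. assert (Hq : In (phi1 i) (map phi1 K1 ++ map phi2 K2)).
    { eapply Permutation_in; [eauto|]. apply Hi, in_or_app. left; now apply in_map. }
    apply in_app_or in Hq. destruct Hq as [Hq|Hq]; apply in_map_iff in Hq; destruct Hq as [k [E Hk]].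
    - apply I1' in E. now subst.
    - symmetry in E. now apply D in E. }
  assert (B2 : incl L2 K2).
  { intros i Hi1. assert (Hq : In (phi2 i) (map phi1 K1 ++ map phi2 K2)).
    { eapply Permutation_in; [eauto|]. apply Hi, in_or_app. right; now apply in_map. }
    apply in_app_or in Hq. destruct Hq as [Hq|Hq]; apply in_map_iff in Hq; destruct Hq as [k [E Hk]].
    - now apply D in E.
    - apply I2' in E. now subst. }
  pose proof (A1 K1 N1 B1). pose proof (A2 K2 N2 B2).
  rewrite (Csum_perm f _ _ P), Csum_app, !Csum_map.
  match goal with |- (Cmod (?x + ?y - (?c + ?d)) < _)%R =>
    replace (x + y - (c + d)) with ((x - c) + (y - d)) by ring end.
  eapply Rle_lt_trans; [apply Cmod_triangle|]. lra.
Qed.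

Lemma has_sum_tail_bound {I} (f : I -> C) (g : I -> R) l L0 eps :
  NoDup L0 -> (forall i, (Cmod (f i) <= g i)%R) ->
  (forall L, NoDup L -> (forall i, In i L -> ~ In i L0) -> (Rsum g L <= eps)%R) ->
  has_sum f l -> (Cmod (l - Csum f L0) <= eps)%R.
Proof.
  intros H0 Hg HT H. apply le_epsilon. intros d Hd.
  destruct (H d Hd) as [L1 A1]. destruct (NoDup_upper_bound L0 L1) as [L [HL [B0 B1]]].
  pose proof (A1 L HL B1). destruct (incl_split L0 L H0 HL B0) as [K [P [HK D]]].
  pose proof (Cmod_sub_triangle l (Csum f L) (Csum f L0)).
  rewrite (Cmod_sub_sym l (Csum f L)) in H2.
  replace (Csum f L - Csum f L0) with (Csum f K) in H2.
  - pose proof (Cmod_Csum f K).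
    pose proof (Rsum_le (fun i => Cmod (f i)) g K (fun i _ => Hg i)).
    pose proof (HT K HK D). lra.
  - rewrite (Csum_perm f _ _ P), Csum_app. ring.
Qed.

(** * Limits of complex sequences and dominated convergence *)

Lemma Cto_unique u l1 l2 : Cto u l1 -> Cto u l2 -> l1 = l2.
Proof.
  intros H1 H2. apply Cmod_small_eq. intros eps He.
  destruct (H1 (eps / 2)%R) as [N1 A1]; [lra|]. destruct (H2 (eps / 2)%R) as [N2 A2]; [lra|].
  pose proof (A1 (max N1 N2) (Nat.le_max_l _ _)). pose proof (A2 (max N1 N2) (Nat.le_max_r _ _)).
  pose proof (Cmod_sub_triangle l1 (u (max N1 N2)) l2). rewrite (Cmod_sub_sym l1 (u _)) in H3. lra.
Qed.

Lemma Cto_ext u v l : (forall n, u n = v n) -> Cto u l -> Cto v l.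
Proof.
  intros E H eps He. destruct (H eps He) as [N A]. exists N. intros n Hn. rewrite <- E; auto.
Qed.

Lemma Cto_const c : Cto (fun _ => c) c.
Proof.
  intros eps He. exists O. intros. replace (c - c) with (RtoC 0) by ring. rewrite Cmod_0; auto.
Qed.

Lemma Cto_plus u v a b : Cto u a -> Cto v b -> Cto (fun n => u n + v n) (a + b).
Proof.
  intros H1 H2 eps He.
  destruct (H1 (eps / 2)%R) as [N1 A1]; [lra|]. destruct (H2 (eps / 2)%R) as [N2 A2]; [lra|].
  exists (max N1 N2). intros n Hn. assert (K1 : (N1 <= n)%nat) by lia. assert (K2 : (N2 <= n)%nat) by lia.
  pose proof (A1 n K1). pose proof (A2 n K2).
  replace (u n + v n - (a + b)) with ((u n - a) + (v n - b)) by ring.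
  eapply Rle_lt_trans; [apply Cmod_triangle|]. lra.
Qed.

Lemma Cto_mult u v a b : Cto u a -> Cto v b -> Cto (fun n => u n * v n) (a * b).
Proof.
  intros H1 H2 eps He. pose proof (Cmod_ge_0 a). pose proof (Cmod_ge_0 b).
  set (d := Rmin 1 (eps / (Cmod a + Cmod b + 2))).
  assert (Hd : (0 < d)%R) by (apply Rmin_pos; [lra|apply Rdiv_lt_0_compat; lra]).
  assert (Hd1 : (d <= 1)%R) by apply Rmin_l.
  assert (Hd2 : (d * (Cmod a + Cmod b + 2) <= eps)%R).
  { apply Rle_trans with ((eps / (Cmod a + Cmod b + 2)) * (Cmod a + Cmod b + 2))%R.
    - apply Rmult_le_compat_r; [lra|apply Rmin_r].
    - right; field; lra. }
  destruct (H1 d Hd) as [N1 A1]. destruct (H2 d Hd) as [N2 A2].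
  exists (max N1 N2). intros n Hn. assert (K1 : (N1 <= n)%nat) by lia. assert (K2 : (N2 <= n)%nat) by lia.
  pose proof (A1 n K1). pose proof (A2 n K2).
  replace (u n * v n - a * b) with ((u n - a) * (v n - b) + (a * (v n - b) + b * (u n - a))) by ring.
  eapply Rle_lt_trans; [apply Cmod_triangle|].
  eapply Rle_lt_trans; [apply Rplus_le_compat_l, Cmod_triangle|]. rewrite !Cmod_mult.
  pose proof (Cmod_ge_0 (u n - a)). pose proof (Cmod_ge_0 (v n - b)). nra.
Qed.

Lemma Cto_scal c u a : Cto u a -> Cto (fun n => c * u n) (c * a).
Proof. intros H. apply Cto_mult; auto using Cto_const. Qed.

Lemma Cto_inv (u : nat -> C) (a : C) : a <> 0 -> Cto u a -> Cto (fun n => / u n) (/ a).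
Proof.
  intros Ha H eps He. pose proof (proj1 (Cmod_gt_0 a) Ha) as Ha'.
  set (d := Rmin (Cmod a / 2) (eps * (Cmod a * Cmod a) / 2)).
  assert (Hd : (0 < d)%R) by (apply Rmin_pos; [lra|]; apply Rdiv_lt_0_compat; [apply Rmult_lt_0_compat; [auto|nra]|lra]).
  destruct (H d Hd) as [N A]. exists N. intros n Hn. pose proof (A n Hn).
  assert (d <= Cmod a / 2)%R by apply Rmin_l.
  assert (d <= eps * (Cmod a * Cmod a) / 2)%R by apply Rmin_r.
  assert (Hu : (Cmod a / 2 < Cmod (u n))%R).
  { pose proof (Cmod_triangle (u n) (a - u n)). replace (u n + (a - u n)) with a in H3 by ring.
    rewrite (Cmod_sub_sym a) in H3. lra. }
  assert (Hun : u n <> 0) by (apply Cmod_gt_0; lra).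
  replace (/ u n - / a) with ((a - u n) * / (u n * a)) by (field; auto).
  rewrite Cmod_mult, Cmod_inv, Cmod_mult by (apply Cmult_neq_0; auto).
  rewrite (Cmod_sub_sym a).
  assert (0 < Cmod (u n) * Cmod a)%R by nra.
  apply Rmult_lt_reg_r with (Cmod (u n) * Cmod a)%R; auto.
  rewrite Rmult_assoc, Rinv_l by lra.
  assert (eps * (Cmod a * Cmod a) / 2 < eps * (Cmod (u n) * Cmod a))%R; [|lra].
  replace (eps * (Cmod a * Cmod a) / 2)%R with (eps * Cmod a * (Cmod a / 2))%R by field.
  replace (eps * (Cmod (u n) * Cmod a))%R with (eps * Cmod a * Cmod (u n))%R by ring.
  apply Rmult_lt_compat_l; auto. nra.
Qed.

Lemma Cto_shift u l (s : nat -> nat) : (forall n, (n <= s n)%nat) -> Cto u l -> Cto (fun n => u (s n)) l.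
Proof.
  intros Hs H eps He. destruct (H eps He) as [N A]. exists N. intros n Hn. apply A.
  specialize (Hs n). lia.
Qed.

Lemma Cto_Csum {I} (F : nat -> I -> C) (f : I -> C) L :
  (forall i, Cto (fun n => F n i) (f i)) -> Cto (fun n => Csum (F n) L) (Csum f L).
Proof.
  intros H. induction L as [|x L IH]; simpl; [apply Cto_const|]. apply Cto_plus; auto.
Qed.

(** Dominated convergence for series: outside one finite [L0] both tails are at most eps/4 uniformly
    in [n], and on [L0] the pointwise limits suffice. *)
Lemma has_sum_dominated {I} (F : nat -> I -> C) (f : I -> C) (g : I -> R) (u : nat -> C) l :
  Rsummable g -> (forall n i, (Cmod (F n i) <= g i)%R) -> (forall i, (Cmod (f i) <= g i)%R) ->
  (forall i, Cto (fun n => F n i) (f i)) ->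
  (forall n, has_sum (F n) (u n)) -> has_sum f l -> Cto u l.
Proof.
  intros Hg B1 B2 Hp Hu Hl eps He.
  destruct (Rsummable_tail g Hg (eps / 4)%R) as [L0 [N0 T]]; [lra|].
  destruct (Cto_Csum F f L0 Hp (eps / 4)%R) as [N A]; [lra|].
  exists N. intros n Hn. pose proof (A n Hn).
  pose proof (has_sum_tail_bound (F n) g (u n) L0 _ N0 (B1 n) T (Hu n)).
  pose proof (has_sum_tail_bound f g l L0 _ N0 B2 T Hl).
  pose proof (Cmod_sub_triangle (u n) (Csum (F n) L0) l).
  pose proof (Cmod_sub_triangle (Csum (F n) L0) (Csum f L0) l).
  rewrite (Cmod_sub_sym l) in H1. lra.
Qed.

Lemma has_sum_exhaust {I} (f : I -> C) l (Ls : nat -> list I) :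
  (forall N, NoDup (Ls N)) ->
  (forall i, exists N0, forall N, (N0 <= N)%nat -> In i (Ls N)) ->
  has_sum f l -> Cto (fun N => Csum f (Ls N)) l.
Proof.
  intros HN Hi H eps He. destruct (H eps He) as [L A].
  assert (E : exists N0, forall N, (N0 <= N)%nat -> incl L (Ls N)).
  { clear A. induction L as [|x L [N1 IH]].
    - exists O. intros N _ y [].
    - destruct (Hi x) as [N2 H2]. exists (max N1 N2). intros N HM y [->|Hy].
      + apply H2; lia.
      + apply (IH N); auto; lia. }
  destruct E as [N0 E]. exists N0. intros N HM. apply A; auto.
Qed.

(** An arbitrary value when [f] has no sum, so each use is accompanied by a summability proof or
    goes through [sumC_eq]. *)
Definition sumC {I : Type} (f : I -> C) : C := epsilon (inhabits (RtoC 0)) (has_sum f).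

Lemma sumC_spec {I} (f : I -> C) : summable f -> has_sum f (sumC f).
Proof. intros H. unfold sumC. apply epsilon_spec. now apply summable_has_sum. Qed.

Lemma sumC_eq {I} (f : I -> C) l : has_sum f l -> sumC f = l.
Proof.
  intros H. apply (has_sum_unique f); auto. apply sumC_spec. eapply has_sum_summable; eauto.
Qed.

Lemma Cto_Cconv (u : nat -> C) (l : C) : Cto u l <-> Cconv u l.
Proof.
  unfold Cconv. rewrite filterlim_locally. split.
  - intros H eps. destruct (H eps (cond_pos eps)) as [N A]. exists N. intros n Hn.
    apply C_NormedModule_mixin_compat1. exact (A n Hn).
  - intros H eps He.
    assert (He' : (0 < eps / 2)%R) by lra.
    destruct (H (mkposreal _ He')) as [N A]. exists N. intros n Hn.
    destruct (A n Hn) as [B1 B2]. eapply Rle_lt_trans; [apply Cmod_le_Re_Im|].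
    change (Rabs (Re (u n) - Re l) < eps / 2)%R in B1.
    change (Rabs (Im (u n) - Im l) < eps / 2)%R in B2.
    change (Rabs (Re (u n) - Re l) + Rabs (Im (u n) - Im l) < eps)%R. lra.
Qed.

Lemma Cto_Clim (u : nat -> C) (l : C) : Cto u l -> Clim u = l.
Proof.
  intros H. unfold Clim.
  assert (A : forall p : C -> R, (forall x y, (Rabs (p x - p y) <= Cmod (x - y))%R) ->
              real (Lim_seq (fun N => p (u N))) = p l).
  { intros p Hp. rewrite (is_lim_seq_unique _ (p l)); auto.
    apply is_lim_seq_spec. intros eps. destruct (H eps (cond_pos eps)) as [N B].
    exists N. intros n Hn. eapply Rle_lt_trans; [apply Hp|]. auto. }
  rewrite !A.
  - destruct l; reflexivity.
  - intros x y. change (Im x - Im y)%R with (Im (x - y)).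
    eapply Rle_trans; [apply Rmax_r|apply Rmax_Cmod].
  - intros x y. change (Re x - Re y)%R with (Re (x - y)). apply re_le_Cmod.
Qed.

(** * Box partial sums against unordered sums *)

Definition box (N : nat) : list Z :=
  map (fun i => (Z.of_nat i - Z.of_nat N)%Z) (seq 0 (S (2 * N))).

Lemma box_NoDup N : NoDup (box N).
Proof.
  apply FinFun.Injective_map_NoDup; [intros a b; lia|apply seq_NoDup].
Qed.

Lemma in_box N k : In k (box N) <-> (- Z.of_nat N <= k <= Z.of_nat N)%Z.
Proof.
  unfold box. rewrite in_map_iff. split.
  - intros [i [<- Hi]]. apply in_seq in Hi. lia.
  - intros H. exists (Z.to_nat (k + Z.of_nat N)). rewrite in_seq. lia.
Qed.

Lemma sum_n_Csum (f : nat -> C) n : sum_n f n = Csum f (seq 0 (S n)).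
Proof.
  induction n as [|n IH].
  - rewrite sum_O. change (f O = (f O + 0)%C). ring.
  - rewrite sum_Sn, IH, (seq_S (S n)), Csum_app.
    change ((Csum f (seq 0 (S n)) + f (S n))%C = (Csum f (seq 0 (S n)) + (f (S n) + 0))%C). ring.
Qed.

Lemma sum_n_Rsum (f : nat -> R) n : sum_n f n = Rsum f (seq 0 (S n)).
Proof.
  induction n as [|n IH].
  - rewrite sum_O. change (f O = (f O + 0)%R). ring.
  - rewrite sum_Sn, IH, (seq_S (S n)), Rsum_app.
    change ((Rsum f (seq 0 (S n)) + f (S n))%R = (Rsum f (seq 0 (S n)) + (f (S n) + 0))%R). ring.
Qed.

Lemma Zpartial_box (a : Z -> C) N : Zpartial a N = Csum a (box N).
Proof. unfold Zpartial, box. rewrite sum_n_Csum, Csum_map. reflexivity. Qed.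

Lemma Csum_list_prod {I J} (F : I * J -> C) L1 L2 :
  Csum F (list_prod L1 L2) = Csum (fun i => Csum (fun j => F (i, j)) L2) L1.
Proof.
  induction L1 as [|x L1 IH]; simpl; [reflexivity|]. now rewrite Csum_app, Csum_map, IH.
Qed.

Lemma Rsum_list_prod_iter {I J} (F : I * J -> R) L1 L2 :
  Rsum F (list_prod L1 L2) = Rsum (fun i => Rsum (fun j => F (i, j)) L2) L1.
Proof.
  induction L1 as [|x L1 IH]; simpl; [reflexivity|]. now rewrite Rsum_app, Rsum_map, IH.
Qed.

Definition uncur (a : Z -> Z -> C) (p : Z * Z) : C := a (fst p) (snd p).

Lemma Z2partial_box (a : Z -> Z -> C) N :
  Z2partial a N = Csum (uncur a) (list_prod (box N) (box N)).
Proof.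
  unfold Z2partial. rewrite Csum_list_prod. unfold box at 2. rewrite Csum_map, sum_n_Csum.
  apply Csum_ext. intros i _. unfold box. rewrite Csum_map, sum_n_Csum. reflexivity.
Qed.

Lemma Z2abs_box (a : Z -> Z -> C) N :
  sum_n (fun i => sum_n (fun j =>
     Cmod (a (Z.of_nat i - Z.of_nat N)%Z (Z.of_nat j - Z.of_nat N)%Z)) (2 * N)) (2 * N)
  = Rsum (fun p => Cmod (uncur a p)) (list_prod (box N) (box N)).
Proof.
  rewrite Rsum_list_prod_iter. unfold box at 2. rewrite Rsum_map, sum_n_Rsum.
  apply Rle_antisym; apply Rsum_le; intros i _; unfold box; rewrite Rsum_map, sum_n_Rsum;
    right; reflexivity.
Qed.

Lemma in_box2_eventually (p : Z * Z) :
  exists N0, forall N, (N0 <= N)%nat -> In p (list_prod (box N) (box N)).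
Proof.
  destruct p as [a b]. exists (Z.to_nat (Z.abs a + Z.abs b)). intros N HN.
  apply in_prod_iff. rewrite !in_box. lia.
Qed.

Lemma has_sum_Zsum (a : Z -> C) l : has_sum a l -> Zsum a = l.
Proof.
  intros H. apply Cto_Clim. eapply Cto_ext; [intros N; symmetry; apply Zpartial_box|].
  apply has_sum_exhaust; auto using box_NoDup.
  intros k. exists (Z.to_nat (Z.abs k)). intros N HN. apply in_box. lia.
Qed.

Lemma has_sum_Z2partial (a : Z -> Z -> C) l : has_sum (uncur a) l -> Cto (Z2partial a) l.
Proof.
  intros H. eapply Cto_ext; [intros N; symmetry; apply Z2partial_box|].
  apply has_sum_exhaust; auto using in_box2_eventually, NoDup_list_prod, box_NoDup.
Qed.

Lemma has_sum_Z2sum (a : Z -> Z -> C) l : has_sum (uncur a) l -> Z2sum a = l.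
Proof. intros H. apply Cto_Clim. now apply has_sum_Z2partial. Qed.

(** Every finite set of lattice points lies in some box, so the bound on absolute box sums gives
    absolute summability; the box limit must then be the unordered sum. *)
Lemma has_Z2sum_iff (a : Z -> Z -> C) l : has_Z2sum a l <-> has_sum (uncur a) l.
Proof.
  split.
  - intros [[M HM] H].
    assert (S : summable (uncur a)).
    { exists M. intros L HL.
      assert (E : exists N, incl L (list_prod (box N) (box N))).
      { clear HL. induction L as [|x L [N1 IH]].
        - exists O. intros y [].
        - destruct (in_box2_eventually x) as [N2 H2]. exists (max N1 N2). intros y [->|Hy].
          + apply H2; lia.
          + apply IH in Hy. destruct y as [y1 y2]. rewrite in_prod_iff, !in_box in *. lia. }
      destruct E as [N E]. pose proof (HM N) as HN. rewrite Z2abs_box in HN.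
      eapply Rle_trans; [|exact HN].
      apply Rsum_incl; auto using NoDup_list_prod, box_NoDup. intros; apply Cmod_ge_0. }
    destruct (summable_has_sum _ S) as [l' Hl].
    replace l with l'; auto. apply (Cto_unique (Z2partial a)).
    + now apply has_sum_Z2partial.
    + now apply Cto_Cconv.
  - intros H. split.
    + destruct (has_sum_summable _ _ H) as [M HM]. exists M. intros N.
      rewrite Z2abs_box. apply HM. auto using NoDup_list_prod, box_NoDup.
    + apply Cto_Cconv. now apply has_sum_Z2partial.
Qed.

(** * Integer powers and geometric series *)

Definition zpow (w : C) (k : Z) : C :=
  match k with
  | Z0 => 1
  | Zpos p => w ^ Pos.to_nat p
  | Zneg p => / w ^ Pos.to_nat p
  end.

Lemma zpow_0 (w : C) : zpow w 0 = 1.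
Proof. reflexivity. Qed.

Lemma zpow_1 (w : C) : zpow w 1 = w.
Proof. unfold zpow. simpl. ring. Qed.

Lemma zpow_of_nat (w : C) n : zpow w (Z.of_nat n) = w ^ n.
Proof.
  destruct n as [|n]; [reflexivity|]. unfold zpow, Z.of_nat. now rewrite SuccNat2Pos.id_succ.
Qed.

Lemma zpow_neg_nat (w : C) n : zpow w (- Z.of_nat n) = / w ^ n.
Proof.
  destruct n as [|n]; simpl.
  - field.
  - now rewrite SuccNat2Pos.id_succ.
Qed.

Lemma zpow_succ (w : C) k : w <> 0 -> zpow w (k + 1) = zpow w k * w.
Proof.
  intros Hw. destruct (Z_le_gt_dec 0 k) as [Hk|Hk].
  - rewrite <- (Z2Nat.id k) by lia. set (n := Z.to_nat k).
    replace (Z.of_nat n + 1)%Z with (Z.of_nat (S n)) by lia.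
    rewrite !zpow_of_nat, Cpow_S. ring.
  - replace k with (- Z.of_nat (S (Z.to_nat (- k - 1))))%Z at 2 by lia.
    set (n := Z.to_nat (- k - 1)).
    replace (k + 1)%Z with (- Z.of_nat n)%Z by lia.
    rewrite !zpow_neg_nat, Cpow_S. field. auto using Cpow_nz.
Qed.

Lemma zpow_nz (w : C) k : w <> 0 -> zpow w k <> 0.
Proof.
  intros Hw. destruct k as [|p|p]; simpl.
  - apply C1_nz.
  - now apply Cpow_nz.
  - intros E. assert (H : w ^ Pos.to_nat p * / w ^ Pos.to_nat p = 1).
    { apply Cinv_r. now apply Cpow_nz. }
    rewrite E in H. apply C1_nz. rewrite <- H. ring.
Qed.

Lemma zpow_add (w : C) a b : w <> 0 -> zpow w (a + b) = zpow w a * zpow w b.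
Proof.
  intros Hw. revert b. apply (Z.bi_induction (fun b => zpow w (a + b) = zpow w a * zpow w b)).
  - intros x y ->; tauto.
  - rewrite Z.add_0_r, zpow_0. ring.
  - intros b. replace (a + Z.succ b)%Z with (a + b + 1)%Z by lia.
    replace (Z.succ b) with (b + 1)%Z by lia. rewrite !zpow_succ by auto. split.
    + intros ->. ring.
    + intros H. apply (f_equal (fun x => x * / w)) in H.
      replace (zpow w (a + b)) with (zpow w (a + b) * w * / w) by (field; auto).
      rewrite H. field; auto.
Qed.

Lemma zpow_opp (w : C) a : w <> 0 -> zpow w (- a) = / zpow w a.
Proof.
  intros Hw. assert (H : zpow w a * zpow w (- a) = 1).
  { rewrite <- zpow_add by auto. now replace (a + - a)%Z with 0%Z by lia. }
  pose proof (zpow_nz w a Hw).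
  replace (zpow w (- a)) with (/ zpow w a * (zpow w a * zpow w (- a))) by (field; auto).
  rewrite H. ring.
Qed.

Lemma zpow_mul_l (u v : C) k : u <> 0 -> v <> 0 -> zpow (u * v) k = zpow u k * zpow v k.
Proof.
  intros Hu Hv. destruct k as [|p|p]; simpl; try ring.
  - apply Cpow_mult_l.
  - rewrite Cpow_mult_l. field. auto using Cpow_nz.
Qed.

Lemma zpow_inv_l (u : C) k : u <> 0 -> zpow (/ u) k = zpow u (- k).
Proof.
  intros Hu. destruct k as [|p|p]; simpl; try ring.
  - now apply Cpow_inv.
  - rewrite Cpow_inv by auto. field. auto using Cpow_nz.
Qed.

Lemma zpow_mul (w : C) a b : w <> 0 -> zpow (zpow w a) b = zpow w (a * b).
Proof.
  intros Hw. revert b. apply (Z.bi_induction (fun b => zpow (zpow w a) b = zpow w (a * b))).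
  - intros x y ->; tauto.
  - now rewrite Z.mul_0_r.
  - intros b. pose proof (zpow_nz w a Hw). replace (a * Z.succ b)%Z with (a * b + a)%Z by lia.
    replace (Z.succ b) with (b + 1)%Z by lia. rewrite zpow_succ, zpow_add by auto. split.
    + intros ->. ring.
    + intros H0. apply (f_equal (fun x => x * / zpow w a)) in H0.
      replace (zpow (zpow w a) b) with (zpow (zpow w a) b * zpow w a * / zpow w a) by (field; auto).
      rewrite H0. field; auto.
Qed.

Lemma zpow_one_l k : zpow 1 k = 1.
Proof.
  destruct k as [|p|p]; simpl; auto; rewrite Cpow_1_l; auto. field.
Qed.

Lemma Cmod_zpow (w : C) k : w <> 0 -> Cmod (zpow w k) = powerRZ (Cmod w) k.
Proof.
  intros Hw. destruct k as [|p|p]; simpl.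
  - apply Cmod_1.
  - apply Cmod_pow.
  - rewrite Cmod_inv by now apply Cpow_nz. now rewrite Cmod_pow.
Qed.

Definition sgn (k : Z) : C := zpow (-(1)) k.

Lemma Copp1_nz : -(1) <> 0.
Proof. intros E. apply C1_nz. replace (RtoC 1) with (- -(1)) by ring. rewrite E. ring. Qed.

Lemma sgn_add a b : sgn (a + b) = sgn a * sgn b.
Proof. apply zpow_add, Copp1_nz. Qed.

Lemma sgn_double a : sgn (2 * a) = 1.
Proof.
  unfold sgn. rewrite <- zpow_mul by apply Copp1_nz.
  replace (zpow (-(1)) 2) with (RtoC 1) by (unfold zpow; simpl; ring). apply zpow_one_l.
Qed.

Lemma sgn_1 : sgn 1 = -(1).
Proof. apply zpow_1. Qed.

Lemma sgn_even a b : (exists c, b = a + 2 * c)%Z -> sgn b = sgn a.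
Proof. intros [c ->]. rewrite sgn_add, sgn_double. ring. Qed.

Lemma sgn_odd a b : (exists c, b = a + 2 * c + 1)%Z -> sgn b = - sgn a.
Proof. intros [c ->]. rewrite !sgn_add, sgn_double, sgn_1. ring. Qed.

Lemma Cmod_sgn a : Cmod (sgn a) = 1%R.
Proof.
  unfold sgn. rewrite Cmod_zpow by apply Copp1_nz. rewrite Cmod_m1. destruct a; simpl; auto.
  - apply pow1.
  - rewrite pow1. apply Rinv_1.
Qed.

Lemma powerRZ_pos r k : (0 < r)%R -> (0 < powerRZ r k)%R.
Proof. intros. now apply powerRZ_lt. Qed.

Lemma powerRZ_le_anti r a b :
  (0 < r <= 1)%R -> (b <= a)%Z -> (powerRZ r a <= powerRZ r b)%R.
Proof.
  intros Hr H. replace a with (b + Z.of_nat (Z.to_nat (a - b)))%Z by lia.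
  rewrite powerRZ_add by lra. rewrite <- pow_powerRZ.
  assert (0 < powerRZ r b)%R by (apply powerRZ_pos; lra).
  assert (r ^ Z.to_nat (a - b) <= 1)%R.
  { rewrite <- (pow1 (Z.to_nat (a - b))). apply pow_incr. lra. }
  nra.
Qed.

Lemma powerRZ_le_base r s a :
  (0 < r <= s)%R -> (0 <= a)%Z -> (powerRZ r a <= powerRZ s a)%R.
Proof.
  intros H Ha. rewrite <- (Z2Nat.id a) by auto. rewrite <- !pow_powerRZ. apply pow_incr. lra.
Qed.

Lemma has_sum_nat_shift (f : nat -> C) l :
  has_sum (fun n => f (S n)) l -> has_sum f (f O + l).
Proof.
  intros H. apply (has_sum_cover (fun _ : unit => O) S); auto.
  - intros [] []; auto.
  - intros [|j]; [left; exists tt|right; exists j]; auto.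
  - apply (has_sum_single (fun _ : unit => f O) tt). intros []; tauto.
Qed.

Lemma Rsum_geom_seq r n : (r <> 1)%R -> Rsum (fun k => r ^ k)%R (seq 0 n) = ((1 - r ^ n) / (1 - r))%R.
Proof.
  intros Hr. induction n as [|n IH]; [simpl; field; lra|].
  rewrite seq_S, Rsum_app, IH. simpl. field. lra.
Qed.

Lemma Rsummable_geom r : (0 <= r < 1)%R -> Rsummable (fun n : nat => r ^ n)%R.
Proof.
  intros Hr. exists (/ (1 - r))%R. intros L HL.
  assert (Hi : incl L (seq 0 (S (list_max L)))).
  { intros k Hk. apply in_seq. pose proof (proj1 (list_max_le L (list_max L)) (le_n _)).
    rewrite Forall_forall in H. apply H in Hk. lia. }
  eapply Rle_trans.
  - apply (Rsum_incl _ L (seq 0 (S (list_max L)))); auto using seq_NoDup.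
    intros; apply pow_le; lra.
  - rewrite Rsum_geom_seq by lra.
    assert (0 <= r ^ S (list_max L))%R by (apply pow_le; lra).
    unfold Rdiv. rewrite <- (Rmult_1_l (/ (1 - r))) at 2. apply Rmult_le_compat_r; [|lra].
    left; apply Rinv_0_lt_compat; lra.
Qed.

Lemma has_sum_geom (a : C) : (Cmod a < 1)%R -> has_sum (fun n : nat => a ^ n) (/ (1 - a)).
Proof.
  intros Ha. destruct (summable_has_sum (fun n : nat => a ^ n)) as [l Hl].
  { eapply Rsummable_le; [|apply (Rsummable_geom (Cmod a))].
    - intros i. rewrite Cmod_pow. lra.
    - split; auto using Cmod_ge_0. }
  pose proof (has_sum_nat_shift (fun n => a ^ n) _ (has_sum_scal a _ _ Hl)) as H. simpl in H.
  pose proof (has_sum_unique _ _ _ Hl H) as E.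
  assert (Hn : 1 - a <> 0).
  { intros E1. replace a with (RtoC 1) in Ha; [rewrite Cmod_1 in Ha; lra|].
    replace a with (1 - (1 - a)) by ring. rewrite E1. ring. }
  replace (/ (1 - a)) with l; auto.
  replace l with (/ (1 - a) * (l - a * l)) by (field; auto).
  rewrite E at 1. field; auto.
Qed.

Lemma has_sum_Z_halves (f : Z -> C) a b :
  has_sum (fun n : nat => f (Z.of_nat n)) a ->
  has_sum (fun n : nat => f (- Z.of_nat n - 1)%Z) b -> has_sum f (a + b).
Proof.
  intros Ha Hb. apply (has_sum_cover Z.of_nat (fun n => (- Z.of_nat n - 1)%Z)); auto;
    try (intros; lia).
  intros j. destruct (Z_le_gt_dec 0 j) as [H|H].
    + left. exists (Z.to_nat j). lia.
    + right. exists (Z.to_nat (- j - 1)). lia.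
Qed.

Lemma Rsummable_Zgeom r : (0 < r < 1)%R -> Rsummable (fun k : Z => powerRZ r (Z.abs k)).
Proof.
  intros Hr.
  assert (G : forall g : nat -> R, (forall n, 0 <= g n <= r ^ n)%R -> exists l, has_sum (fun n => RtoC (g n)) l).
  { intros g Hg. apply Rsummable_nonneg_has_sum; [intros; apply Hg|].
    eapply Rsummable_le; [|apply (Rsummable_geom r)]; [|lra]. intros; apply Hg. }
  destruct (G (fun n => powerRZ r (Z.abs (Z.of_nat n)))) as [a Ha].
  { intros n. split; [left; apply powerRZ_pos; lra|]. rewrite pow_powerRZ.
    apply powerRZ_le_anti; [lra|lia]. }
  destruct (G (fun n => powerRZ r (Z.abs (- Z.of_nat n - 1)))) as [b Hb].
  { intros n. split; [left; apply powerRZ_pos; lra|]. rewrite pow_powerRZ.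
    apply powerRZ_le_anti; [lra|lia]. }
  pose proof (has_sum_Z_halves (fun k => RtoC (powerRZ r (Z.abs k))) a b Ha Hb) as H.
  apply has_sum_summable in H. eapply Rsummable_le; [|exact H].
  intros k. simpl. rewrite Cmod_R. apply Rle_abs.
Qed.

Lemma summable_Zgeom r M (f : Z -> C) :
  (0 < r < 1)%R -> (forall k, (Cmod (f k) <= M * powerRZ r (Z.abs k))%R) -> summable f.
Proof.
  intros Hr H. apply (Rsummable_le _ (fun k => (Rabs M * powerRZ r (Z.abs k))%R)).
  - intros k. eapply Rle_trans; [apply H|]. apply Rmult_le_compat_r; [|apply Rle_abs].
    left; apply powerRZ_pos; lra.
  - apply Rsummable_scal; [apply Rabs_pos|]. now apply Rsummable_Zgeom.
Qed.

Lemma Rsummable_Z2geom r : (0 < r < 1)%R ->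
  Rsummable (fun p : Z * Z => (powerRZ r (Z.abs (fst p)) * powerRZ r (Z.abs (snd p)))%R).
Proof.
  intros Hr. apply (Rsummable_prod (fun k : Z => powerRZ r (Z.abs k)) (fun k : Z => powerRZ r (Z.abs k)));
    auto using Rsummable_Zgeom; intros; left; apply powerRZ_pos; lra.
Qed.

Lemma summable_Z2geom r M (f : Z * Z -> C) :
  (0 < r < 1)%R ->
  (forall a b, (Cmod (f (a, b)) <= M * (powerRZ r (Z.abs a) * powerRZ r (Z.abs b)))%R) -> summable f.
Proof.
  intros Hr H.
  apply (Rsummable_le _ (fun p => (Rabs M * (powerRZ r (Z.abs (fst p)) * powerRZ r (Z.abs (snd p))))%R)).
  - intros [a b]. eapply Rle_trans; [apply H|]. apply Rmult_le_compat_r; [|apply Rle_abs].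
    apply Rmult_le_pos; left; apply powerRZ_pos; lra.
  - apply Rsummable_scal; [apply Rabs_pos|]. now apply Rsummable_Z2geom.
Qed.

(* The sign pattern of the Laurent expansion of Kronecker's function. *)
Definition sg (n k : Z) : Z :=
  if (0 <=? n)%Z then (if (0 <=? k)%Z then 1 else 0)%Z
  else (if (0 <=? k)%Z then 0 else -1)%Z.

Definition sgC (n k : Z) : C := RtoC (IZR (sg n k)).

Lemma sg_cases n k :
  ((0 <= n /\ 0 <= k /\ sg n k = 1) \/ (n < 0 /\ k < 0 /\ sg n k = -1) \/
   (((0 <= n /\ k < 0) \/ (n < 0 /\ 0 <= k)) /\ sg n k = 0))%Z.
Proof.
  unfold sg. destruct (Z.leb_spec 0 n), (Z.leb_spec 0 k); lia.
Qed.

Lemma sg_comm n k : sg n k = sg k n.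
Proof. pose proof (sg_cases n k). pose proof (sg_cases k n). lia. Qed.

(** One closed form, two expansions: powers k >= 0 with sign +1 when |y| < 1, powers k < 0 with sign
    -1 when |y| > 1. The sign of [n] selects which, through [sg]. *)
Lemma has_sum_sg_geom (n : Z) (y : C) :
  y <> 0 -> ((0 <= n)%Z -> (Cmod y < 1)%R) -> ((n < 0)%Z -> (1 < Cmod y)%R) ->
  has_sum (fun k => sgC n k * zpow y k) (/ (1 - y)).
Proof.
  intros Hy H1 H2. destruct (Z_le_gt_dec 0 n) as [Hn|Hn].
  - replace (/ (1 - y)) with (/ (1 - y) + 0) by ring. apply has_sum_Z_halves.
    + eapply has_sum_ext; [|apply has_sum_geom; auto]. intros k. simpl.
      rewrite zpow_of_nat. unfold sgC.
      destruct (sg_cases n (Z.of_nat k)) as [(_&_&->)|[|]]; [ring|lia|lia].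
    + eapply has_sum_ext; [|apply has_sum_zero]. intros k. unfold sgC. simpl.
      destruct (sg_cases n (- Z.of_nat k - 1)) as [|[|(_&->)]]; [lia|lia|ring].
  - assert (Hy1 : (1 < Cmod y)%R) by (apply H2; lia).
    assert (Hi : (Cmod (/ y) < 1)%R).
    { rewrite Cmod_inv by auto. rewrite <- Rinv_1. apply Rinv_lt_contravar; lra. }
    assert (Hn1 : 1 - y <> 0).
    { intros E1. replace y with (RtoC 1) in Hy1; [rewrite Cmod_1 in Hy1; lra|].
      replace y with (1 - (1 - y)) by ring. rewrite E1. ring. }
    assert (Hn2 : y - 1 <> 0).
    { intros E. apply Hn1. replace (1 - y) with (- (y - 1)) by ring. rewrite E; ring. }
    replace (/ (1 - y)) with (0 + - / y * / (1 - / y)).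
    + apply has_sum_Z_halves.
      * eapply has_sum_ext; [|apply has_sum_zero]. intros k. unfold sgC. simpl.
        destruct (sg_cases n (Z.of_nat k)) as [|[|(_&->)]]; [lia|lia|ring].
      * eapply has_sum_ext; [|apply has_sum_scal, has_sum_geom; exact Hi]. intros k. unfold sgC. simpl.
        destruct (sg_cases n (- Z.of_nat k - 1)) as [|[(_&_&->)|]]; [lia| |lia].
        replace (- Z.of_nat k - 1)%Z with (- Z.of_nat (S k))%Z by lia.
        rewrite zpow_neg_nat, Cpow_inv, Cpow_S by auto.
        replace (RtoC (-1)) with (-(1)) by (rewrite <- RtoC_opp; reflexivity).
        field. auto using Cpow_nz.
    + field. split; auto.
Qed.

(** * The triple product *)

(** The q-Pochhammer product (q;q)_n; [qpinf] is (q;q)_∞. *)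
Fixpoint qp (q : C) (n : nat) : C :=
  match n with
  | O => 1
  | S m => qp q m * (1 - q ^ S m)
  end.

Definition qpinf (q : C) : C := Clim (qp q).

Lemma Cmod_one_minus_le (x : C) : (Cmod (1 - x) <= 1 + Cmod x)%R.
Proof.
  unfold Cminus. eapply Rle_trans; [apply Cmod_triangle|]. rewrite Cmod_opp, Cmod_1. lra.
Qed.

Lemma Cmod_one_minus_ge (x : C) : (1 - Cmod x <= Cmod (1 - x))%R.
Proof.
  pose proof (Cmod_triangle (1 - x) x). replace (1 - x + x) with (RtoC 1) in H by ring.
  rewrite Cmod_1 in H. lra.
Qed.

Lemma Cmod_one_minus_ge' (x : C) : (Cmod x - 1 <= Cmod (1 - x))%R.
Proof.
  pose proof (Cmod_triangle (1 - x) (- (1))). replace (1 - x + - (1)) with (- x) in H by ring.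
  rewrite Cmod_opp, Cmod_m1 in H. lra.
Qed.

Lemma one_minus_nz (x : C) : (Cmod x <> 1)%R -> 1 - x <> 0.
Proof.
  intros H E. apply H. replace x with (1 - (1 - x)) by ring. rewrite E.
  replace (1 - 0) with (RtoC 1) by ring. apply Cmod_1.
Qed.

Lemma Rsum_geom_le r n : (0 <= r < 1)%R -> (Rsum (fun k => r ^ S k)%R (seq 0 n) <= / (1 - r))%R.
Proof.
  intros Hr. apply Rle_trans with (Rsum (fun k => r ^ k)%R (seq 0 n)).
  - apply Rsum_le. intros i _. simpl. assert (0 <= r ^ i)%R by (apply pow_le; lra). nra.
  - rewrite Rsum_geom_seq by lra. assert (0 <= r ^ n)%R by (apply pow_le; lra).
    unfold Rdiv. rewrite <- (Rmult_1_l (/ (1 - r))) at 2. apply Rmult_le_compat_r; [|lra].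
    left; apply Rinv_0_lt_compat; lra.
Qed.

Lemma qp_upper (q : C) : (Cmod q < 1)%R -> exists B, (0 < B)%R /\ forall n, (Cmod (qp q n) <= B)%R.
Proof.
  intros Hq. set (r := Cmod q). pose proof (Cmod_ge_0 q) as H0. fold r in H0.
  exists (exp (/ (1 - r))). split; [apply exp_pos|].
  assert (A : forall n, (Cmod (qp q n) <= exp (Rsum (fun k => r ^ S k)%R (seq 0 n)))%R).
  { induction n as [|n IH].
    - simpl. rewrite exp_0, Cmod_1. lra.
    - rewrite seq_S, Rsum_app, exp_plus. simpl qp. rewrite Cmod_mult.
      apply Rmult_le_compat; auto using Cmod_ge_0.
      eapply Rle_trans; [apply Cmod_one_minus_le|]. change (q * q ^ n) with (q ^ S n).
      rewrite Cmod_pow. fold r. simpl (Rsum _ _). rewrite Rplus_0_r.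
      apply exp_ineq1_le. }
  intros n. eapply Rle_trans; [apply A|].
  assert (Hr : (0 <= r < 1)%R) by (unfold r in *; lra).
  destruct (Rsum_geom_le r n Hr) as [E|E].
  - left. now apply exp_increasing.
  - rewrite E. lra.
Qed.

(** A bound below uniform in [n] makes the infinite product nonzero and its reciprocals bounded.
    Each factor 1 - x with 0 <= x <= r is at least exp(-x/(1-r)), and the exponents add up to a
    geometric series. *)
Lemma qp_lower (q : C) : (Cmod q < 1)%R -> exists m, (0 < m)%R /\ forall n, (m <= Cmod (qp q n))%R.
Proof.
  intros Hq. set (r := Cmod q). pose proof (Cmod_ge_0 q) as H0. fold r in H0, Hq.
  exists (exp (- (/ (1 - r) * / (1 - r)))). split; [apply exp_pos|].
  assert (Hi : (0 < / (1 - r))%R) by (apply Rinv_0_lt_compat; lra).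
  assert (A : forall n, (exp (- (/ (1 - r) * Rsum (fun k => r ^ S k)%R (seq 0 n))) <= Cmod (qp q n))%R).
  { induction n as [|n IH].
    - simpl. rewrite Rmult_0_r, Ropp_0, exp_0, Cmod_1. lra.
    - rewrite seq_S, Rsum_app, Rmult_plus_distr_l, Ropp_plus_distr, exp_plus.
      simpl qp. rewrite Cmod_mult.
      apply Rmult_le_compat; auto; try (left; apply exp_pos).
      eapply Rle_trans; [|apply Cmod_one_minus_ge]. change (q * q ^ n) with (q ^ S n).
      rewrite Cmod_pow. fold r. simpl (Rsum _ _). rewrite Rplus_0_r. simpl (0 + n)%nat.
      set (x := (r ^ S n)%R).
      assert (Hx : (0 <= x <= r)%R).
      { unfold x. simpl. assert (0 <= r ^ n <= 1)%R.
        { split; [apply pow_le; lra|]. rewrite <- (pow1 n). apply pow_incr; lra. } nra. }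
      (* 1 / (1 - x) = 1 + x / (1 - x) <= exp (x / (1 - x)) *)
      rewrite exp_Ropp.
      assert (Hx1 : (0 < 1 - x)%R) by lra.
      rewrite <- (Rinv_inv (1 - x)). apply Rinv_le_contravar; [apply Rinv_0_lt_compat; lra|].
      eapply Rle_trans; [|apply exp_ineq1_le].
      assert (/ (1 - x) <= / (1 - r))%R by (apply Rinv_le_contravar; lra).
      replace (/ (1 - x))%R with (1 + / (1 - x) * x)%R by (field; lra).
      change (r * r ^ n)%R with x. apply Rplus_le_compat_l, Rmult_le_compat_r; [lra|assumption]. }
  intros n. eapply Rle_trans; [|apply A].
  assert (Hs : (Rsum (fun k => r ^ S k)%R (seq 0 n) <= / (1 - r))%R) by (apply Rsum_geom_le; lra).
  assert (- (/ (1 - r) * / (1 - r)) <= - (/ (1 - r) * Rsum (fun k => r ^ S k)%R (seq 0 n)))%R by nra.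
  destruct H as [E|E]; [left; now apply exp_increasing|rewrite E; lra].
Qed.

Lemma qp_nz (q : C) n : (Cmod q < 1)%R -> qp q n <> 0.
Proof.
  intros Hq. destruct (qp_lower q Hq) as [m [Hm H]]. apply Cmod_gt_0. specialize (H n). lra.
Qed.

(** The increments of [qp] are -(q;q)_n q^(n+1), an absolutely summable family, so the sequence is a
    convergent telescoping sum. *)
Lemma qp_lim (q : C) : (Cmod q < 1)%R -> Cto (qp q) (qpinf q).
Proof.
  intros Hq.
  assert (E : exists l, Cto (qp q) l).
  { destruct (qp_upper q Hq) as [B [HB Hu]].
    destruct (summable_has_sum (fun n : nat => - qp q n * q ^ S n)) as [l Hl].
    { eapply Rsummable_le; [|apply (Rsummable_scal B (fun n : nat => (Cmod q ^ n)%R))].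
      - intros n. rewrite Cmod_mult, Cmod_opp, Cmod_pow. simpl.
        assert (0 <= Cmod q ^ n)%R by (apply pow_le, Cmod_ge_0).
        pose proof (Cmod_ge_0 q). pose proof (Cmod_ge_0 (qp q n)).
        apply Rmult_le_compat; auto; [apply Rmult_le_pos; auto|]. nra.
      - lra.
      - apply Rsummable_geom. split; auto using Cmod_ge_0. }
    exists (1 + l).
    assert (Hs : forall i, exists N0, forall N, (N0 <= N)%nat -> In i (seq 0 N)).
    { intros i. exists (S i). intros N HN. apply in_seq. lia. }
    pose proof (Cto_plus _ _ _ _ (Cto_const 1)
      (has_sum_exhaust _ _ (seq 0) (fun N => seq_NoDup N 0) Hs Hl)) as H.
    eapply Cto_ext; [|exact H]. clear H.
    induction n as [|n IH]; [simpl; ring|].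
    rewrite seq_S, Csum_app. simpl Csum at 2. simpl qp.
    rewrite Cplus_assoc, IH. simpl. ring. }
  destruct E as [l Hl]. unfold qpinf. now rewrite (Cto_Clim _ _ Hl).
Qed.

Lemma qpinf_nz (q : C) : (Cmod q < 1)%R -> qpinf q <> 0.
Proof.
  intros Hq E. destruct (qp_lower q Hq) as [m [Hm H]].
  destruct (qp_lim q Hq m Hm) as [N A]. specialize (A N (le_n _)). rewrite E in A.
  replace (qp q N - 0) with (qp q N) in A by ring. specialize (H N). lra.
Qed.

(** 1/(q;q)_j with the usual convention that it vanishes for j < 0. Gaussian binomials then vanish
    outside their range and [rqp_pred] holds for all integers, including the boundary j = 0. *)
Definition rqp (q : C) (j : Z) : C := if (j <? 0)%Z then 0 else / qp q (Z.to_nat j).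

Lemma rqp_pred (q : C) j : q <> 0 -> (Cmod q < 1)%R -> rqp q (j - 1) = (1 - zpow q j) * rqp q j.
Proof.
  intros Hq0 Hq. unfold rqp. destruct (Z.ltb_spec j 0), (Z.ltb_spec (j - 1) 0); try lia.
  - ring.
  - replace j with 0%Z by lia. rewrite zpow_0. ring.
  - replace (Z.to_nat j) with (S (Z.to_nat (j - 1))) by lia. set (n := Z.to_nat (j - 1)).
    replace j with (Z.of_nat (S n)) by lia. rewrite zpow_of_nat.
    pose proof (qp_nz q n Hq). pose proof (qp_nz q (S n) Hq) as Hn. simpl in Hn.
    assert (1 - q * q ^ n <> 0).
    { intros E. apply Hn. rewrite E. ring. }
    simpl. field. auto.
Qed.

Lemma rqp_bound (q : C) : (Cmod q < 1)%R -> exists M, (0 < M)%R /\ forall j, (Cmod (rqp q j) <= M)%R.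
Proof.
  intros Hq. destruct (qp_lower q Hq) as [m [Hm H]]. exists (/ m)%R.
  split; [now apply Rinv_0_lt_compat|]. intros j. unfold rqp. destruct (j <? 0)%Z.
  - rewrite Cmod_0. left. now apply Rinv_0_lt_compat.
  - rewrite Cmod_inv by now apply qp_nz. apply Rinv_le_contravar; auto.
Qed.

Lemma rqp_lim (q : C) k (e : Z) : (Cmod q < 1)%R -> (0 < e)%Z ->
  Cto (fun N => rqp q (e * Z.of_nat N + k)) (/ qpinf q).
Proof.
  intros Hq He eps Hp.
  destruct (Cto_inv _ _ (qpinf_nz q Hq) (qp_lim q Hq) eps Hp) as [N A].
  exists (N + Z.to_nat (Z.abs k))%nat. intros n Hn. unfold rqp.
  assert (Z.of_nat N <= e * Z.of_nat n + k)%Z by nia.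
  destruct (Z.ltb_spec (e * Z.of_nat n + k) 0); [lia|]. apply A. lia.
Qed.

Definition tri (k : Z) : Z := (k * (k - 1) / 2)%Z.

Lemma tri_spec k : (2 * tri k = k * (k - 1))%Z.
Proof.
  unfold tri. assert (H : ((k * (k - 1)) mod 2 = 0)%Z).
  { destruct (Z.Even_or_Odd k) as [[j ->]|[j ->]].
    - replace (2 * j * (2 * j - 1))%Z with ((j * (2 * j - 1)) * 2)%Z by ring. apply Z_mod_mult.
    - replace ((2 * j + 1) * (2 * j + 1 - 1))%Z with (((2 * j + 1) * j) * 2)%Z by ring. apply Z_mod_mult. }
  pose proof (Z_div_mod_eq_full (k * (k - 1)) 2). lia.
Qed.

Lemma tri_add a b : (tri (a + b) = tri a + tri b + a * b)%Z.
Proof. pose proof (tri_spec a). pose proof (tri_spec b). pose proof (tri_spec (a + b)). nia. Qed.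

Definition tprod (q w : C) : nat -> C :=
  fix P N := match N with
  | O => 1
  | S M => P M * (1 - w * q ^ M) * (1 - q ^ S M / w)
  end.

(** Terms of the theta series in multiplicative form. By [triple_product] its sum is (q;q)_∞ times
    the limit of [tprod], with a simple factor 1 - w. *)
Definition tht (q w : C) (k : Z) : C := sgn k * zpow q (tri k) * zpow w k.

Definition theta (q w : C) : C := sumC (tht q w).

Lemma Cmod_tht (q w : C) k : q <> 0 -> w <> 0 -> Cmod (tht q w k) = (powerRZ (Cmod q) (tri k) * powerRZ (Cmod w) k)%R.
Proof.
  intros Hq Hw. unfold tht. rewrite !Cmod_mult, Cmod_sgn, !Cmod_zpow by auto. ring.
Qed.

Lemma has_sum_shift (f : Z -> C) l d : has_sum f l -> has_sum (fun k => f (k + d)%Z) l.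
Proof.
  intros H. apply (has_sum_bij (fun k => (k + d)%Z) (fun k => (k - d)%Z)); auto; intros; lia.
Qed.

(* The finite triple product, with Gaussian binomial coefficients as weights. *)
Lemma tprod_has_sum (q w : C) N :
  q <> 0 -> (Cmod q < 1)%R -> w <> 0 ->
  has_sum (fun k => tht q w k *
    (qp q (2 * N) * rqp q (Z.of_nat N + k) * rqp q (Z.of_nat N - k))) (tprod q w N).
Proof.
  intros Hq0 Hq Hw. induction N as [|N IH].
  - set (f := fun k : Z => _). replace (tprod q w 0) with (f 0%Z).
    + apply has_sum_single. intros k Hk. unfold f, rqp.
      destruct (Z.ltb_spec (Z.of_nat 0 + k) 0), (Z.ltb_spec (Z.of_nat 0 - k) 0); try lia; ring.
    + unfold f, rqp, tht, sgn. simpl. field.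
  - set (f := fun k : Z => _) in IH.
    (* The new factor is (1 - w q^N)(1 - q^(N+1)/w) = (1 + q^(2N+1)) - w q^N - q^(N+1)/w: the old
       family itself plus two copies in which multiplication by w or 1/w becomes an index shift. *)
    pose proof (has_sum_plus _ _ _ _ (has_sum_scal (1 + q ^ (2 * N + 1)) _ _ IH)
      (has_sum_plus _ _ _ _ (has_sum_scal (- (w * q ^ N)) _ _ (has_sum_shift f _ (-1) IH))
        (has_sum_scal (- (q ^ S N / w)) _ _ (has_sum_shift f _ 1 IH)))) as H.
    match type of H with has_sum _ ?l => replace (tprod q w (S N)) with l end.
    + eapply has_sum_ext; [|exact H]. clear H IH. intros k. subst f. cbv beta.
      set (a := rqp q (Z.of_nat (S N) + k)). set (b := rqp q (Z.of_nat (S N) - k)).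
      assert (Ea1 : rqp q (Z.of_nat N + k) = (1 - zpow q (Z.of_nat N + k + 1)) * a).
      { replace (Z.of_nat N + k)%Z with (Z.of_nat (S N) + k - 1)%Z at 1 by lia.
        rewrite rqp_pred by auto. do 3 f_equal. lia. }
      assert (Ea2 : rqp q (Z.of_nat N + (k + -1)) = (1 - zpow q (Z.of_nat N + k)) * rqp q (Z.of_nat N + k)).
      { rewrite <- rqp_pred by auto. f_equal. lia. }
      assert (Ea3 : rqp q (Z.of_nat N + (k + 1)) = a) by (unfold a; f_equal; lia).
      assert (Eb1 : rqp q (Z.of_nat N - k) = (1 - zpow q (Z.of_nat N - k + 1)) * b).
      { replace (Z.of_nat N - k)%Z with (Z.of_nat (S N) - k - 1)%Z at 1 by lia.
        rewrite rqp_pred by auto. do 3 f_equal. lia. }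
      assert (Eb2 : rqp q (Z.of_nat N - (k + 1)) = (1 - zpow q (Z.of_nat N - k)) * rqp q (Z.of_nat N - k)).
      { rewrite <- rqp_pred by auto. f_equal. lia. }
      assert (Eb3 : rqp q (Z.of_nat N - (k + -1)) = b) by (unfold b; f_equal; lia).
      rewrite Ea2, Ea3, Ea1, Eb2, Eb3, Eb1. clearbody a b. clear Ea1 Ea2 Ea3 Eb1 Eb2 Eb3.
      unfold tht. rewrite !tri_add. change (tri 1) with 0%Z. change (tri (-1)) with 1%Z.
      replace (Z.of_nat N - k)%Z with (Z.of_nat N + - k)%Z by lia.
      replace (tri k + 1 + k * -1)%Z with (tri k + 1 + - k)%Z by lia.
      replace (tri k + 0 + k * 1)%Z with (tri k + k)%Z by lia.
      rewrite !sgn_add.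
      rewrite !zpow_add, !zpow_opp, !zpow_1 by auto.
      replace (zpow w (-1)) with (/ w) by (unfold zpow; simpl; field; auto).
      replace (sgn (-1)) with (-(1)) by (unfold sgn, zpow; simpl; field; apply Copp1_nz).
      rewrite sgn_1.
      replace (2 * S N)%nat with (S (S (2 * N))) by lia. cbn [qp].
      replace (2 * N)%nat with (N + N)%nat by lia.
      replace (N + N + 1)%nat with (S (N + N)) by lia. cbn [Cpow].
      rewrite !Cpow_add_r, !zpow_of_nat.
      pose proof (zpow_nz q k Hq0). field. auto.
    + simpl. replace (N + (N + 0) + 1)%nat with (S (N + N)) by lia. simpl.
      rewrite Cpow_add_r. field. auto.
Qed.

(** Quadratic decay beats any exponential: once r^n <= min(s, 1/s), the factor s^k is at most
    r^(-n|k|). *)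
Lemma powerRZ_tri_bound r s :
  (0 < r < 1)%R -> (0 < s)%R -> exists M, (0 < M)%R /\ forall k,
    (powerRZ r (tri k) * powerRZ s k <= M * powerRZ r (Z.abs k))%R.
Proof.
  intros Hr Hs.
  assert (E : exists n : nat, (r ^ n <= s)%R /\ (r ^ n <= / s)%R).
  { assert (Hp : (0 < Rmin s (/ s))%R) by (apply Rmin_pos; auto; now apply Rinv_0_lt_compat).
    destruct (pow_lt_1_zero r ltac:(rewrite Rabs_pos_eq; lra) _ Hp) as [n Hn].
    exists n. specialize (Hn n (le_n _)). rewrite Rabs_pos_eq in Hn by (apply pow_le; lra).
    pose proof (Rmin_l s (/ s)). pose proof (Rmin_r s (/ s)). lra. }
  destruct E as [n [E1 E2]].
  assert (Hs2 : forall k, (powerRZ s k <= powerRZ r (- (Z.of_nat n * Z.abs k)))%R).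
  { intros k. replace (- (Z.of_nat n * Z.abs k))%Z with (- (Z.of_nat n * Z.of_nat (Z.abs_nat k)))%Z by lia.
    rewrite <- Nat2Z.inj_mul, powerRZ_neg', <- pow_powerRZ, pow_mult by lra.
    assert (H0 : (0 < r ^ n)%R) by (apply pow_lt; lra).
    destruct (Z_le_gt_dec 0 k).
    - replace k with (Z.of_nat (Z.abs_nat k)) at 1 by lia. rewrite <- pow_powerRZ.
      rewrite <- pow_inv. apply pow_incr. split; [lra|].
      rewrite <- (Rinv_inv s). apply Rinv_le_contravar; auto.
    - replace k with (- Z.of_nat (Z.abs_nat k))%Z at 1 by lia. rewrite powerRZ_neg', <- pow_powerRZ by lra.
      apply Rinv_le_contravar; [now apply pow_lt|]. apply pow_incr. lra. }
  (* Chosen so that k(k-1)/2 - n|k| >= |k| - c for every k; completing the square would allow a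
     smaller value. *)
  set (c := ((Z.of_nat n + 2) * (Z.of_nat n + 2))%Z).
  exists (powerRZ r (- c)). split; [apply powerRZ_pos; lra|]. intros k.
  assert (0 < powerRZ r (tri k))%R by (apply powerRZ_pos; lra).
  eapply Rle_trans; [apply Rmult_le_compat_l; [lra|apply Hs2]|].
  rewrite <- !powerRZ_add by lra. apply powerRZ_le_anti; [lra|].
  pose proof (tri_spec k). unfold c.
  destruct (Z.abs_spec k) as [[_ ->]|[_ ->]]; nia.
Qed.

Lemma tht_bound (q w : C) : q <> 0 -> (Cmod q < 1)%R -> w <> 0 ->
  exists M, (0 < M)%R /\ forall k, (Cmod (tht q w k) <= M * powerRZ (Cmod q) (Z.abs k))%R.
Proof.
  intros Hq0 Hq Hw. apply Cmod_gt_0 in Hq0 as Hq1. apply Cmod_gt_0 in Hw as Hw1.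
  destruct (powerRZ_tri_bound (Cmod q) (Cmod w)) as [M [HM H]]; auto.
  exists M. split; auto. intros k. rewrite Cmod_tht; auto.
Qed.

Lemma theta_has_sum (q w : C) : q <> 0 -> (Cmod q < 1)%R -> w <> 0 -> has_sum (tht q w) (theta q w).
Proof.
  intros Hq0 Hq Hw. apply sumC_spec. destruct (tht_bound q w Hq0 Hq Hw) as [M [_ H]].
  apply (summable_Zgeom (Cmod q) M); auto. split; auto. now apply Cmod_gt_0.
Qed.

(** In the finite identity each weight tends to (q;q)_∞ / (q;q)_∞^2 = 1/(q;q)_∞, and the uniform
    bounds on [qp] and [rqp] dominate. *)
Lemma triple_product (q w : C) : q <> 0 -> (Cmod q < 1)%R -> w <> 0 ->
  Cto (tprod q w) (theta q w * / qpinf q).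
Proof.
  intros Hq0 Hq Hw. destruct (tht_bound q w Hq0 Hq Hw) as [M [HM H]].
  destruct (qp_upper q Hq) as [B [HB HB1]]. destruct (rqp_bound q Hq) as [D [HD HD1]].
  apply Cmod_gt_0 in Hq0 as Hq1.
  assert (Hf : has_sum (fun k => tht q w k * / qpinf q) (theta q w * / qpinf q)).
  { rewrite Cmult_comm. eapply has_sum_ext; [|apply has_sum_scal, theta_has_sum; auto].
    intros k. simpl. ring. }
  set (g := fun k => ((M * (B * D * D + Cmod (/ qpinf q))) * powerRZ (Cmod q) (Z.abs k))%R).
  pose proof (Cmod_ge_0 (/ qpinf q)) as Hi.
  assert (HBD : (0 < B * D * D)%R) by (repeat apply Rmult_lt_0_compat; auto).
  refine (has_sum_dominated _ _ g _ _ _ _ _ _ (fun N => tprod_has_sum q w N Hq0 Hq Hw) Hf).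
  - apply Rsummable_scal; [|apply Rsummable_Zgeom; auto]. apply Rmult_le_pos; lra.
  - intros N k. unfold g. rewrite Cmod_mult.
    rewrite (Rmult_comm M), Rmult_assoc, Rmult_comm.
    apply Rmult_le_compat; auto using Cmod_ge_0. rewrite !Cmod_mult.
    apply Rle_trans with (B * D * D)%R; [|lra].
    repeat apply Rmult_le_compat; auto using Cmod_ge_0. apply Rmult_le_pos; apply Cmod_ge_0.
  - intros k. unfold g. rewrite Cmod_mult.
    rewrite (Rmult_comm M), Rmult_assoc, Rmult_comm.
    apply Rmult_le_compat; auto using Cmod_ge_0. lra.
  - intros k. apply Cto_scal.
    replace (/ qpinf q) with (qpinf q * / qpinf q * / qpinf q) by (field; now apply qpinf_nz).
    apply Cto_mult; [apply Cto_mult|].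
    + apply (Cto_shift (qp q) _ (fun N => (2 * N)%nat)); [intros; lia|]. now apply qp_lim.
    + eapply Cto_ext; [|apply (rqp_lim q k 1); auto; lia]. intros N. cbv beta. f_equal. lia.
    + eapply Cto_ext; [|apply (rqp_lim q (- k) 1); auto; lia]. intros N. cbv beta. f_equal. lia.
Qed.

(** * Kronecker's function *)

(** The double series of Kronecker's function. Summing over the second index gives the sum of z^n /
    (1 - a q^n); the double form is preferred because its symmetry in [a] and [z] is visible. *)
Definition kap (q a z : C) (p : Z * Z) : C :=
  sgC (fst p) (snd p) * zpow q (fst p * snd p) * zpow z (fst p) * zpow a (snd p).

Definition kron (q a z : C) : C := sumC (kap q a z).

Definition ups (q a : C) (p : Z * Z) : C :=
  sgC (fst p) (snd p) * sgn (fst p) * zpow q (tri (fst p + 1) + fst p * snd p) * zpow a (snd p).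

(* [lerch q a] is the sum of (-1)^n q^(n(n+1)/2) / (1 - a q^n) over all integers n,
   expanded in the annulus |q| < |a| < 1. *)
Definition lerch (q a : C) : C := sumC (ups q a).

Definition annulus (q a : C) : Prop := (Cmod q < Cmod a < 1)%R.

Lemma annulus_nz (q a : C) : annulus q a -> a <> 0.
Proof. intros [H _]. apply Cmod_gt_0. pose proof (Cmod_ge_0 q). lra. Qed.

Lemma powerRZ_opp_div r s n : (0 < r)%R -> (0 < s)%R ->
  powerRZ s (- n) = (powerRZ r (- n) * powerRZ (r / s) n)%R.
Proof.
  intros Hr Hs. unfold Rdiv. rewrite powerRZ_mult, powerRZ_inv', !powerRZ_neg'.
  field. split; apply Rgt_not_eq, powerRZ_pos; auto.
Qed.

Lemma ratio_bound (q a : C) : q <> 0 -> (Cmod q < 1)%R -> annulus q a ->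
  exists r, (0 < r < 1)%R /\ (Cmod q <= r)%R /\ (Cmod a <= r)%R /\ (Cmod q / Cmod a <= r)%R.
Proof.
  intros Hq0 Hq [H1 H2]. apply Cmod_gt_0 in Hq0.
  exists (Rmax (Cmod a) (Cmod q / Cmod a)).
  assert (Hd : (Cmod q / Cmod a < 1)%R).
  { apply Rmult_lt_reg_r with (Cmod a); [lra|]. unfold Rdiv. rewrite Rmult_assoc, Rinv_l; lra. }
  pose proof (Rmax_l (Cmod a) (Cmod q / Cmod a)). pose proof (Rmax_r (Cmod a) (Cmod q / Cmod a)).
  repeat split; try lra. now apply Rmax_lub_lt.
Qed.

(** For nonnegative indices |z|^n |a|^k dominates. For n = -n', k = -k' negative, the term is
    q^(n'k' - n' - k') (q/z)^n' (q/a)^k', and n'k' - n' - k' = (n'-1)(k'-1) - 1 >= -1; hence the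
    constant |q|^(-1). *)
Lemma kap_summable (q a z : C) : q <> 0 -> (Cmod q < 1)%R -> annulus q a -> annulus q z ->
  summable (kap q a z).
Proof.
  intros Hq0 Hq Ha Hz. apply Cmod_gt_0 in Hq0 as Hr.
  destruct (ratio_bound q a Hq0 Hq Ha) as (r1 & Hr1 & A1 & A2 & A3).
  destruct (ratio_bound q z Hq0 Hq Hz) as (r2 & Hr2 & B1 & B2 & B3).
  pose proof (annulus_nz q a Ha) as Ha0. pose proof (annulus_nz q z Hz) as Hz0.
  apply Cmod_gt_0 in Ha0 as Ha1. apply Cmod_gt_0 in Hz0 as Hz1.
  set (r := Rmax r1 r2).
  assert (R1 : (r1 <= r)%R) by apply Rmax_l. assert (R2 : (r2 <= r)%R) by apply Rmax_r.
  assert (Hrr : (0 < r < 1)%R) by (split; [lra|apply Rmax_lub_lt; lra]).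
  apply (summable_Z2geom r (powerRZ (Cmod q) (-1))); auto.
  intros n k. unfold kap. simpl fst; simpl snd. rewrite !Cmod_mult, !Cmod_zpow by auto.
  destruct (sg_cases n k) as [(Hn&Hk&E)|[(Hn&Hk&E)|(_&E)]]; unfold sgC; rewrite E.
  - rewrite Cmod_1, !Z.abs_eq, Rmult_1_l by auto. rewrite Rmult_assoc.
    apply Rmult_le_compat.
    + left; apply powerRZ_pos; auto.
    + left; apply Rmult_lt_0_compat; apply powerRZ_pos; auto.
    + apply powerRZ_le_anti; [lra|nia].
    + apply Rmult_le_compat; try (left; apply powerRZ_pos; auto); apply powerRZ_le_base; auto; lra.
  - rewrite Cmod_R, Rabs_m1, Rmult_1_l. rewrite !Z.abs_neq by lia.
    set (n' := (- n)%Z). set (k' := (- k)%Z).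
    replace (n * k)%Z with (n' * k')%Z by (unfold n', k'; ring).
    replace n with (- n')%Z by (unfold n'; lia). replace k with (- k')%Z by (unfold k'; lia).
    assert (Hn' : (1 <= n')%Z) by (unfold n'; lia). assert (Hk' : (1 <= k')%Z) by (unfold k'; lia).
    clearbody n' k'. clear E Hn Hk n k.
    rewrite (powerRZ_opp_div (Cmod q) (Cmod z)), (powerRZ_opp_div (Cmod q) (Cmod a)) by auto.
    replace (powerRZ (Cmod q) (n' * k') * (powerRZ (Cmod q) (- n') * powerRZ (Cmod q / Cmod z) n') *
      (powerRZ (Cmod q) (- k') * powerRZ (Cmod q / Cmod a) k'))%R with
      (powerRZ (Cmod q) (n' * k' + - n' + - k') * (powerRZ (Cmod q / Cmod z) n' * powerRZ (Cmod q / Cmod a) k'))%R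
      by (rewrite !powerRZ_add by lra; ring).
    assert (0 < Cmod q / Cmod a)%R by now apply Rdiv_lt_0_compat.
    assert (0 < Cmod q / Cmod z)%R by now apply Rdiv_lt_0_compat.
    apply Rmult_le_compat.
    + left; apply powerRZ_pos; auto.
    + left; apply Rmult_lt_0_compat; apply powerRZ_pos; auto.
    + apply powerRZ_le_anti; [lra|nia].
    + apply Rmult_le_compat; try (left; apply powerRZ_pos; auto); apply powerRZ_le_base; try lia; lra.
  - rewrite Cmod_0, !Rmult_0_l. apply Rmult_le_pos; [|apply Rmult_le_pos]; left; apply powerRZ_pos; lra.
Qed.

Lemma ups_summable (q a : C) : q <> 0 -> (Cmod q < 1)%R -> annulus q a -> summable (ups q a).
Proof.
  intros Hq0 Hq Ha. apply Cmod_gt_0 in Hq0 as Hr.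
  destruct (ratio_bound q a Hq0 Hq Ha) as (r & Hrr & A1 & A2 & A3).
  pose proof (annulus_nz q a Ha) as Ha0. apply Cmod_gt_0 in Ha0 as Ha1.
  apply (summable_Z2geom r (powerRZ (Cmod q) (-1))); auto.
  intros n k. unfold ups. simpl fst; simpl snd.
  rewrite !Cmod_mult, Cmod_sgn, !Cmod_zpow, Rmult_1_r by auto.
  pose proof (tri_spec (n + 1)) as Ht.
  destruct (sg_cases n k) as [(Hn&Hk&E)|[(Hn&Hk&E)|(_&E)]]; unfold sgC; rewrite E.
  - rewrite Cmod_1, !Z.abs_eq, Rmult_1_l by auto.
    replace (tri (n + 1) + n * k)%Z with ((tri (n + 1) + n * k - n) + n)%Z by lia.
    rewrite powerRZ_add, Rmult_assoc by lra.
    apply Rmult_le_compat.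
    + left; apply powerRZ_pos; auto.
    + left; apply Rmult_lt_0_compat; apply powerRZ_pos; auto.
    + apply powerRZ_le_anti; [lra|nia].
    + apply Rmult_le_compat; try (left; apply powerRZ_pos; auto); apply powerRZ_le_base; auto; lra.
  - rewrite Cmod_R, Rabs_m1, Rmult_1_l. rewrite !Z.abs_neq by lia.
    set (n' := (- n)%Z). set (k' := (- k)%Z).
    replace (n * k)%Z with (n' * k')%Z by (unfold n', k'; ring).
    replace (powerRZ (Cmod a) k) with (powerRZ (Cmod a) (- k')) by (f_equal; unfold k'; lia).
    assert (Hn' : (1 <= n')%Z) by (unfold n'; lia). assert (Hk' : (1 <= k')%Z) by (unfold k'; lia).
    assert (Ht' : (2 * tri (n + 1) = n' * (n' - 1))%Z) by (unfold n'; lia).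
    clearbody n' k'. clear E Ht.
    rewrite (powerRZ_opp_div (Cmod q) (Cmod a)) by auto.
    replace (powerRZ (Cmod q) (tri (n + 1) + n' * k') *
      (powerRZ (Cmod q) (- k') * powerRZ (Cmod q / Cmod a) k'))%R with
      (powerRZ (Cmod q) (tri (n + 1) + n' * k' + - n' + - k') * (powerRZ (Cmod q) n' * powerRZ (Cmod q / Cmod a) k'))%R.
    2: { replace (tri (n + 1) + n' * k')%Z with (tri (n + 1) + n' * k' + - n' + n')%Z at 2 by lia.
         rewrite (powerRZ_add _ _ n'), (powerRZ_add _ _ (- k')) by lra. ring. }
    assert (0 < Cmod q / Cmod a)%R by now apply Rdiv_lt_0_compat.
    apply Rmult_le_compat.
    + left; apply powerRZ_pos; auto.
    + left; apply Rmult_lt_0_compat; apply powerRZ_pos; auto.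
    + apply powerRZ_le_anti; [lra|nia].
    + apply Rmult_le_compat; try (left; apply powerRZ_pos; auto); apply powerRZ_le_base; try lia; lra.
  - rewrite Cmod_0, !Rmult_0_l. apply Rmult_le_pos; [|apply Rmult_le_pos]; left; apply powerRZ_pos; lra.
Qed.

(** In the annulus no denominator 1 - a q^n vanishes, and the sign of [n] dictates the direction of
    its geometric expansion. *)
Lemma annulus_shift_Cmod (q a : C) n : q <> 0 -> (Cmod q < 1)%R -> annulus q a ->
  ((0 <= n)%Z -> (Cmod (a * zpow q n) < 1)%R) /\ ((n < 0)%Z -> (1 < Cmod (a * zpow q n))%R).
Proof.
  intros Hq0 Hq [H1 H2]. apply Cmod_gt_0 in Hq0 as Hr. rewrite Cmod_mult, Cmod_zpow by auto.
  split; intros Hn.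
  - assert (powerRZ (Cmod q) n <= powerRZ (Cmod q) 0)%R by (apply powerRZ_le_anti; [lra|lia]).
    assert (0 < powerRZ (Cmod q) n)%R by now apply powerRZ_pos. simpl in H. nra.
  - assert (powerRZ (Cmod q) (-1) <= powerRZ (Cmod q) n)%R by (apply powerRZ_le_anti; [lra|lia]).
    simpl in H. rewrite Rmult_1_r in H.
    apply Rlt_le_trans with (Cmod a * / Cmod q)%R; [|apply Rmult_le_compat_l; lra].
    apply Rmult_lt_reg_r with (Cmod q); auto. rewrite Rmult_assoc, Rinv_l; lra.
Qed.

Lemma kap_row (q a z : C) n : q <> 0 -> (Cmod q < 1)%R -> annulus q a ->
  has_sum (fun k => kap q a z (n, k)) (zpow z n * / (1 - a * zpow q n)).
Proof.
  intros Hq0 Hq Ha. destruct (annulus_shift_Cmod q a n Hq0 Hq Ha) as [H1 H2].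
  pose proof (annulus_nz q a Ha) as Ha0.
  assert (Hy : a * zpow q n <> 0) by (apply Cmult_neq_0; auto using zpow_nz).
  eapply has_sum_ext; [|apply has_sum_scal, (has_sum_sg_geom n (a * zpow q n)); auto].
  intros k. unfold kap. simpl. rewrite zpow_mul_l, zpow_mul by auto using zpow_nz. ring.
Qed.

Lemma ups_row (q a : C) n : q <> 0 -> (Cmod q < 1)%R -> annulus q a ->
  has_sum (fun k => ups q a (n, k)) (sgn n * zpow q (tri (n + 1)) * / (1 - a * zpow q n)).
Proof.
  intros Hq0 Hq Ha. destruct (annulus_shift_Cmod q a n Hq0 Hq Ha) as [H1 H2].
  pose proof (annulus_nz q a Ha) as Ha0.
  assert (Hy : a * zpow q n <> 0) by (apply Cmult_neq_0; auto using zpow_nz).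
  eapply has_sum_ext; [|apply has_sum_scal, (has_sum_sg_geom n (a * zpow q n)); auto].
  intros k. unfold ups. simpl. rewrite zpow_add, zpow_mul_l, zpow_mul by auto using zpow_nz. ring.
Qed.

Lemma kron_series (q a z : C) : q <> 0 -> (Cmod q < 1)%R -> annulus q a -> annulus q z ->
  has_sum (fun n => zpow z n * / (1 - a * zpow q n)) (kron q a z).
Proof.
  intros Hq0 Hq Ha Hz. eapply has_sum_rows; [apply sumC_spec; apply kap_summable; eauto|].
  intros n. now apply kap_row.
Qed.

Lemma lerch_series (q a : C) : q <> 0 -> (Cmod q < 1)%R -> annulus q a ->
  has_sum (fun n => sgn n * zpow q (tri (n + 1)) * / (1 - a * zpow q n)) (lerch q a).
Proof.
  intros Hq0 Hq Ha. eapply has_sum_rows; [apply sumC_spec; apply ups_summable; eauto|].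
  intros n. now apply ups_row.
Qed.

Lemma kron_sym (q a z : C) : q <> 0 -> (Cmod q < 1)%R -> annulus q a -> annulus q z ->
  kron q a z = kron q z a.
Proof.
  intros Hq0 Hq Ha Hz. symmetry. apply sumC_eq.
  eapply has_sum_ext; [|apply (has_sum_bij (fun p : Z * Z => (snd p, fst p)) (fun p => (snd p, fst p)) (kap q a z))].
  - intros [n k]. unfold kap, sgC. simpl. rewrite sg_comm, (Z.mul_comm k n). ring.
  - now intros [].
  - now intros [].
  - apply sumC_spec. now apply kap_summable.
Qed.

(** The exponent is symmetric about n = s - 1/2, while n -> 2s - 1 - n changes the parity, so the
    sum equals its own negative. *)
Lemma theta_vanish (q : C) s l : q <> 0 ->
  has_sum (fun n => sgn n * zpow q (tri (n + 1) - s * n)) l -> l = 0.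
Proof.
  intros Hq H.
  assert (Hb : forall n, (2 * s - 1 - (2 * s - 1 - n) = n)%Z) by (intros; lia).
  pose proof (has_sum_bij (fun n => (2 * s - 1 - n)%Z) (fun n => (2 * s - 1 - n)%Z) _ l Hb Hb H) as H1.
  pose proof (has_sum_scal (-(1)) _ _ H) as H2.
  assert (E : l = -(1) * l).
  { apply (has_sum_unique _ _ _ H1). eapply has_sum_ext; [|exact H2]. intros n. cbv beta.
    rewrite (sgn_odd n (2 * s - 1 - n)) by (exists (s - 1 - n)%Z; lia).
    replace (tri (2 * s - 1 - n + 1) - s * (2 * s - 1 - n))%Z with (tri (n + 1) - s * n)%Z; [ring|].
    pose proof (tri_spec (2 * s - 1 - n + 1)). pose proof (tri_spec (n + 1)). nia. }
  assert (E2 : 2 * l = 0) by (replace (2 * l) with (l + l) by ring; rewrite E at 1; ring).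
  replace l with (/ 2 * (2 * l)); [rewrite E2; ring|]. field.
Qed.

(* With d_s the coefficient of z^s in kron * theta, the ratio v_s = d_s / ((-1)^s q^(s(s-1)/2))
   satisfies v_s - a v_(s-1) = 0, because the difference is a vanishing theta value. *)
Lemma kron_theta (q a z : C) : q <> 0 -> (Cmod q < 1)%R -> annulus q a -> annulus q z ->
  kron q a z * theta q z = lerch q a * theta q (a * z).
Proof.
  intros Hq0 Hq Ha Hz.
  pose proof (annulus_nz q a Ha) as Ha0. pose proof (annulus_nz q z Hz) as Hz0.
  pose proof (has_sum_mult _ _ _ _ (kron_series q a z Hq0 Hq Ha Hz) (theta_has_sum q z Hq0 Hq Hz0)) as H.
  (* The pair (s, n) stands for index n in the series of [kron] and s - n in that of [theta], so
     that s is the total power of z. *)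
  set (phi := fun p : Z * Z => (snd p, fst p - snd p)%Z).
  set (psi := fun p : Z * Z => (fst p + snd p, fst p)%Z).
  assert (B1 : forall p, psi (phi p) = p) by (intros [x y]; unfold psi, phi; simpl; f_equal; lia).
  assert (B2 : forall p, phi (psi p) = p) by (intros [x y]; unfold psi, phi; simpl; f_equal; lia).
  pose proof (has_sum_bij phi psi _ _ B1 B2 H) as H1.
  clear H. simpl in H1.
  set (V := fun s n => sgn n * zpow q (tri (n + 1) - s * n) * / (1 - a * zpow q n)).
  assert (E1 : has_sum (fun p => tht q z (fst p) * V (fst p) (snd p)) (kron q a z * theta q z)).
  { eapply has_sum_ext; [|exact H1]. intros [s n]. unfold V, tht. simpl.
    (* This identity splits off the factor [tht q z s] and leaves [V s n], which is free of z. *)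
    replace (tri (s - n))%Z with (tri s + (tri (n + 1) - s * n))%Z.
    2: { pose proof (tri_spec (s - n)). pose proof (tri_spec (n + 1)). pose proof (tri_spec s). nia. }
    replace (zpow z s) with (zpow z (s - n) * zpow z n) by (rewrite <- zpow_add by auto; f_equal; lia).
    rewrite (zpow_add q) by auto.
    replace (sgn (s - n)) with (sgn s * sgn n).
    2: { rewrite <- sgn_add. apply sgn_even. exists n. lia. }
    ring. }
  assert (Htn : forall s, tht q z s <> 0).
  { intros s. unfold tht, sgn. repeat apply Cmult_neq_0; auto using zpow_nz, Copp1_nz. }
  assert (E2 : forall s, has_sum (V s) (sumC (V s))).
  { intros s. destruct (summable_has_sum _ (summable_row _ s (has_sum_summable _ _ E1))) as [l Hl].
    apply sumC_spec. apply (has_sum_summable _ (/ tht q z s * l)).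
    eapply has_sum_ext; [|apply has_sum_scal, Hl]. intros n. simpl. field. auto. }
  assert (E3 : forall s, sumC (V (s + 1)%Z) = a * sumC (V s)).
  { intros s. apply Ceq_minus. replace (sumC (V (s + 1)%Z) - a * sumC (V s)) with
      (sumC (V (s + 1)%Z) + (- a) * sumC (V s)) by ring.
    apply (theta_vanish q (s + 1)); auto.
    eapply has_sum_ext; [|apply has_sum_plus; [apply E2|apply has_sum_scal, E2]].
    intros n. unfold V. cbv beta. replace (tri (n + 1) - s * n)%Z with (tri (n + 1) - (s + 1) * n + n)%Z by lia.
    rewrite (zpow_add q _ n) by auto. field.
    apply one_minus_nz. destruct (annulus_shift_Cmod q a n Hq0 Hq Ha) as [A B].
    destruct (Z_lt_le_dec n 0) as [Hn|Hn]; [specialize (B Hn)|specialize (A Hn)]; lra. }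
  assert (E4 : forall s, sumC (V s) = zpow a s * sumC (V 0%Z)).
  { apply (Z.bi_induction (fun s => sumC (V s) = zpow a s * sumC (V 0%Z))).
    - intros x y ->; tauto.
    - rewrite zpow_0. ring.
    - intros s. replace (Z.succ s) with (s + 1)%Z by lia. rewrite E3, zpow_succ by auto. split.
      + intros ->. ring.
      + intros E. replace (sumC (V s)) with (/ a * (a * sumC (V s))) by (field; auto).
        rewrite E. field; auto. }
  assert (E5 : sumC (V 0%Z) = lerch q a).
  { apply sumC_eq. eapply has_sum_ext; [|apply (lerch_series q a); auto]. intros n. unfold V.
    replace (tri (n + 1) - 0 * n)%Z with (tri (n + 1)) by lia. reflexivity. }
  assert (E6 : has_sum (fun s => tht q z s * sumC (V s)) (kron q a z * theta q z)).
  { eapply has_sum_rows; [exact E1|]. intros s. simpl. apply has_sum_scal, E2. }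
  apply (has_sum_unique _ _ _ E6).
  eapply has_sum_ext; [|apply has_sum_scal, (theta_has_sum q (a * z)); auto using Cmult_neq_0].
  intros s. simpl. rewrite E4, E5. unfold tht. rewrite zpow_mul_l by auto. ring.
Qed.

(** * The product of [lerch] and [theta], by the limit z -> 1 *)

Lemma Cto_Cmod_le (u : nat -> C) (l : C) (M : R) :
  (forall n, (Cmod (u n) <= M)%R) -> Cto u l -> (Cmod l <= M)%R.
Proof.
  intros H Hl. apply le_epsilon. intros eps He. destruct (Hl eps He) as [N A].
  specialize (A N (le_n _)). specialize (H N).
  pose proof (Cmod_triangle (u N) (l - u N)). replace (u N + (l - u N)) with l in H0 by ring.
  rewrite Cmod_sub_sym in A. lra.
Qed.

Lemma Cto_pow (u : nat -> C) (l : C) n : Cto u l -> Cto (fun j => u j ^ n) (l ^ n).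
Proof.
  intros H. induction n as [|n IH]; simpl; [apply Cto_const|]. now apply Cto_mult.
Qed.

Lemma Cto_zpow (u : nat -> C) (l : C) k : l <> 0 -> Cto u l -> Cto (fun j => zpow (u j) k) (zpow l k).
Proof.
  intros Hl H. destruct k as [|p|p]; simpl.
  - apply Cto_const.
  - now apply Cto_pow.
  - apply Cto_inv; [now apply Cpow_nz|]. now apply Cto_pow.
Qed.

Lemma Cto_geom (q : C) : (Cmod q < 1)%R -> Cto (fun n => q ^ n) 0.
Proof.
  intros Hq eps He. assert (Ha : (Rabs (Cmod q) < 1)%R) by (rewrite Rabs_pos_eq; auto using Cmod_ge_0).
  destruct (pow_lt_1_zero _ Ha eps He) as [N A]. exists N. intros n Hn.
  replace (q ^ n - 0) with (q ^ n) by ring. rewrite Cmod_pow. specialize (A n Hn).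
  rewrite Rabs_pos_eq in A; auto. apply pow_le, Cmod_ge_0.
Qed.

(** The theta product stripped of its factor 1 - w, hence regular at w = 1, where it equals
    (q;q)_N^2. *)
Definition tprod1 (q w : C) : nat -> C :=
  fix P N := match N with
  | O => 1
  | S M => P M * ((1 - w * q ^ S M) * (1 - q ^ S M / w))
  end.

Lemma tprod_tprod1 (q w : C) N : w <> 0 -> tprod q w N * (1 - w * q ^ N) = (1 - w) * tprod1 q w N.
Proof.
  intros Hw. induction N as [|N IH]; [simpl; ring|]. cbn [tprod tprod1]. rewrite IH. ring.
Qed.

Lemma tprod1_one (q : C) N : tprod1 q 1 N = qp q N * qp q N.
Proof. induction N as [|N IH]; [simpl; ring|]. cbn [tprod1 qp]. rewrite IH. field. Qed.

(** A Lipschitz estimate at t = 1 that is uniform in [N]: this is what permits N -> ∞ before t ->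
    1. *)
Lemma tprod1_bound (q : C) (t0 : R) : (Cmod q < 1)%R -> (0 < t0 < 1)%R ->
  exists M, (0 < M)%R /\ forall N (t : R), (t0 <= t <= 1)%R ->
    (Cmod (tprod1 q t N - tprod1 q 1 N) <= M * (1 - t))%R.
Proof.
  intros Hq Ht0. set (r := Cmod q). pose proof (Cmod_ge_0 q) as Hr. fold r in Hr, Hq.
  set (c := (1 + / t0)%R).
  assert (Hi0 : (1 <= / t0)%R) by (rewrite <- Rinv_1; apply Rinv_le_contravar; lra).
  set (S_ := fun N => Rsum (fun k => r ^ S k)%R (seq 0 N)).
  assert (S_S : forall N, S_ (S N) = (S_ N + r ^ S N)%R).
  { intros N. unfold S_. rewrite seq_S, Rsum_app. simpl. ring. }
  assert (Hrp : forall n, (0 <= r ^ n)%R) by (intros; apply pow_le; lra).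
  assert (F : forall (t : R) n, (t0 <= t <= 1)%R ->
    (Cmod ((1 - t * q ^ n) * (1 - q ^ n / t)) <= exp (c * r ^ n))%R).
  { intros t n Ht. rewrite Cmod_mult. unfold c. rewrite Rmult_plus_distr_r, exp_plus.
    assert (Hti : (/ t <= / t0)%R) by (apply Rinv_le_contravar; lra).
    assert (Hti0 : (0 < / t)%R) by (apply Rinv_0_lt_compat; lra).
    specialize (Hrp n).
    apply Rmult_le_compat; auto using Cmod_ge_0.
    - eapply Rle_trans; [apply Cmod_one_minus_le|]. eapply Rle_trans; [|apply exp_ineq1_le].
      rewrite Cmod_mult, Cmod_R, Cmod_pow, Rabs_pos_eq by lra. fold r. nra.
    - eapply Rle_trans; [apply Cmod_one_minus_le|]. eapply Rle_trans; [|apply exp_ineq1_le].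
      unfold Cdiv. rewrite <- RtoC_inv by lra.
      rewrite Cmod_mult, Cmod_R, Cmod_pow, Rabs_pos_eq by lra. fold r. nra. }
  assert (G : forall (t : R) N, (t0 <= t <= 1)%R -> (Cmod (tprod1 q t N) <= exp (c * S_ N))%R).
  { intros t N Ht. induction N as [|N IH].
    - unfold S_. simpl. rewrite Rmult_0_r, exp_0, Cmod_1. lra.
    - cbn [tprod1]. rewrite Cmod_mult, S_S, Rmult_plus_distr_l, exp_plus.
      apply Rmult_le_compat; auto using Cmod_ge_0. }
  assert (D : forall (t : R) N, (t0 <= t <= 1)%R ->
    (Cmod (tprod1 q t N - tprod1 q 1 N) <= exp (c * S_ N) * (/ t0 * S_ N * (1 - t)))%R).
  { intros t N Ht. induction N as [|N IH].
    - unfold S_. simpl. replace (1 - 1) with (RtoC 0) by ring. rewrite Cmod_0. right; ring.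
    - cbn [tprod1]. set (x := q ^ S N). set (U := tprod1 q t N) in *. set (V := tprod1 q 1 N) in *.
      assert (Htn : RtoC t <> 0) by (intros E; apply RtoC_inj in E; lra).
      (* The two factors differ by (1 - tx)(1 - x/t) - (1 - x)^2 = -x (1-t)^2 / t, so each step adds
         an error of order x (1-t), summable over [N]. *)
      replace (U * ((1 - t * x) * (1 - x / t)) - V * ((1 - 1 * x) * (1 - x / 1))) with
        ((U - V) * ((1 - t * x) * (1 - x / t)) + V * (- x * ((1 - t) * (1 - t) * / t))).
      2: { field. auto. }
      eapply Rle_trans; [apply Cmod_triangle|]. rewrite (Cmod_mult (U - V)), (Cmod_mult V).
      assert (Hx : (Cmod (- x * ((1 - t) * (1 - t) * / t)) <= r ^ S N * (/ t0 * (1 - t)))%R).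
      { rewrite Cmod_mult, Cmod_opp. unfold x. rewrite Cmod_pow. fold r.
        apply Rmult_le_compat_l; auto.
        rewrite <- RtoC_inv, <- RtoC_minus, <- !RtoC_mult, Cmod_R by lra.
        assert (Hti : (/ t <= / t0)%R) by (apply Rinv_le_contravar; lra).
        assert (Hti0 : (0 < / t)%R) by (apply Rinv_0_lt_compat; lra).
        rewrite Rabs_pos_eq by (apply Rmult_le_pos; [apply Rmult_le_pos|]; lra).
        rewrite (Rmult_comm (/ t0)). apply Rmult_le_compat; [apply Rmult_le_pos| | |]; try lra.
        rewrite <- (Rmult_1_r (1 - t)) at 3. apply Rmult_le_compat_l; lra. }
      pose proof (F t (S N) Ht) as HF. fold x in HF.
      assert (HV : (Cmod V <= exp (c * S_ N))%R) by (apply (G 1%R); lra).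
      rewrite S_S. rewrite (Rmult_plus_distr_l c), exp_plus.
      set (E := exp (c * S_ N)) in *. set (e := exp (c * r ^ S N)) in *.
      assert (He : (1 <= e)%R).
      { unfold e. eapply Rle_trans; [|apply exp_ineq1_le]. specialize (Hrp (S N)).
        assert (0 <= c * r ^ S N)%R by (apply Rmult_le_pos; unfold c; lra). lra. }
      assert (HE : (0 < E)%R) by apply exp_pos.
      replace (E * e * (/ t0 * (S_ N + r ^ S N) * (1 - t)))%R with
        (E * (/ t0 * S_ N * (1 - t)) * e + E * e * (r ^ S N * (/ t0 * (1 - t))))%R by ring.
      apply Rplus_le_compat.
      + apply Rmult_le_compat; auto using Cmod_ge_0.
      + apply Rmult_le_compat; auto using Cmod_ge_0. nra. }
  assert (HS : forall N, (0 <= S_ N <= / (1 - r))%R).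
  { intros N. split; [apply Rsum_nonneg; auto|apply Rsum_geom_le; lra]. }
  assert (Hir : (0 < / (1 - r))%R) by (apply Rinv_0_lt_compat; lra).
  exists (exp (c * / (1 - r)) * (/ t0 * / (1 - r)))%R. split.
  { apply Rmult_lt_0_compat; [apply exp_pos|]. nra. }
  intros N t Ht. eapply Rle_trans; [apply D; auto|].
  rewrite <- Rmult_assoc. destruct (HS N) as [HS1 HS2].
  apply Rmult_le_compat_r; [lra|]. apply Rmult_le_compat.
  - left; apply exp_pos.
  - apply Rmult_le_pos; lra.
  - destruct HS2 as [E|E]; [left; apply exp_increasing|rewrite E; lra].
    apply Rmult_lt_compat_l; auto. unfold c. lra.
  - apply Rmult_le_compat_l; lra.
Qed.

(** The cube arises as one (q;q)_∞ from the triple product and two from [tprod1] at w = 1. *)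
Lemma theta_near_one (q : C) (t0 : R) : q <> 0 -> (Cmod q < 1)%R -> (0 < t0 < 1)%R ->
  exists M, (0 < M)%R /\ forall t : R, (t0 <= t < 1)%R ->
    (Cmod (theta q t * / (1 - t) - qpinf q ^ 3) <= M * (1 - t))%R.
Proof.
  intros Hq0 Hq Ht0. destruct (tprod1_bound q t0 Hq Ht0) as [M [HM H]].
  exists (M * (Cmod (qpinf q) + 1))%R. pose proof (Cmod_ge_0 (qpinf q)). split; [nra|].
  intros t Ht.
  assert (Htn : RtoC t <> 0) by (intros E; apply RtoC_inj in E; lra).
  assert (Ht1 : 1 - t <> 0).
  { rewrite <- RtoC_minus. intros E; apply RtoC_inj in E; lra. }
  assert (L : Cto (tprod1 q t) (theta q t * / qpinf q * (1 + (- t) * 0) * / (1 - t))).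
  { pose proof (Cto_mult _ _ _ _ (Cto_mult _ _ _ _ (triple_product q t Hq0 Hq Htn)
      (Cto_plus _ _ _ _ (Cto_const 1) (Cto_scal (- t) _ _ (Cto_geom q Hq))))
      (Cto_const (/ (1 - t)))) as L. eapply Cto_ext; [|exact L].
    intros N. cbv beta. replace (1 + - t * q ^ N) with (1 - t * q ^ N) by ring.
    rewrite tprod_tprod1 by auto. field; auto. }
  assert (L1 : Cto (tprod1 q 1) (qpinf q * qpinf q)).
  { eapply Cto_ext; [intros N; symmetry; apply tprod1_one|]. apply Cto_mult; now apply qp_lim. }
  pose proof (Cto_plus _ _ _ _ L (Cto_scal (-(1)) _ _ L1)) as L2.
  apply (fun h => Cto_Cmod_le _ _ (M * (1 - t)) h) in L2.
  2: { intros N. replace (tprod1 q t N + - (1) * tprod1 q 1 N) with (tprod1 q t N - tprod1 q 1 N) by ring.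
       apply H. lra. }
  pose proof (qpinf_nz q Hq) as Hqn.
  match type of L2 with (Cmod ?e <= _)%R =>
    replace (theta q t * / (1 - t) - qpinf q ^ 3) with (qpinf q * e) by (field; auto) end.
  rewrite Cmod_mult. assert (0 <= M * (1 - t))%R by (apply Rmult_le_pos; lra). nra.
Qed.

(* Let z -> 1 in [kron_theta]: the pole of kron at z = 1 cancels the zero of theta. *)
Lemma lerch_theta (q a : C) : q <> 0 -> (Cmod q < 1)%R -> annulus q a ->
  lerch q a * theta q a = qpinf q ^ 3.
Proof.
  intros Hq0 Hq Ha. apply Cmod_gt_0 in Hq0 as Hr.
  pose proof (annulus_nz q a Ha) as Ha0. apply Cmod_gt_0 in Ha0 as Ha1.
  (* The limit is taken along real t_j = 1 - d/(j+1), with t0 = 1 - d midway between |q| and 1, so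
     all t_j lie in the annulus and stay away from |q|. *)
  set (r := Cmod q) in *. set (d := ((1 - r) / 2)%R). set (t0 := ((1 + r) / 2)%R).
  set (t := fun j : nat => (1 - d * / (INR j + 1))%R).
  assert (Hji : forall j, (0 < / (INR j + 1) <= 1)%R).
  { intros j. pose proof (pos_INR j). split; [apply Rinv_0_lt_compat; lra|].
    rewrite <- Rinv_1. apply Rinv_le_contravar; lra. }
  assert (Ht : forall j, (t0 <= t j < 1)%R).
  { intros j. specialize (Hji j). unfold t, t0, d. nra. }
  assert (Ht0 : (r < t0 < 1)%R) by (unfold t0; lra).
  assert (Htl : Cto (fun j => RtoC (1 - t j)) 0).
  { intros eps He. destruct (archimed_cor1 eps He) as [N [HN HN0]]. exists N. intros n Hn.
    replace (RtoC (1 - t n) - 0) with (RtoC (1 - t n)) by ring. rewrite Cmod_R.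
    specialize (Ht n). rewrite Rabs_pos_eq by lra. unfold t.
    apply Rle_lt_trans with (/ (INR n + 1))%R.
    - specialize (Hji n). unfold d. nra.
    - eapply Rle_lt_trans; [|exact HN]. apply Rinv_le_contravar.
      + apply lt_0_INR; lia.
      + apply le_INR in Hn. lra. }
  assert (Htn : forall j, RtoC (t j) <> 0).
  { intros j E. apply RtoC_inj in E. specialize (Ht j). lra. }
  assert (Ht1 : forall j, 1 - t j <> 0).
  { intros j E. rewrite <- RtoC_minus in E. apply RtoC_inj in E. specialize (Ht j). lra. }
  assert (Hta : forall j, annulus q (t j)).
  { intros j. unfold annulus. rewrite Cmod_R. specialize (Ht j). rewrite Rabs_pos_eq by lra. fold r. lra. }
  assert (L1 : Cto (fun j => theta q (t j) * / (1 - t j)) (qpinf q ^ 3)).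
  { destruct (theta_near_one q t0 Hq0 Hq) as [M [HM HT]]; [lra|].
    intros eps He. destruct (Htl (eps / M)%R) as [N HN]; [now apply Rdiv_lt_0_compat|].
    exists N. intros n Hn. specialize (HN n Hn). specialize (Ht n).
    replace (RtoC (1 - t n) - 0) with (RtoC (1 - t n)) in HN by ring.
    rewrite Cmod_R, Rabs_pos_eq in HN by lra.
    eapply Rle_lt_trans; [apply HT; auto|].
    apply Rlt_le_trans with (M * (eps / M))%R; [apply Rmult_lt_compat_l; auto|]. right. field. lra. }
  (* After [kron_sym] the rows are a^k / (1 - t q^k). The row k = 0 carries the whole pole and
     contributes exactly 1; the others are bounded as t -> 1 and are killed by the factor 1 - t. *)
  assert (L2 : Cto (fun j => (1 - t j) * kron q a (t j)) 1).
  { destruct (ratio_bound q a Hq0 Hq Ha) as (s & Hs & S1 & S2 & S3). fold r in S1, S3.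
    (* The three summands serve k = 0, k > 0 and k < 0: |1 - t q^k| is at least 1 - r for k > 0 and
       at least r^k (t0 - r) for k < 0. *)
    set (M := (1 + / (1 - r) + / (t0 - r))%R).
    assert (I1 : (0 < / (1 - r))%R) by (apply Rinv_0_lt_compat; lra).
    assert (I2 : (0 < / (t0 - r))%R) by (apply Rinv_0_lt_compat; lra).
    assert (Bd : forall j k, k <> 0%Z -> (Cmod (zpow a k * / (1 - t j * zpow q k)) <= M * powerRZ s (Z.abs k))%R).
    { intros j k Hk. specialize (Ht j).
      assert (Hn : 1 - t j * zpow q k <> 0).
      { apply one_minus_nz. destruct (annulus_shift_Cmod q (t j) k Hq0 Hq (Hta j)) as [A B].
        destruct (Z_lt_le_dec k 0) as [Hn|Hn]; [specialize (B Hn)|specialize (A Hn)]; lra. }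
      rewrite Cmod_mult, Cmod_inv, Cmod_zpow by auto.
      assert (Hp : (0 < powerRZ s (Z.abs k))%R) by (apply powerRZ_pos; lra).
      assert (Hc : Cmod (t j * zpow q k) = (t j * powerRZ r k)%R).
      { rewrite Cmod_mult, Cmod_R, Cmod_zpow, Rabs_pos_eq by (auto; lra). reflexivity. }
      destruct (Z_lt_le_dec k 0) as [Hk0|Hk0].
      - rewrite Z.abs_neq in * by lia.
        assert (E : (powerRZ r k * (t0 - r) <= Cmod (1 - t j * zpow q k))%R).
        { eapply Rle_trans; [|apply Cmod_one_minus_ge']. rewrite Hc.
          assert (P1 : (powerRZ r (-1) <= powerRZ r k)%R) by (apply powerRZ_le_anti; [lra|lia]).
          assert (P2 : (1 <= powerRZ r k * r)%R).
          { apply Rle_trans with (powerRZ r (-1) * r)%R; [|apply Rmult_le_compat_r; lra].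
            simpl. rewrite Rmult_1_r, Rinv_l; lra. }
          assert (P3 : (0 < powerRZ r k)%R) by (apply powerRZ_pos; lra). nra. }
        assert (P3 : (0 < powerRZ r k)%R) by (apply powerRZ_pos; lra).
        apply Rle_trans with (powerRZ (Cmod a) k * / (powerRZ r k * (t0 - r)))%R.
        + apply Rmult_le_compat_l; [left; apply powerRZ_pos; auto|].
          apply Rinv_le_contravar; auto. apply Rmult_lt_0_compat; lra.
        + replace k with (- - k)%Z at 1 by lia. rewrite (powerRZ_opp_div r) by auto.
          replace (- - k)%Z with k by lia. rewrite Rinv_mult.
          replace (powerRZ r k * powerRZ (r / Cmod a) (- k) * (/ powerRZ r k * / (t0 - r)))%R
            with (/ (t0 - r) * powerRZ (r / Cmod a) (- k))%R by (field; lra).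
          apply Rmult_le_compat; [lra|left; apply powerRZ_pos, Rdiv_lt_0_compat; auto|unfold M; lra|].
          apply powerRZ_le_base; [|lia]. split; [apply Rdiv_lt_0_compat; auto|auto].
      - rewrite Z.abs_eq in * by lia.
        assert (E : (1 - r <= Cmod (1 - t j * zpow q k))%R).
        { eapply Rle_trans; [|apply Cmod_one_minus_ge]. rewrite Hc.
          assert (P1 : (powerRZ r k <= powerRZ r 1)%R) by (apply powerRZ_le_anti; [lra|lia]).
          rewrite powerRZ_1 in P1.
          assert (P3 : (0 < powerRZ r k)%R) by (apply powerRZ_pos; lra). nra. }
        rewrite Rmult_comm. apply Rmult_le_compat.
        + left. apply Rinv_0_lt_compat. lra.
        + left; apply powerRZ_pos; auto.
        + apply Rle_trans with (/ (1 - r))%R; [apply Rinv_le_contravar; lra|unfold M; lra].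
        + apply powerRZ_le_base; [lra|lia]. }
    assert (H0 : has_sum (fun k : Z => if Z.eqb k 0 then RtoC 1 else 0) 1).
    { apply (has_sum_single (fun k : Z => if Z.eqb k 0 then RtoC 1 else 0) 0%Z).
      intros i Hi. destruct (Z.eqb_spec i 0); [lia|auto]. }
    assert (HM : (1 <= M)%R) by (unfold M; lra).
    apply (has_sum_dominated (fun j k => (1 - t j) * (zpow a k * / (1 - t j * zpow q k)))
      (fun k : Z => if Z.eqb k 0 then RtoC 1 else 0) (fun k => (M * powerRZ s (Z.abs k))%R)); auto.
    - apply Rsummable_scal; [lra|]. now apply Rsummable_Zgeom.
    - intros j k. specialize (Ht j). destruct (Z.eq_dec k 0) as [->|Hk].
      + rewrite !zpow_0. replace ((1 - t j) * (1 * / (1 - t j * 1))) with (RtoC 1).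
        * rewrite Cmod_1. simpl. lra.
        * field. replace (1 - t j * 1) with (1 - t j) by ring. auto.
      + rewrite Cmod_mult, <- RtoC_minus, Cmod_R, Rabs_pos_eq by lra.
        specialize (Bd j k Hk). pose proof (Cmod_ge_0 (zpow a k * / (1 - t j * zpow q k))). nra.
    - intros k. assert (0 < powerRZ s (Z.abs k))%R by (apply powerRZ_pos; lra).
      destruct (Z.eqb_spec k 0) as [->|Hk].
      + rewrite Cmod_1. simpl. lra.
      + rewrite Cmod_0. nra.
    - intros k. destruct (Z.eqb_spec k 0) as [->|Hk].
      + eapply Cto_ext; [|apply (Cto_const 1)]. intros j. rewrite !zpow_0. field.
        replace (1 - t j * 1) with (1 - t j) by ring. auto.
      + intros eps He. set (P := (M * powerRZ s (Z.abs k))%R).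
        assert (HP : (0 < P)%R) by (apply Rmult_lt_0_compat; [lra|apply powerRZ_pos; lra]).
        destruct (Htl (eps / P)%R) as [N HN]; [now apply Rdiv_lt_0_compat|].
        exists N. intros n Hn. specialize (HN n Hn). specialize (Ht n). specialize (Bd n k Hk).
        replace (RtoC (1 - t n) - 0) with (RtoC (1 - t n)) in HN by ring.
        rewrite Cmod_R, Rabs_pos_eq in HN by lra.
        replace ((1 - t n) * (zpow a k * / (1 - t n * zpow q k)) - 0) with
          (RtoC (1 - t n) * (zpow a k * / (1 - t n * zpow q k))) by (rewrite RtoC_minus; ring).
        rewrite Cmod_mult, Cmod_R, Rabs_pos_eq by lra. fold P in Bd.
        apply Rle_lt_trans with ((1 - t n) * P)%R; [apply Rmult_le_compat_l; lra|].
        apply Rlt_le_trans with (eps / P * P)%R; [apply Rmult_lt_compat_r; auto|]. right. field. lra.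
    - intros j. apply has_sum_scal. rewrite (kron_sym q a (t j)); auto. now apply kron_series. }
  assert (L3 : Cto (fun j => theta q (a * t j)) (theta q a)).
  { assert (Ht0n : RtoC t0 <> 0) by (intros E; apply RtoC_inj in E; lra).
    assert (Sm : forall w : C, w <> 0 -> Rsummable (fun k => Cmod (tht q w k))).
    { intros w Hw. exact (has_sum_summable _ _ (theta_has_sum q w Hq0 Hq Hw)). }
    apply (has_sum_dominated (fun j => tht q (a * t j)) (tht q a)
      (fun k => (Cmod (tht q a k) + Cmod (tht q (a * t0) k))%R)).
    - apply Rsummable_plus; apply Sm; auto using Cmult_neq_0.
    - intros j k. rewrite !Cmod_tht, !Cmod_mult, !powerRZ_mult, !Cmod_R by auto using Cmult_neq_0.
      specialize (Ht j). rewrite !Rabs_pos_eq by lra. fold r.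
      assert (P1 : (0 < powerRZ r (tri k) * powerRZ (Cmod a) k)%R)
        by (apply Rmult_lt_0_compat; apply powerRZ_pos; auto).
      rewrite <- !Rmult_assoc. set (X := (powerRZ r (tri k) * powerRZ (Cmod a) k)%R) in *.
      assert (P2 : (0 < powerRZ t0 k)%R) by (apply powerRZ_pos; lra).
      (* t^k is at most 1 for k >= 0 and at most t0^k for k < 0, so the theta series at a and at a
         t0 together dominate. *)
      assert (P3 : (powerRZ (t j) k <= 1 + powerRZ t0 k)%R); [|nra].
      destruct (Z_lt_le_dec k 0) as [Hk|Hk].
      + assert (powerRZ (t j) k <= powerRZ t0 k)%R; [|lra].
        replace k with (- - k)%Z by lia. rewrite !(powerRZ_neg' _ (- k)).
        apply Rinv_le_contravar; [apply powerRZ_pos; lra|]. apply powerRZ_le_base; [lra|lia].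
      + assert (powerRZ (t j) k <= powerRZ (t j) 0)%R by (apply powerRZ_le_anti; [lra|lia]).
        simpl in H. lra.
    - intros k. pose proof (Cmod_ge_0 (tht q (a * t0) k)). lra.
    - intros k. unfold tht. apply Cto_scal. apply Cto_zpow; auto.
      pose proof (Cto_scal a _ _ (Cto_plus _ _ _ _ (Cto_const 1) (Cto_scal (-(1)) _ _ Htl))) as L.
      replace (a * (1 + - (1) * 0)) with a in L by ring. eapply Cto_ext; [|exact L].
      intros j. cbv beta. rewrite RtoC_minus. ring.
    - intros j. apply theta_has_sum; auto using Cmult_neq_0.
    - now apply theta_has_sum. }
  apply (Cto_unique (fun j => lerch q a * theta q (a * t j))).
  - now apply Cto_scal.
  - replace (qpinf q ^ 3) with (1 * qpinf q ^ 3) by ring.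
    eapply Cto_ext; [|apply (Cto_mult _ _ _ _ L2 L1)]. intros j. cbv beta.
    rewrite <- kron_theta by auto. field. auto.
Qed.

(** Read off from [lerch_theta]: a factor of a nonzero constant cannot vanish. *)
Lemma theta_nz (q a : C) : q <> 0 -> (Cmod q < 1)%R -> annulus q a -> theta q a <> 0.
Proof.
  intros Hq0 Hq Ha E. pose proof (lerch_theta q a Hq0 Hq Ha) as H. rewrite E, Cmult_0_r in H.
  apply (Cpow_nz (qpinf q) 3); auto. now apply qpinf_nz.
Qed.

Lemma Cinv_nz (y : C) : y <> 0 -> / y <> 0.
Proof. intros Hy E. apply C1_nz. rewrite <- (Cinv_r y Hy), E. ring. Qed.

Lemma theta_reflect (q y : C) : q <> 0 -> (Cmod q < 1)%R -> y <> 0 ->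
  theta q (q / y) = theta q y.
Proof.
  intros Hq0 Hq Hy. apply sumC_eq.
  assert (Hb : forall k : Z, (- - k = k)%Z) by (intros; lia).
  eapply has_sum_ext; [|apply (has_sum_bij Z.opp Z.opp _ _ Hb Hb (theta_has_sum q y Hq0 Hq Hy))].
  intros k. unfold tht. unfold Cdiv.
  rewrite zpow_mul_l, zpow_inv_l by auto using Cinv_nz.
  rewrite (sgn_even k (- k)) by (exists (- k)%Z; lia).
  replace (tri (- k)) with (tri k + k)%Z.
  - rewrite zpow_add by auto. ring.
  - pose proof (tri_spec k). pose proof (tri_spec (- k)). nia.
Qed.

Lemma theta_inv (q y : C) : q <> 0 -> (Cmod q < 1)%R -> y <> 0 ->
  theta q (/ y) = - / y * theta q y.
Proof.
  intros Hq0 Hq Hy. apply sumC_eq.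
  assert (Hb : forall k : Z, (1 - (1 - k) = k)%Z) by (intros; lia).
  eapply has_sum_ext; [|apply has_sum_scal,
    (has_sum_bij (fun k => (1 - k)%Z) (fun k => (1 - k)%Z) _ _ Hb Hb (theta_has_sum q y Hq0 Hq Hy))].
  intros k. unfold tht. rewrite zpow_inv_l by auto.
  rewrite (sgn_odd k (1 - k)) by (exists (- k)%Z; lia).
  replace (tri (1 - k)) with (tri k).
  - replace (1 - k)%Z with (- k + 1)%Z by lia. rewrite zpow_succ by auto. field; auto.
  - pose proof (tri_spec k). pose proof (tri_spec (1 - k)). nia.
Qed.

(** Factors of the base-q product are sorted by the parity of the power of q: even powers go to w,
    odd ones to wq. *)
Lemma tprod_split (q w : C) N : q <> 0 -> w <> 0 ->
  tprod (q * q) w N * tprod (q * q) (w * q) N = tprod q w (2 * N).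
Proof.
  intros Hq Hw. induction N as [|N IH]; [simpl; ring|].
  replace (2 * S N)%nat with (S (S (2 * N))) by lia. cbn [tprod]. rewrite <- IH.
  assert (E : forall n, (q * q) ^ n = q ^ (2 * n)).
  { intros n. rewrite Cpow_mult_r. f_equal. simpl. ring. }
  rewrite !E. replace (2 * S N)%nat with (S (S (2 * N))) by lia. cbn [Cpow]. field. auto.
Qed.

Lemma Cmod_sq_lt (q : C) : (Cmod q < 1)%R -> (Cmod (q * q) < 1)%R.
Proof. intros H. rewrite Cmod_mult. pose proof (Cmod_ge_0 q). nra. Qed.

(** Turns a quotient of thetas in bases q^2 and q into the reciprocal of a single theta in base q^2,
    up to constants coming from three triple products. *)
Lemma theta_split (q w : C) : q <> 0 -> (Cmod q < 1)%R -> w <> 0 ->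
  theta (q * q) w * theta (q * q) (w * q) * qpinf q = qpinf (q * q) ^ 2 * theta q w.
Proof.
  intros Hq0 Hq Hw. pose proof (Cmod_sq_lt q Hq) as HQ.
  assert (HQ0 : q * q <> 0) by now apply Cmult_neq_0.
  assert (Hwq : w * q <> 0) by now apply Cmult_neq_0.
  pose proof (Cto_mult _ _ _ _ (triple_product (q * q) w HQ0 HQ Hw)
    (triple_product (q * q) (w * q) HQ0 HQ Hwq)) as L.
  apply (Cto_ext _ _ _ (fun N => tprod_split q w N Hq0 Hw)) in L.
  assert (Hs : forall n, (n <= 2 * n)%nat) by (intros; lia).
  pose proof (Cto_unique _ _ _ L (Cto_shift _ _ _ Hs (triple_product q w Hq0 Hq Hw))) as E.
  pose proof (qpinf_nz q Hq) as N1. pose proof (qpinf_nz (q * q) HQ) as N2.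
  replace (theta q w) with (theta q w * / qpinf q * qpinf q) by (field; auto).
  rewrite <- E. field. auto.
Qed.

(** * The exponential *)

Lemma ee_plus (a b : C) : ee (a + b) = ee a * ee b.
Proof.
  unfold ee. rewrite Cmult_plus_distr_l. generalize (RtoC (2 * PI) * Ci * a) (RtoC (2 * PI) * Ci * b).
  intros [x y] [x' y']. unfold cexp, Cplus, Cmult, Re, Im. simpl.
  rewrite exp_plus, cos_plus, sin_plus. f_equal; ring.
Qed.

Lemma ee_coords (x y : R) :
  ee (x, y) = (exp (- (2 * PI * y)) * cos (2 * PI * x), exp (- (2 * PI * y)) * sin (2 * PI * x))%R.
Proof.
  unfold ee, cexp, RtoC, Ci, Cmult, Re, Im. simpl. f_equal; f_equal; f_equal; ring.
Qed.

Lemma ee_0 : ee 0 = 1.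
Proof.
  change (RtoC 0) with (0%R, 0%R). rewrite ee_coords, !Rmult_0_r, Ropp_0, exp_0, cos_0, sin_0.
  unfold RtoC. f_equal; ring.
Qed.

Lemma ee_nz (z : C) : ee z <> 0.
Proof.
  intros E. apply C1_nz. rewrite <- ee_0. replace (RtoC 0) with (z + - z) at 1 by ring.
  rewrite ee_plus, E. ring.
Qed.

Lemma Cmod_ee (z : C) : Cmod (ee z) = exp (- (2 * PI * Im z)).
Proof.
  destruct z as [x y]. rewrite ee_coords. simpl Im. unfold Cmod. simpl fst; simpl snd.
  set (E := exp (- (2 * PI * y))).
  replace ((E * cos (2 * PI * x)) ^ 2 + (E * sin (2 * PI * x)) ^ 2)%R with (E * E)%R.
  - apply sqrt_square. left; apply exp_pos.
  - pose proof (sin2_cos2 (2 * PI * x)) as H. unfold Rsqr in H.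
    replace (E * E)%R with (E * E * 1)%R by ring. rewrite <- H. ring.
Qed.

Lemma Cmod_ee_lt_1 (tau : C) : (0 < Im tau)%R -> (Cmod (ee tau) < 1)%R.
Proof.
  intros H. rewrite Cmod_ee, <- exp_0. apply exp_increasing. pose proof PI_RGT_0. nra.
Qed.

Lemma ee_IZR (k : Z) (z : C) : ee (IZR k * z) = zpow (ee z) k.
Proof.
  revert k. apply (Z.bi_induction (fun k => ee (IZR k * z) = zpow (ee z) k)).
  - intros x y ->; tauto.
  - rewrite Cmult_0_l. apply ee_0.
  - intros k. unfold Z.succ. rewrite plus_IZR, RtoC_plus, Cmult_plus_distr_r, ee_plus, Cmult_1_l.
    rewrite zpow_succ by apply ee_nz. pose proof (ee_nz z). split; [now intros ->|].
    intros E. replace (ee (IZR k * z)) with (ee (IZR k * z) * ee z * / ee z) by (field; auto).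
    rewrite E. field; auto.
Qed.

Lemma ee_half : ee (RtoC (/ 2)) = -(1).
Proof.
  unfold RtoC at 1. rewrite ee_coords. replace (2 * PI * / 2)%R with PI by field.
  rewrite Rmult_0_r, Ropp_0, exp_0, cos_PI, sin_PI. unfold RtoC, Copp. simpl. f_equal; ring.
Qed.

Lemma qpow_plus (tau : C) x y : qpow tau (x + y) = qpow tau x * qpow tau y.
Proof. unfold qpow. rewrite RtoC_plus, Cmult_plus_distr_r. apply ee_plus. Qed.

Lemma qpow_IZR (tau : C) k : qpow tau (IZR k) = zpow (ee tau) k.
Proof. apply ee_IZR. Qed.

Lemma qpow_nz (tau : C) x : qpow tau x <> 0.
Proof. apply ee_nz. Qed.

Lemma qpow_double (tau : C) x : qpow (RtoC 2 * tau) x = qpow tau (2 * x).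
Proof. unfold qpow. f_equal. rewrite RtoC_mult. ring. Qed.

Lemma ee_double (tau : C) : ee (RtoC 2 * tau) = ee tau * ee tau.
Proof. rewrite <- ee_plus. f_equal. ring. Qed.

(** For n = m + 1/2 one has n^2/2 = 1/8 + m(m+1)/2, and m(m+1)/2 = [tri (- m)]; the sign change of
    the index explains the argument 1/ζ. *)
Lemma vartheta_theta (z tau : C) : (0 < Im tau)%R ->
  vartheta z tau = qpow tau (/ 8) * ee (/ 2 * z) * ee (/ 4) * theta (ee tau) (/ ee z).
Proof.
  intros Ht. apply has_sum_Zsum.
  assert (Hb : forall k : Z, (- - k = k)%Z) by (intros; lia).
  eapply has_sum_ext; [|apply has_sum_scal, (has_sum_bij Z.opp Z.opp _ _ Hb Hb
    (theta_has_sum (ee tau) (/ ee z) (ee_nz tau) (Cmod_ee_lt_1 tau Ht) (Cinv_nz _ (ee_nz z))))].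
  intros m. cbv beta zeta. unfold tht. rewrite zpow_inv_l by apply ee_nz. rewrite Z.opp_involutive.
  replace ((IZR m + / 2) * (IZR m + / 2) / 2)%R with (/ 8 + IZR (tri (- m)))%R.
  2: { pose proof (f_equal IZR (tri_spec (- m))) as E. rewrite !mult_IZR, minus_IZR, opp_IZR in E. lra. }
  rewrite qpow_plus, qpow_IZR.
  replace (RtoC (IZR m + / 2) * (z + RtoC (/ 2))) with
    ((/ 2 * z + IZR m * z) + (/ 4 + IZR m * RtoC (/ 2))).
  2: { rewrite RtoC_plus. rewrite RtoC_inv by lra. field. }
  rewrite !ee_plus, !ee_IZR, ee_half.
  replace (sgn (- m)) with (zpow (- (1)) m) by (symmetry; apply (sgn_even m); exists (- m)%Z; lia).
  ring.
Qed.

Lemma eta_partial_qp (tau : C) N : eta_partial tau N = qp (ee tau) N.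
Proof.
  induction N as [|N IH]; [reflexivity|]. cbn [eta_partial qp]. rewrite IH.
  do 2 f_equal. rewrite INR_IZR_INZ, qpow_IZR, zpow_of_nat. reflexivity.
Qed.

Lemma eta_qpinf (tau : C) : eta tau = qpow tau (/ 24) * qpinf (ee tau).
Proof.
  unfold eta, qpinf, Clim. f_equal. f_equal; f_equal; apply Lim_seq_ext; intros N;
    now rewrite eta_partial_qp.
Qed.

Lemma vartheta_quotient (z tau : C) : (0 < Im tau)%R ->
  annulus (ee tau) (ee z) ->
  vartheta z (RtoC 2 * tau) / vartheta z tau =
  qpow tau (/ 8) * (theta (ee tau * ee tau) (ee z) / theta (ee tau) (ee z)).
Proof.
  intros Ht Ha.
  assert (Ht2 : (0 < Im (RtoC 2 * tau))%R) by (rewrite im_scal_l; lra).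
  pose proof (Cmod_ee_lt_1 tau Ht) as Hq. pose proof (ee_nz tau) as Hq0. pose proof (ee_nz z) as Hz.
  rewrite !vartheta_theta, ee_double, qpow_double by auto.
  rewrite !theta_inv by auto using Cmult_neq_0, Cmod_sq_lt.
  pose proof (theta_nz _ _ Hq0 Hq Ha) as Hn.
  replace (2 * / 8)%R with (/ 8 + / 8)%R by lra. rewrite qpow_plus.
  pose proof (qpow_nz tau (/ 8)). pose proof (ee_nz (/ 2 * z)). pose proof (ee_nz (/ 4)).
  field. repeat split; auto.
Qed.

Lemma annulus_sq (q y : C) : q <> 0 -> (Cmod q < 1)%R -> annulus q y ->
  annulus (q * q) y /\ annulus (q * q) (y * q) /\ annulus (q * q) (q / y).
Proof.
  intros Hq0 Hq Hy. pose proof (annulus_nz q y Hy) as Hy0. destruct Hy as [H1 H2].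
  apply Cmod_gt_0 in Hq0 as Hr. unfold annulus. rewrite Cmod_div by auto. rewrite !Cmod_mult.
  repeat split; try nra.
  - apply Rmult_lt_reg_r with (Cmod y); [lra|].
    replace (Cmod q / Cmod y * Cmod y)%R with (Cmod q) by (field; lra).
    rewrite <- (Rmult_1_r (Cmod q)) at 3. rewrite Rmult_assoc. apply Rmult_lt_compat_l; nra.
  - apply Rmult_lt_reg_r with (Cmod y); [lra|].
    replace (Cmod q / Cmod y * Cmod y)%R with (Cmod q) by (field; lra). lra.
Qed.

(** In base q^2 take a = q/(xw) and z = xq. Reflection gives θ(az) = θ(q^2/w) = θ(w) and θ(a) =
    θ(xwq), so K is (q^2;q^2)^3 θ(w) / (θ(xq) θ(xwq)). Two uses of [theta_split] give (q^2;q^2)^4 /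
    (q;q)^2 and U gives another (q;q)^(-3), whence the constant; each of the three quotients
    contributes q^(1/8). *)
Lemma fF_kron_lerch (tau z1 z2 : C) : (0 < Im tau)%R -> region tau z1 z2 ->
  let q := ee tau in let x := ee z1 in let w := ee z2 in
  fF z1 z2 tau = qpow tau (3 / 8) * (qpinf (q * q) / qpinf q ^ 5) *
    (kron (q * q) (q / (x * w)) (x * q) * lerch q w).
Proof.
  intros Ht [Hx [Hw Hxw]] q x w. unfold fF.
  assert (Exw : ee (z1 + z2) = x * w) by apply ee_plus.
  fold q x in Hx. fold q w in Hw. fold q x w in Hxw.
  change (annulus q x) in Hx. change (annulus q w) in Hw. change (annulus q (x * w)) in Hxw.
  pose proof (Cmod_ee_lt_1 tau Ht) as Hq. fold q in Hq. pose proof (ee_nz tau) as Hq0. fold q in Hq0.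
  pose proof (ee_nz z1) as Hx0. fold x in Hx0. pose proof (ee_nz z2) as Hw0. fold w in Hw0.
  assert (Hxw0 : x * w <> 0) by now apply Cmult_neq_0.
  assert (HQ0 : q * q <> 0) by now apply Cmult_neq_0. pose proof (Cmod_sq_lt q Hq) as HQ.
  assert (Vn : forall z, annulus q (ee z) -> vartheta z tau <> 0).
  { intros z Hz. rewrite vartheta_theta by auto. fold q. rewrite theta_inv by auto using ee_nz.
    pose proof (theta_nz q _ Hq0 Hq Hz). repeat apply Cmult_neq_0; auto using ee_nz, qpow_nz.
    intros E. apply (Cinv_nz _ (ee_nz z)). replace (/ ee z) with (- - / ee z) by ring. rewrite E. ring. }
  pose proof (Vn z1 Hx). pose proof (Vn z2 Hw).
  assert (vartheta (z1 + z2) tau <> 0) by (apply Vn; rewrite Exw; auto).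
  match goal with |- (?a * ?b * ?c) / (?d * ?e * ?f) = _ =>
    replace ((a * b * c) / (d * e * f)) with ((a / d) * (b / e) * (c / f)) by (field; auto) end.
  rewrite !vartheta_quotient; auto; [|rewrite Exw; auto]. rewrite Exw. fold q x w.
  destruct (annulus_sq q x Hq0 Hq Hx) as (X1 & X2 & X3).
  destruct (annulus_sq q w Hq0 Hq Hw) as (W1 & W2 & W3).
  destruct (annulus_sq q (x * w) Hq0 Hq Hxw) as (Y1 & Y2 & Y3).
  pose proof (theta_split q x Hq0 Hq Hx0) as Sx. pose proof (theta_split q (x * w) Hq0 Hq Hxw0) as Sxw.
  pose proof (kron_theta (q * q) (q / (x * w)) (x * q) HQ0 HQ Y3 X2) as K.
  pose proof (lerch_theta (q * q) (q / (x * w)) HQ0 HQ Y3) as LQ.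
  pose proof (lerch_theta q w Hq0 Hq Hw) as Lq.
  replace (q / (x * w) * (x * q)) with ((q * q) / w) in K by (field; auto).
  rewrite theta_reflect in K by auto.
  replace (q / (x * w)) with ((q * q) / (x * w * q)) in LQ at 2 by (field; auto).
  rewrite theta_reflect in LQ by (auto using Cmult_neq_0).
  pose proof (theta_nz (q * q) x HQ0 HQ X1). pose proof (theta_nz (q * q) (x * w) HQ0 HQ Y1).
  pose proof (theta_nz (q * q) (x * q) HQ0 HQ X2). pose proof (theta_nz (q * q) (x * w * q) HQ0 HQ Y2).
  pose proof (theta_nz q w Hq0 Hq Hw).
  pose proof (theta_nz q x Hq0 Hq Hx). pose proof (theta_nz q (x * w) Hq0 Hq Hxw).
  pose proof (qpinf_nz q Hq). pose proof (qpinf_nz _ HQ).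
  replace (3 / 8)%R with (/ 8 + / 8 + / 8)%R by lra. rewrite !qpow_plus.
  assert (Ex : theta (q * q) x / theta q x = qpinf (q * q) ^ 2 / (qpinf q * theta (q * q) (x * q))).
  { replace (theta q x) with (/ qpinf (q * q) ^ 2 * (qpinf (q * q) ^ 2 * theta q x))
      by (field; auto). rewrite <- Sx. field. auto. }
  assert (Exw' : theta (q * q) (x * w) / theta q (x * w) =
                 qpinf (q * q) ^ 2 / (qpinf q * theta (q * q) (x * w * q))).
  { replace (theta q (x * w)) with (/ qpinf (q * q) ^ 2 * (qpinf (q * q) ^ 2 * theta q (x * w)))
      by (field; auto). rewrite <- Sxw. field. auto. }
  rewrite Ex, Exw'.
  assert (Ek : kron (q * q) (q / (x * w)) (x * q) =
     qpinf (q * q) ^ 3 * theta (q * q) w / (theta (q * q) (x * q) * theta (q * q) (x * w * q))).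
  { replace (kron (q * q) (q / (x * w)) (x * q)) with
      (kron (q * q) (q / (x * w)) (x * q) * theta (q * q) (x * q) / theta (q * q) (x * q)) by (field; auto).
    rewrite K, <- LQ. field. auto. }
  assert (El : lerch q w = qpinf q ^ 3 / theta q w) by (rewrite <- Lq; field; auto).
  rewrite Ek, El. field. auto 10.
Qed.

(** * Laurent coefficients *)

(** The coefficient of x^A w^B in a product of terms of K and U. With indices (n, k) in [kap] and
    (m, s) in [ups] the monomial is x^(n-k) w^(s-k), so n = A + k and s = B + k, leaving k and m
    free. *)
Definition cterm (q : C) (A B : Z) (p : Z * Z) : C :=
  let '(k, m) := p in
  sgC (A + k) k * sgC m (B + k) * sgn m *
  zpow q (2 * (A + k) * k + A + 2 * k + tri (m + 1) + m * (B + k)).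

Definition lcoef (q : C) (A B : Z) : C := sumC (cterm q A B).

Lemma kron_lerch_has_sum (q x w : C) :
  q <> 0 -> (Cmod q < 1)%R -> annulus q x -> annulus q w -> annulus q (x * w) ->
  has_sum (fun P : (Z * Z) * (Z * Z) => (zpow x (fst (fst P)) * zpow w (snd (fst P))) *
             cterm q (fst (fst P)) (snd (fst P)) (snd P))
    (kron (q * q) (q / (x * w)) (x * q) * lerch q w).
Proof.
  intros Hq0 Hq Hx Hw Hxw.
  pose proof (annulus_nz q x Hx) as Hx0. pose proof (annulus_nz q w Hw) as Hw0.
  assert (Hxw0 : x * w <> 0) by now apply Cmult_neq_0.
  assert (HQ0 : q * q <> 0) by now apply Cmult_neq_0. pose proof (Cmod_sq_lt q Hq) as HQ.
  destruct (annulus_sq q x Hq0 Hq Hx) as (_ & X2 & _).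
  destruct (annulus_sq q (x * w) Hq0 Hq Hxw) as (_ & _ & Y3).
  pose proof (has_sum_mult _ _ _ _ (sumC_spec _ (kap_summable _ _ _ HQ0 HQ Y3 X2))
    (sumC_spec _ (ups_summable q w Hq0 Hq Hw))) as H.
  set (phi := fun P : (Z * Z) * (Z * Z) => let '((A, B), (k, m)) := P in ((A + k, k), (m, B + k))%Z).
  set (psi := fun P : (Z * Z) * (Z * Z) => let '((n, k), (m, s)) := P in ((n - k, s - k), (k, m))%Z).
  assert (B1 : forall p, psi (phi p) = p)
    by (intros [[a b] [c d]]; unfold psi, phi; f_equal; f_equal; lia).
  assert (B2 : forall p, phi (psi p) = p)
    by (intros [[a b] [c d]]; unfold psi, phi; f_equal; f_equal; lia).
  eapply has_sum_ext; [|exact (has_sum_bij phi psi _ _ B1 B2 H)].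
  intros [[A B] [k m]]. unfold phi, kap, ups, cterm. cbn [fst snd].
  rewrite zpow_mul_l, zpow_mul_l by auto. unfold Cdiv.
  rewrite zpow_mul_l, zpow_inv_l, zpow_mul_l by auto using Cinv_nz.
  replace (zpow q (2 * (A + k) * k + A + 2 * k + tri (m + 1) + m * (B + k))) with
    (zpow q ((A + k) * k) * zpow q ((A + k) * k) * zpow q (A + k) * zpow q k *
      zpow q (tri (m + 1) + m * (B + k))).
  2: { rewrite <- !zpow_add by auto. f_equal. lia. }
  replace (zpow x (A + k)) with (zpow x A * zpow x k) by (rewrite <- zpow_add; auto).
  replace (zpow w (B + k)) with (zpow w B * zpow w k) by (rewrite <- zpow_add; auto).
  rewrite !zpow_opp by auto. field. auto using zpow_nz.
Qed.

(** No estimate of the exponent is made: the family is a row of an absolutely convergent sum,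
    divided by a nonzero monomial. One point of the region is enough. *)
Lemma cterm_has_sum_at (q x w : C) A B :
  q <> 0 -> (Cmod q < 1)%R -> annulus q x -> annulus q w -> annulus q (x * w) ->
  has_sum (cterm q A B) (lcoef q A B).
Proof.
  intros Hq0 Hq Hx Hw Hxw.
  pose proof (annulus_nz q x Hx) as Hx0. pose proof (annulus_nz q w Hw) as Hw0.
  pose proof (summable_row _ (A, B) (has_sum_summable _ _ (kron_lerch_has_sum q x w Hq0 Hq Hx Hw Hxw))) as S.
  destruct (summable_has_sum _ S) as [l Hl]. cbn [fst snd] in Hl.
  apply sumC_spec. apply (has_sum_summable _ (/ (zpow x A * zpow w B) * l)).
  eapply has_sum_ext; [|apply has_sum_scal, Hl]. intros p. cbv beta. field. auto using zpow_nz.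
Qed.

(** Imaginary part Im τ / 3 gives |ζ_j| = |q|^(1/3) and |ζ_1 ζ_2| = |q|^(2/3), inside the region;
    real translations preserve moduli and will carry the roots of unity. *)
Lemma region_real_shift (tau : C) (s t : R) : (0 < Im tau)%R ->
  region tau (/ 3 * tau + s) (/ 3 * tau + t).
Proof.
  intros Ht. assert (E : forall s : R, Im (/ 3 * tau + s) = (Im tau / 3)%R).
  { intros u. rewrite <- RtoC_inv by lra.
    change (Im (RtoC (/ 3) * tau + u)) with (Im (RtoC (/ 3) * tau) + 0)%R.
    rewrite im_scal_l. field. }
  pose proof PI_RGT_0 as Hpi.
  unfold region. rewrite <- ee_plus, !Cmod_ee.
  assert (E2 : Im (/ 3 * tau + s + (/ 3 * tau + t)) = (2 * (Im tau / 3))%R).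
  { change (Im (/ 3 * tau + s) + Im (/ 3 * tau + t) = 2 * (Im tau / 3))%R. rewrite !E. ring. }
  rewrite !E, E2, <- exp_0. assert (0 < PI * Im tau)%R by nra.
  repeat split; apply exp_increasing; lra.
Qed.

Lemma cterm_has_sum (tau : C) A B : (0 < Im tau)%R ->
  has_sum (cterm (ee tau) A B) (lcoef (ee tau) A B).
Proof.
  intros Ht. destruct (region_real_shift tau 0 0 Ht) as (H1 & H2 & H3).
  apply (cterm_has_sum_at _ (ee (/ 3 * tau + RtoC 0)) (ee (/ 3 * tau + RtoC 0)));
    auto using ee_nz, Cmod_ee_lt_1.
Qed.

Lemma ee_lin2 (k1 k2 : Z) (z1 z2 : C) :
  ee (IZR k1 * z1 + IZR k2 * z2) = zpow (ee z1) k1 * zpow (ee z2) k2.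
Proof. now rewrite ee_plus, !ee_IZR. Qed.

Lemma fF_laurent (tau : C) : (0 < Im tau)%R ->
  is_laurent_expansion tau (fun z1 z2 => fF z1 z2 tau)
    (fun k1 k2 => qpow tau (3 / 8) * (qpinf (ee tau * ee tau) / qpinf (ee tau) ^ 5) * lcoef (ee tau) k1 k2).
Proof.
  intros Ht z1 z2 Hr. rewrite has_Z2sum_iff. rewrite fF_kron_lerch by auto. cbv zeta.
  pose proof (Cmod_ee_lt_1 tau Ht) as Hq. destruct Hr as (Hx & Hw & Hxw).
  pose proof (kron_lerch_has_sum (ee tau) (ee z1) (ee z2) (ee_nz _) Hq Hx Hw Hxw) as H.
  eapply has_sum_ext; [|apply has_sum_scal; eapply has_sum_rows; [exact H|]].
  - intros [k1 k2]. unfold uncur. cbn [fst snd]. rewrite ee_lin2.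
    instantiate (1 := fun p => zpow (ee z1) (fst p) * zpow (ee z2) (snd p) * lcoef (ee tau) (fst p) (snd p)).
    simpl. ring.
  - intros [k1 k2]. cbn [fst snd]. apply has_sum_scal. now apply cterm_has_sum.
Qed.

(** * Uniqueness of Laurent expansions *)

Lemma has_sum_Csum {I J} (F : J -> I -> C) (l : J -> C) L :
  (forall j, In j L -> has_sum (F j) (l j)) ->
  has_sum (fun i => Csum (fun j => F j i) L) (Csum l L).
Proof.
  induction L as [|x L IH]; intros H; simpl; [apply has_sum_zero|].
  apply has_sum_plus; [apply H; left; auto|]. apply IH. intros j Hj. apply H; right; auto.
Qed.

Lemma Csum_geom (y : C) N : (y - 1) * Csum (fun j => y ^ j) (seq 0 N) = y ^ N - 1.
Proof.
  induction N as [|N IH]; [simpl; ring|].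
  rewrite seq_S, Csum_app, Cmult_plus_distr_l, IH. simpl. ring.
Qed.

Lemma ee_real_eq_1 (t : R) : (-1 < t < 1)%R -> ee t = 1 -> t = 0%R.
Proof.
  intros Ht E. unfold RtoC in E. rewrite ee_coords in E.
  apply (f_equal Re) in E. simpl Re in E. rewrite Rmult_0_r, Ropp_0, exp_0, Rmult_1_l in E.
  replace (2 * PI * t)%R with (2 * (PI * t))%R in E by ring. rewrite cos_2a_sin in E.
  assert (Es : sin (PI * t) = 0%R) by nra.
  pose proof PI_RGT_0 as Hpi.
  destruct (Rtotal_order t 0) as [Hn|[Hz|Hp]]; auto.
  - assert (0 < sin (PI * - t))%R by (apply sin_gt_0; nra).
    replace (PI * - t)%R with (- (PI * t))%R in H by ring. rewrite sin_neg in H. lra.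
  - assert (0 < sin (PI * t))%R by (apply sin_gt_0; nra). lra.
Qed.

Lemma root_of_unity_sum (N : nat) (e : Z) : (0 < N)%nat ->
  (e <> 0)%Z -> (Z.abs e < Z.of_nat N)%Z ->
  Csum (fun j => ee (IZR e / INR N)%R ^ j) (seq 0 N) = 0.
Proof.
  intros HN He Hb. set (y := ee (IZR e / INR N)%R).
  assert (HN' : (0 < INR N)%R) by now apply lt_0_INR.
  assert (Hy1 : y <> 1).
  { intros E. apply ee_real_eq_1 in E.
    - apply He. apply eq_IZR. replace (IZR e) with (IZR e / INR N * INR N)%R by (field; lra).
      rewrite E. ring.
    - apply IZR_lt in Hb. rewrite abs_IZR, <- INR_IZR_INZ in Hb. apply Rabs_def2 in Hb.
      split; apply Rmult_lt_reg_r with (INR N); auto;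
        replace (IZR e / INR N * INR N)%R with (IZR e) by (field; lra); lra. }
  assert (HyN : y ^ N = 1).
  { rewrite <- zpow_of_nat. unfold y. rewrite <- ee_IZR, <- INR_IZR_INZ, <- RtoC_mult.
    replace (INR N * (IZR e / INR N))%R with (IZR e) by (field; lra).
    replace (RtoC (IZR e)) with (IZR e * 1) by ring. rewrite ee_IZR.
    replace (ee 1) with (RtoC 1); [apply zpow_one_l|].
    replace (RtoC 1) with (RtoC (/ 2) + RtoC (/ 2)) at 2 by (rewrite <- RtoC_plus; f_equal; lra).
    rewrite ee_plus, ee_half. ring. }
  pose proof (Csum_geom y N) as G. rewrite HyN in G.
  assert (Hn : y - 1 <> 0) by (intros E; apply Hy1, Ceq_minus, E).
  replace (Csum (fun j => y ^ j) (seq 0 N)) with (/ (y - 1) * ((y - 1) * Csum (fun j => y ^ j) (seq 0 N)))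
    by (field; auto).
  rewrite G. ring.
Qed.

(* Averaging over the translates (z1 + j/N, z2 + jH/N), j < N, isolates the coefficients whose
   index is congruent to the given one along (1, H); all but finitely many terms are negligible. *)
Lemma laurent_unique (tau : C) (g : C -> C -> C) (c c' : Z -> Z -> C) :
  (0 < Im tau)%R -> is_laurent_expansion tau g c -> is_laurent_expansion tau g c' ->
  forall a b, c a b = c' a b.
Proof.
  intros Ht Hc Hc' a b.
  set (z0 := / 3 * tau).
  set (D := fun p : Z * Z => (c (fst p) (snd p) - c' (fst p) (snd p)) *
              ee (IZR (fst p) * z0 + IZR (snd p) * z0)).
  assert (Hsh : forall s t : R, has_sum (fun p => D p * ee (IZR (fst p) * s + IZR (snd p) * t)) 0).
  { intros s t. pose proof (region_real_shift tau s t Ht) as Hr.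
    pose proof (proj1 (has_Z2sum_iff _ _) (Hc _ _ Hr)) as H1.
    pose proof (proj1 (has_Z2sum_iff _ _) (Hc' _ _ Hr)) as H2.
    pose proof (has_sum_plus _ _ _ _ H1 (has_sum_scal (-(1)) _ _ H2)) as H3.
    match type of H3 with has_sum _ ?l => replace (RtoC 0) with l by ring end.
    eapply has_sum_ext; [|exact H3]. intros [k1 k2]. unfold uncur, D, z0. cbn [fst snd].
    replace (IZR k1 * (/ 3 * tau + s) + IZR k2 * (/ 3 * tau + t)) with
      ((IZR k1 * (/ 3 * tau) + IZR k2 * (/ 3 * tau)) + (IZR k1 * s + IZR k2 * t)) by ring.
    rewrite (ee_plus (_ + _)). ring. }
  assert (HD : summable D).
  { apply (has_sum_summable _ 0). eapply has_sum_ext; [|apply (Hsh 0%R 0%R)].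
    intros p. cbv beta. rewrite !Cmult_0_r, Cplus_0_r, ee_0. ring. }
  assert (E : D (a, b) = 0).
  { apply Cmod_small_0. intros eps He.
    destruct (Rsummable_tail _ HD eps He) as [L1 [_ T1]].
    destruct (NoDup_upper_bound [(a, b)] L1) as [L0 [N0 [I1 I2]]].
    assert (T0 : forall L, NoDup L -> (forall i, In i L -> ~ In i L0) ->
                 (Rsum (fun i => Cmod (D i)) L <= eps)%R).
    { intros L HL Hd. apply T1; auto. intros i Hi Hi1. apply (Hd i Hi). auto. }
    assert (HR : exists R : Z, (0 <= R)%Z /\ forall p, In p L0 -> (Z.abs (fst p) <= R /\ Z.abs (snd p) <= R)%Z).
    { clear. induction L0 as [|x L [R [HR IH]]].
      - exists 0%Z. split; [lia|]. intros p [].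
      - exists (Z.abs (fst x) + Z.abs (snd x) + R)%Z. split; [lia|].
        intros p [->|Hp]; [lia|]. apply IH in Hp. lia. }
    destruct HR as [R [HR HRb]].
    (* On the box of radius [R] differences of coordinates are at most 2R < H, so [e p] = 0 only at
       (a, b); [N] exceeds every |e p| there, so no other index is congruent to 0 modulo [N]. *)
    set (H := (2 * R + 1)%Z). set (N := Z.to_nat (2 * R + H * (2 * R) + 1)).
    assert (HN : (0 < N)%nat) by (unfold N, H; nia).
    assert (HN' : (0 < INR N)%R) by now apply lt_0_INR.
    assert (HNz : Z.of_nat N = (2 * R + H * (2 * R) + 1)%Z) by (unfold N, H; lia).
    set (e := fun p : Z * Z => ((fst p - a) + H * (snd p - b))%Z).
    set (s := fun p => Csum (fun j => ee (IZR (e p) / INR N)%R ^ j) (seq 0 N)).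
    assert (Hs : has_sum (fun p => RtoC (/ INR N) * (D p * s p)) 0).
    { replace (RtoC 0) with (RtoC (/ INR N) * Csum (fun _ : nat => 0 * 0) (seq 0 N))
        by (rewrite Csum_scal; ring).
      apply has_sum_scal.
      eapply has_sum_ext; [|apply (has_sum_Csum (fun j p => D p * ee (IZR (e p) / INR N)%R ^ j))].
      - intros p. cbv beta. unfold s. now rewrite Csum_scal.
      - intros j _. cbv beta.
        replace (0 * 0) with (ee (- (INR j * IZR (a + H * b) / INR N)%R) * 0) by ring.
        eapply has_sum_ext; [|apply has_sum_scal,
          (Hsh (INR j / INR N)%R (INR j * IZR H / INR N)%R)].
        intros [k1 k2]. cbv beta. cbn [fst snd].
        rewrite <- zpow_of_nat, <- ee_IZR, <- INR_IZR_INZ, Cmult_comm, <- Cmult_assoc, <- ee_plus.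
        do 2 f_equal. unfold e. cbn [fst snd].
        rewrite <- RtoC_opp, <- !RtoC_mult, <- !RtoC_plus. f_equal.
        rewrite !plus_IZR, !mult_IZR, !minus_IZR. field. lra. }
    assert (Hsb : forall p, (Cmod (s p) <= INR N)%R).
    { intros p. unfold s. eapply Rle_trans; [apply Cmod_Csum|].
      apply Rle_trans with (Rsum (fun _ : nat => 1%R) (seq 0 N)).
      - apply Rsum_le. intros j _. rewrite Cmod_pow, Cmod_ee.
        simpl Im. rewrite Rmult_0_r, Ropp_0, exp_0, pow1. lra.
      - right. clear. generalize 0%nat. induction N as [|N IH]; intros i; [reflexivity|].
        rewrite S_INR. simpl. rewrite IH. ring. }
    set (F := fun p : Z * Z => RtoC (/ INR N) * (D p * s p)) in *.
    (* The averaged family sums to 0 and, as |s p| <= N, is dominated by |D|; hence its part over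
       [L0] is at most eps. On [L0] only (a, b) survives the averaging. *)
    assert (B : (Cmod (RtoC 0 - Csum F L0)%C <= eps)%R).
    { apply (has_sum_tail_bound _ (fun i => Cmod (D i))); auto. intros p. unfold F. rewrite !Cmod_mult, Cmod_R, Rabs_pos_eq
        by (left; now apply Rinv_0_lt_compat).
      specialize (Hsb p). pose proof (Cmod_ge_0 (D p)).
      apply Rmult_le_reg_l with (INR N); auto. rewrite <- Rmult_assoc, Rinv_r, Rmult_1_l by lra. nra. }
    replace (Csum F L0) with (D (a, b)) in B.
    { replace (0 - D (a, b)) with (- D (a, b)) in B by ring. now rewrite Cmod_opp in B. }
    destruct (incl_split [(a, b)] L0) as [K [P [NK Dk]]]; auto.
    { constructor; [simpl; tauto|constructor]. }
    rewrite (Csum_perm _ _ _ P), Csum_app. simpl Csum at 1. unfold F at 1.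
    replace (s (a, b)) with (RtoC (INR N)).
    2: { unfold s, e. cbn [fst snd]. replace (a - a + H * (b - b))%Z with 0%Z by lia.
         replace (0 / INR N)%R with 0%R by (field; lra). rewrite ee_0. clear.
         generalize 0%nat. induction N as [|N IH]; intros i; [reflexivity|].
         rewrite S_INR, RtoC_plus. simpl. rewrite <- IH, Cpow_1_l. ring. }
    rewrite (Csum_ext _ (fun _ => 0 * 0)).
    - rewrite Csum_scal. rewrite RtoC_inv by lra. field.
      intros E. apply RtoC_inj in E. lra.
    - intros p Hp. unfold F, s. rewrite root_of_unity_sum; auto; [ring| |].
      + unfold e. intros E.
        assert (Hi : In p L0) by (eapply Permutation_in; [symmetry; exact P|apply in_or_app; auto]).
        pose proof (HRb _ Hi). pose proof (HRb _ (I1 _ (or_introl eq_refl))). cbn [fst snd] in *.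
        apply (Dk p Hp). left. destruct p as [p1 p2]. cbn [fst snd] in *.
        assert (p2 = b) by (unfold H in E; nia). subst p2. f_equal. lia.
      + assert (Hi : In p L0) by (eapply Permutation_in; [symmetry; exact P|apply in_or_app; auto]).
        pose proof (HRb _ Hi). pose proof (HRb _ (I1 _ (or_introl eq_refl))). cbn [fst snd] in *.
        rewrite HNz. unfold e, H. nia. }
  unfold D in E. cbn [fst snd] in E. apply Ceq_minus.
  pose proof (ee_nz (IZR a * z0 + IZR b * z0)) as Hn.
  replace (c a b - c' a b) with ((c a b - c' a b) * ee (IZR a * z0 + IZR b * z0) *
    / ee (IZR a * z0 + IZR b * z0)) by (field; auto).
  rewrite E. ring.
Qed.

(** The explicit expansion shows that [epsilon] had something to choose, and uniqueness that it
    chose this one. *)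
Lemma laurent_coeff_f_eq (tau : C) A B : (0 < Im tau)%R ->
  laurent_coeff_f tau A B =
  qpow tau (3 / 8) * (qpinf (ee tau * ee tau) / qpinf (ee tau) ^ 5) * lcoef (ee tau) A B.
Proof.
  intros Ht. pose proof (fF_laurent tau Ht) as H.
  refine (laurent_unique tau _ _ _ Ht _ H A B).
  unfold laurent_coeff_f. apply epsilon_spec. eexists. exact H.
Qed.

(** * The coefficients of F *)

(* Coefficient of ζ1^-x ζ2^-y in 1 / ((1 - ζ1^-1)(1 - ζ2^-1)(1 - ζ1^-1 ζ2^-1)). *)
Definition kostant (x y : Z) : Z := Z.max 0 (Z.min x y + 1).

(** Kostant's multiplicity formula in type A2: an alternating sum over the six Weyl images of (a,
    b), each monomial of the numerator being divided by the denominator as a series in the inverse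
    variables. *)
Definition weight (a b r1 r2 : Z) : Z :=
  (kostant (a - 1 - r1) (b - 1 - r2) - kostant (- a + b - 1 - r1) (b - 1 - r2)
   - kostant (a - 1 - r1) (- b + a - 1 - r2) + kostant (- b - 1 - r1) (- b + a - 1 - r2)
   + kostant (- a + b - 1 - r1) (- a - 1 - r2) - kostant (- b - 1 - r1) (- a - 1 - r2))%Z.

Definition deltaZ (a1 a2 k1 k2 : Z) : Z := if (Z.eqb k1 a1 && Z.eqb k2 a2)%bool then 1%Z else 0%Z.

Definition mul_denomZ (c : Z -> Z -> Z) (k1 k2 : Z) : Z :=
  (c k1 k2 - c (k1 + 1) k2 - c k1 (k2 + 1) + c (k1 + 2) (k2 + 1) + c (k1 + 1) (k2 + 2)
   - c (k1 + 2) (k2 + 2))%Z.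

Lemma mul_denomZ_kostant a1 a2 k1 k2 :
  mul_denomZ (fun x y => kostant (a1 - x) (a2 - y)) k1 k2 = deltaZ a1 a2 k1 k2.
Proof.
  unfold mul_denomZ, kostant, deltaZ.
  destruct (Z.eqb_spec k1 a1), (Z.eqb_spec k2 a2); simpl; lia.
Qed.

Lemma delta2_Z a1 a2 k1 k2 : delta2 a1 a2 k1 k2 = RtoC (IZR (deltaZ a1 a2 k1 k2)).
Proof. unfold delta2, deltaZ. destruct (_ && _)%bool; reflexivity. Qed.

Lemma mul_denom_Z (c : Z -> Z -> Z) k1 k2 :
  mul_denom (fun x y => RtoC (IZR (c x y))) k1 k2 = RtoC (IZR (mul_denomZ c k1 k2)).
Proof.
  unfold mul_denom, mul_denomZ. rewrite ?minus_IZR, ?plus_IZR, ?minus_IZR, ?RtoC_minus, ?RtoC_plus, ?RtoC_minus. ring.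
Qed.

Lemma weight_mul_denom n1 n2 k1 k2 :
  mul_denom (fun x y => RtoC (IZR (weight n1 n2 x y))) k1 k2 = numer n1 n2 k1 k2.
Proof.
  rewrite mul_denom_Z. unfold numer. rewrite !delta2_Z, <- !mul_denomZ_kostant.
  set (M1 := mul_denomZ (fun x y => kostant (n1 - 1 - x) (n2 - 1 - y)) k1 k2).
  set (M2 := mul_denomZ (fun x y => kostant (- n1 + n2 - 1 - x) (n2 - 1 - y)) k1 k2).
  set (M3 := mul_denomZ (fun x y => kostant (n1 - 1 - x) (- n2 + n1 - 1 - y)) k1 k2).
  set (M4 := mul_denomZ (fun x y => kostant (- n2 - 1 - x) (- n2 + n1 - 1 - y)) k1 k2).
  set (M5 := mul_denomZ (fun x y => kostant (- n1 + n2 - 1 - x) (- n1 - 1 - y)) k1 k2).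
  set (M6 := mul_denomZ (fun x y => kostant (- n2 - 1 - x) (- n1 - 1 - y)) k1 k2).
  replace (mul_denomZ (weight n1 n2) k1 k2) with (M1 + - M2 + - M3 + M4 + M5 + - M6)%Z
    by (unfold M1, M2, M3, M4, M5, M6, mul_denomZ, weight; ring).
  rewrite !plus_IZR, !opp_IZR, !RtoC_plus, !RtoC_opp. reflexivity.
Qed.

(** Each of the six series is infinite towards negative exponents; finiteness is a cancellation,
    with a different pairing of the terms according to which of k1, k2 is very negative. *)
Lemma weight_finsupp n1 n2 : finsupp (fun x y => RtoC (IZR (weight n1 n2 x y))).
Proof.
  set (s := (Z.abs n1 + Z.abs n2 + 1)%Z). exists (4 * s)%Z. intros k1 k2 H.
  assert (E : weight n1 n2 k1 k2 = 0%Z); [|now rewrite E].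
  assert (Hs : (Z.abs n1 + Z.abs n2 < s)%Z) by (unfold s; lia). clearbody s.
  assert (K0 : forall x y, (x < 0 \/ y < 0)%Z -> kostant x y = 0%Z) by (unfold kostant; intros; lia).
  assert (Kl : forall x y, (0 <= x <= y)%Z -> kostant x y = (x + 1)%Z) by (unfold kostant; intros; lia).
  assert (Kx : forall x x' y, (y <= x)%Z -> (y <= x')%Z -> kostant x y = kostant x' y)
    by (unfold kostant; intros; lia).
  assert (Ky : forall x y y', (x <= y)%Z -> (x <= y')%Z -> kostant x y = kostant x y')
    by (unfold kostant; intros; lia).
  (* The second pair of arguments is the first with both entries lowered by a + b, so the minimum
     drops by a + b. The three pairings then give (n1+n2) - (2 n2 - n1) - (2 n1 - n2) = 0. *)
  assert (Kp : forall a b, (s - 1 < - k1 -> s - 1 < - k2 -> Z.abs a < s -> Z.abs b < s ->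
     kostant (a - 1 - k1) (b - 1 - k2) - kostant (- b - 1 - k1) (- a - 1 - k2) = a + b)%Z)
    by (unfold kostant; intros; lia).
  unfold weight.
  destruct (Z_lt_le_dec s k1) as [P1|P1]; [rewrite !K0 by lia; lia|].
  destruct (Z_lt_le_dec s k2) as [P2|P2]; [rewrite !K0 by lia; lia|].
  (* Here |k1| is at most s, so k2 < -4s and every minimum is the first argument. The six first
     arguments coincide in pairs of opposite sign; the next case is the mirror image. *)
  destruct (Z_lt_le_dec (- k1) (s + 1)) as [Q1|Q1].
  { rewrite (Ky (n1 - 1 - k1) (- n2 + n1 - 1 - k2) (n2 - 1 - k2))%Z by lia.
    rewrite (Ky (- n1 + n2 - 1 - k1) (- n1 - 1 - k2) (n2 - 1 - k2))%Z by lia.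
    rewrite (Ky (- n2 - 1 - k1) (- n1 - 1 - k2) (- n2 + n1 - 1 - k2))%Z by lia. lia. }
  destruct (Z_lt_le_dec (- k2) (s + 1)) as [Q2|Q2].
  { rewrite (Kx (- n1 + n2 - 1 - k1) (n1 - 1 - k1) (n2 - 1 - k2))%Z by lia.
    rewrite (Kx (- n2 - 1 - k1) (n1 - 1 - k1) (- n2 + n1 - 1 - k2))%Z by lia.
    rewrite (Kx (- n2 - 1 - k1) (- n1 + n2 - 1 - k1) (- n1 - 1 - k2))%Z by lia. lia. }
  pose proof (Kp n1 n2) as H1. pose proof (Kp (- n1 + n2) n2)%Z as H2. pose proof (Kp n1 (- n2 + n1))%Z as H3.
  replace (- (- n1 + n2) - 1 - k2)%Z with (- n2 + n1 - 1 - k2)%Z in H2 by lia.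
  replace (- (- n2 + n1) - 1 - k1)%Z with (- n1 + n2 - 1 - k1)%Z in H3 by lia.
  clear K0 Kx Ky Kp. lia.
Qed.

(* The denominator has leading term 1, so c is determined by downward induction on k1 + k2. *)
Lemma mul_denom_inj (c c' : Z -> Z -> C) :
  finsupp c -> finsupp c' -> (forall k1 k2, mul_denom c k1 k2 = mul_denom c' k1 k2) ->
  forall k1 k2, c k1 k2 = c' k1 k2.
Proof.
  intros [M HM] [M' HM'] H.
  set (B := (2 * (Z.abs M + Z.abs M' + 1))%Z).
  assert (A : forall n : nat, forall k1 k2, (B - Z.of_nat n < k1 + k2)%Z -> c k1 k2 = c' k1 k2).
  { induction n as [|n IH]; intros k1 k2 Hk.
    - rewrite HM, HM'; auto; unfold B in Hk; lia.
    - destruct (Z_lt_le_dec (B - Z.of_nat n) (k1 + k2)) as [Hl|Hl]; [auto|].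
      specialize (H k1 k2). unfold mul_denom in H.
      rewrite !(IH (k1 + _)%Z) in H by lia. rewrite (IH k1 (k2 + 1)%Z) in H by lia.
      apply Ceq_minus. apply Ceq_minus in H. rewrite <- H. ring. }
  intros k1 k2. apply (A (Z.to_nat (B - (k1 + k2) + 1))). lia.
Qed.

Lemma summand_poly_weight n1 n2 r1 r2 : summand_poly n1 n2 r1 r2 = RtoC (IZR (weight n1 n2 r1 r2)).
Proof.
  assert (S : finsupp (summand_poly n1 n2) /\
    forall k1 k2, mul_denom (summand_poly n1 n2) k1 k2 = numer n1 n2 k1 k2).
  { unfold summand_poly. apply epsilon_spec. exists (fun x y => RtoC (IZR (weight n1 n2 x y))).
    split; [apply weight_finsupp|apply weight_mul_denom]. }
  destruct S as [S1 S2].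
  apply (mul_denom_inj (summand_poly n1 n2) (fun x y => RtoC (IZR (weight n1 n2 x y))));
    auto using weight_finsupp.
  intros k1 k2. now rewrite S2, weight_mul_denom.
Qed.

(** The exponent 2 Q(a - 1/2, b - 1/2) of F minus its constant 1/2, which makes it an integer. *)
Definition expo (a b : Z) : Z := (2 * (a * a + b * b - a * b) - a - b)%Z.

Definition fterm (q : C) (r1 r2 : Z) (p : Z * Z) : C :=
  zpow q (expo (fst p) (snd p)) * RtoC (IZR (weight (fst p) (snd p) r1 r2)).

Lemma weight_bound a b r1 r2 :
  (Z.abs (weight a b r1 r2) <= 6 * (Z.abs a + Z.abs b + (Z.abs r1 + 3)))%Z.
Proof.
  assert (K : forall x y, (0 <= kostant x y <= Z.abs x + 1)%Z) by (unfold kostant; intros; lia).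
  unfold weight.
  pose proof (K (a - 1 - r1) (b - 1 - r2))%Z. pose proof (K (- a + b - 1 - r1) (b - 1 - r2))%Z.
  pose proof (K (a - 1 - r1) (- b + a - 1 - r2))%Z. pose proof (K (- b - 1 - r1) (- b + a - 1 - r2))%Z.
  pose proof (K (- a + b - 1 - r1) (- a - 1 - r2))%Z. pose proof (K (- b - 1 - r1) (- a - 1 - r2))%Z.
  clear K. lia.
Qed.

Lemma linear_geom_bound r : (0 < r < 1)%R ->
  exists M, (0 < M)%R /\ forall n, (0 <= n)%Z -> (IZR n * powerRZ r n <= M)%R.
Proof.
  intros Hr. set (d := (/ r - 1)%R).
  assert (Hd : (0 < d)%R).
  { unfold d. assert (1 < / r)%R; [|lra]. rewrite <- Rinv_1. apply Rinv_lt_contravar; lra. }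
  exists (/ d)%R. split; [now apply Rinv_0_lt_compat|]. intros n Hn.
  rewrite <- (Z2Nat.id n Hn), <- pow_powerRZ, <- INR_IZR_INZ. set (m := Z.to_nat n).
  pose proof (poly m d Hd) as P. replace (1 + d)%R with (/ r)%R in P by (unfold d; ring).
  rewrite pow_inv in P. assert (Hp : (0 < r ^ m)%R) by (apply pow_lt; lra).
  apply Rmult_le_reg_l with d; auto. rewrite Rinv_r by lra.
  apply (Rmult_le_compat_r (r ^ m)) in P; [|lra]. rewrite Rinv_l in P by lra. nra.
Qed.

(** With S = |a| + |b| the exponent is at least 2S - 8 and the weight at most linear in S: one
    factor r^S absorbs the weight, the other is the geometric majorant. *)
Lemma fterm_summable (q : C) r1 r2 : q <> 0 -> (Cmod q < 1)%R -> summable (fterm q r1 r2).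
Proof.
  intros Hq0 Hq. apply Cmod_gt_0 in Hq0 as Hr. set (r := Cmod q) in *.
  destruct (linear_geom_bound r) as [M [HM Hb]]; [lra|].
  set (c := (Z.abs r1 + 3)%Z).
  apply (summable_Z2geom r (powerRZ r (-8) * (6 * (M + IZR c)))); [lra|].
  intros a b. unfold fterm. cbn [fst snd]. rewrite Cmod_mult, Cmod_zpow, Cmod_R, <- abs_IZR by auto.
  fold r. set (S := (Z.abs a + Z.abs b)%Z).
  pose proof (weight_bound a b r1 r2) as W. fold S c in W. apply IZR_le in W.
  rewrite mult_IZR, plus_IZR in W.
  assert (E : (S + S - 8 <= expo a b)%Z).
  { unfold expo, S. destruct (Z.abs_spec a) as [[? ->]|[? ->]], (Z.abs_spec b) as [[? ->]|[? ->]];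
      pose proof (Z.square_nonneg (a - b)); nia. }
  assert (P0 : (0 < powerRZ r S)%R) by (apply powerRZ_pos; lra).
  assert (P8 : (0 < powerRZ r (-8))%R) by (apply powerRZ_pos; lra).
  assert (P1 : (powerRZ r S <= 1)%R).
  { change 1%R with (powerRZ r 0). apply powerRZ_le_anti; [lra|unfold S; lia]. }
  rewrite <- powerRZ_add by lra. fold S.
  apply Rle_trans with (powerRZ r (S + S - 8) * (6 * (IZR S + IZR c)))%R.
  { apply Rmult_le_compat; auto.
    - left; apply powerRZ_pos; lra.
    - apply IZR_le. lia.
    - apply powerRZ_le_anti; [lra|auto]. }
  replace (S + S - 8)%Z with (-8 + S + S)%Z by lia. rewrite !powerRZ_add by lra.
  assert (HS : (0 <= S)%Z) by (unfold S; lia). specialize (Hb S HS).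
  assert (Hc : (0 <= IZR c)%R) by (apply IZR_le; unfold c; lia).
  replace (powerRZ r (-8) * powerRZ r S * powerRZ r S * (6 * (IZR S + IZR c)))%R with
    (powerRZ r (-8) * (6 * (IZR S * powerRZ r S + IZR c * powerRZ r S)) * powerRZ r S)%R by ring.
  apply Rmult_le_compat_r; [lra|]. apply Rmult_le_compat_l; [lra|]. nra.
Qed.

Lemma coeffF_fterm (tau : C) r1 r2 : (0 < Im tau)%R ->
  coeffF 2 tau r1 r2 = qpow tau (/ 2) * sumC (fterm (ee tau) r1 r2).
Proof.
  intros Ht. apply has_sum_Z2sum.
  eapply has_sum_ext; [|apply has_sum_scal, sumC_spec, fterm_summable;
    [apply ee_nz|now apply Cmod_ee_lt_1]].
  intros [a b]. unfold uncur, fterm. cbn [fst snd]. rewrite summand_poly_weight.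
  replace (INR 2 * Qf (IZR a - / INR 2) (IZR b - / INR 2))%R with (/ 2 + IZR (expo a b))%R.
  - rewrite qpow_plus, qpow_IZR. ring.
  - unfold Qf, expo. simpl INR. rewrite !minus_IZR, mult_IZR, minus_IZR, plus_IZR, !mult_IZR. field.
Qed.

(** * Matching the weights *)

Definition heaviside (x : Z) : Z := if (0 <=? x)%Z then 1%Z else 0%Z.

(** Makes [sg] affine in half-plane indicators, so that products of signs expand into polynomials in
    them and can be compared with Kostant differences. *)
Lemma sg_heaviside n k : sg n k = (heaviside n + heaviside k - 1)%Z.
Proof. unfold sg, heaviside. destruct (0 <=? n)%Z, (0 <=? k)%Z; reflexivity. Qed.

Lemma heaviside_compl x : heaviside (- 1 - x) = (1 - heaviside x)%Z.
Proof. unfold heaviside. destruct (Z.leb_spec 0 x), (Z.leb_spec 0 (- 1 - x)); lia. Qed.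

(** The signs of [cterm] after the substitutions in [lcoef_cweight]: the first product comes from
    even m, the second from odd m, where [sgn m] is -1. *)
Definition cweight (a b r1 r2 : Z) : Z :=
  (sg (r1 + b - 1) (b - 1 - r1 + r2) * sg (2 * (a - b - r2)) (2 * r2 + b - 1) -
   sg (r1 - a) (r2 - r1 - a) * sg (2 * (b - 1 - r2) + 1) (2 * r2 - a))%Z.

(** The reflection is the Weyl reflection (a, b) -> (-b, -a), which negates [weight], followed by
    translation by (1, 1). So each Kostant value on the left is paired with the negative of one at a
    neighbouring point. *)
Lemma weight_sym a b r1 r2 :
  (weight a b r1 r2 + weight (1 - b) (1 - a) r1 r2 =
   cweight a b r1 r2 + cweight (1 - b) (1 - a) r1 r2)%Z.
Proof.
  (* [D0], [D1], [D2] are the differences of the Kostant function along (1,1), (1,0) and (0,1), the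
     positive roots in these coordinates: indicators of a quadrant or of a half-quadrant. *)
  assert (D0 : (forall x y x' y', x' = x - 1 -> y' = y - 1 ->
    kostant x y - kostant x' y' = heaviside x * heaviside y)%Z).
  { intros x y x' y' -> ->. unfold kostant, heaviside. destruct (Z.leb_spec 0 x), (Z.leb_spec 0 y); lia. }
  assert (D1 : (forall x y x' y' d, x' = x - 1 -> y' = y -> d = y - x ->
    kostant x y - kostant x' y' = heaviside x * heaviside d)%Z).
  { intros x y x' y' d -> -> ->. unfold kostant, heaviside. destruct (Z.leb_spec 0 x), (Z.leb_spec 0 (y - x)); lia. }
  assert (D2 : (forall x y x' y' d, x' = x -> y' = y - 1 -> d = x - y ->
    kostant x y - kostant x' y' = heaviside y * heaviside d)%Z).
  { intros x y x' y' d -> -> ->. unfold kostant, heaviside. destruct (Z.leb_spec 0 y), (Z.leb_spec 0 (x - y)); lia. }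
  assert (H2 : forall x, heaviside (2 * x) = heaviside x).
  { intros x. unfold heaviside. destruct (Z.leb_spec 0 x), (Z.leb_spec 0 (2 * x)); lia. }
  assert (H2' : forall x, heaviside (2 * x + 1) = heaviside x).
  { intros x. unfold heaviside. destruct (Z.leb_spec 0 x), (Z.leb_spec 0 (2 * x + 1)); lia. }
  assert (P : (weight a b r1 r2 + weight (1 - b) (1 - a) r1 r2 =
    heaviside (a - 1 - r1) * heaviside (b - 1 - r2) - heaviside (b - 1 - r2) * heaviside (r2 - r1 - a)
    - heaviside (a - 1 - r1) * heaviside (r1 - r2 - b) - heaviside (- b - r1) * heaviside (a - 1 - r2 + r1)
    - heaviside (- a - r2) * heaviside (b - 1 - r1 + r2) + heaviside (- b - r1) * heaviside (- a - r2))%Z).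
  { replace (heaviside (- b - r1)) with (heaviside (1 - b - 1 - r1)) by (f_equal; lia).
    replace (heaviside (- a - r2)) with (heaviside (1 - a - 1 - r2)) by (f_equal; lia).
    unfold weight.
    pose proof (D0 (a - 1 - r1) (b - 1 - r2) (- (1 - a) - 1 - r1) (- (1 - b) - 1 - r2))%Z.
    pose proof (D2 (- a + b - 1 - r1) (b - 1 - r2) (- (1 - b) + (1 - a) - 1 - r1) (- (1 - b) - 1 - r2)
      (r2 - r1 - a))%Z.
    pose proof (D1 (a - 1 - r1) (- b + a - 1 - r2) (- (1 - a) - 1 - r1) (- (1 - a) + (1 - b) - 1 - r2)
      (r1 - r2 - b))%Z.
    pose proof (D1 (1 - b - 1 - r1) (- (1 - a) + (1 - b) - 1 - r2) (- b - 1 - r1) (- b + a - 1 - r2)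
      (a - 1 - r2 + r1))%Z.
    pose proof (D2 (- (1 - b) + (1 - a) - 1 - r1) (1 - a - 1 - r2) (- a + b - 1 - r1) (- a - 1 - r2)
      (b - 1 - r1 + r2))%Z.
    pose proof (D0 (1 - b - 1 - r1) (1 - a - 1 - r2) (- b - 1 - r1) (- a - 1 - r2))%Z.
    clear D0 D1 D2 H2 H2'. lia. }
  rewrite P. clear P D0 D1 D2. unfold cweight. rewrite !sg_heaviside, !H2, !H2'. clear H2 H2'.
  (* All arguments are brought to nine standard forms x or to their complements -1 - x, so that
     [heaviside_compl] leaves nine indicators. *)
  replace (r1 + b - 1)%Z with (- 1 - (- b - r1))%Z by lia.
  replace (b - 1 - r1 + r2)%Z with (- 1 - (r1 - r2 - b))%Z by lia.
  replace (r1 - a)%Z with (- 1 - (a - 1 - r1))%Z by lia.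
  replace (a - 1 - r2 + r1)%Z with (- 1 - (r2 - r1 - a))%Z by lia.
  replace (r1 + (1 - a) - 1)%Z with (- 1 - (a - 1 - r1))%Z by lia.
  replace (1 - a - 1 - r1 + r2)%Z with (r2 - r1 - a)%Z by lia.
  replace (1 - b - (1 - a) - r2)%Z with (a - b - r2)%Z by lia.
  replace (2 * r2 + (1 - a) - 1)%Z with (2 * r2 - a)%Z by lia.
  replace (r1 - (1 - b))%Z with (- 1 - (- b - r1))%Z by lia.
  replace (r2 - r1 - (1 - b))%Z with (- 1 - (r1 - r2 - b))%Z by lia.
  replace (1 - a - 1 - r2)%Z with (- a - r2)%Z by lia.
  replace (2 * r2 - (1 - b))%Z with (2 * r2 + b - 1)%Z by lia.
  rewrite !heaviside_compl.
  (* The terms with the shift 2 r2 cancel; seven half-plane conditions remain. *)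
  generalize (heaviside (2 * r2 + b - 1)) (heaviside (2 * r2 - a)). intros u v.
  unfold heaviside.
  destruct (Z.leb_spec 0 (a - 1 - r1)), (Z.leb_spec 0 (b - 1 - r2)), (Z.leb_spec 0 (r2 - r1 - a)),
    (Z.leb_spec 0 (r1 - r2 - b)), (Z.leb_spec 0 (- b - r1)), (Z.leb_spec 0 (- a - r2)),
    (Z.leb_spec 0 (a - b - r2)); lia.
Qed.

Lemma expo_sym a b : expo (1 - b) (1 - a) = expo a b.
Proof. unfold expo. ring. Qed.

(** For even and for odd m separately, an affine change of variables carries the exponent of
    [cterm], increased by 2 Q(r), to [expo]; both halves then live on one lattice and their signs
    add up to [cweight]. *)
Lemma lcoef_cweight (tau : C) r1 r2 : (0 < Im tau)%R ->
  has_sum (fun p : Z * Z => zpow (ee tau) (expo (fst p) (snd p)) * RtoC (IZR (cweight (fst p) (snd p) r1 r2)))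
    (zpow (ee tau) (2 * (r1 * r1 + r2 * r2 - r1 * r2)) * lcoef (ee tau) (2 * r1 - r2) (r1 + r2)).
Proof.
  intros Ht. set (q := ee tau). assert (Hq0 : q <> 0) by apply ee_nz.
  set (A := (2 * r1 - r2)%Z). set (B := (r1 + r2)%Z).
  pose proof (cterm_has_sum tau A B Ht) as H. fold q in H.
  pose proof (has_sum_summable _ _ H) as S.
  set (phi1 := fun p : Z * Z => (fst p, 2 * snd p)%Z).
  set (phi2 := fun p : Z * Z => (fst p, 2 * snd p + 1)%Z).
  assert (I1 : forall x y, phi1 x = phi1 y -> x = y).
  { intros [x1 x2] [y1 y2] E. unfold phi1 in E. cbn [fst snd] in E.
    apply pair_equal_spec in E. f_equal; lia. }
  assert (I2 : forall x y, phi2 x = phi2 y -> x = y).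
  { intros [x1 x2] [y1 y2] E. unfold phi2 in E. cbn [fst snd] in E.
    apply pair_equal_spec in E. f_equal; lia. }
  destruct (summable_has_sum (fun p => cterm q A B (phi1 p))) as [l1 H1].
  { apply (Rsummable_inj phi1 (fun p => Cmod (cterm q A B p))); auto. }
  destruct (summable_has_sum (fun p => cterm q A B (phi2 p))) as [l2 H2].
  { apply (Rsummable_inj phi2 (fun p => Cmod (cterm q A B p))); auto. }
  assert (E : lcoef q A B = l1 + l2).
  { apply (has_sum_unique _ _ _ H). apply (has_sum_cover phi1 phi2); auto.
    - intros [x1 x2] [y1 y2] E. unfold phi1, phi2 in E. cbn [fst snd] in E.
      apply pair_equal_spec in E. lia.
    - intros [j1 j2]. destruct (Z.Even_or_Odd j2) as [[c ->]|[c ->]]; [left|right]; now exists (j1, c). }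
  rewrite E.
  (* With m = 2j or 2j + 1 the quadratic part is 2(k^2 + kj + j^2), which becomes 2(a^2 - ab + b^2)
     for k = b, j = a - b and also for k = -a, j = b. The first serves even m, the second odd m; the
     translations match the linear terms. *)
  set (f1 := fun p : Z * Z => (snd p - 1 - r1 + r2, fst p - snd p - r2)%Z).
  set (g1 := fun p : Z * Z => (snd p + (fst p + 1 + r1 - r2) + r2, fst p + 1 + r1 - r2)%Z).
  set (f2 := fun p : Z * Z => (r2 - r1 - fst p, snd p - 1 - r2)%Z).
  set (g2 := fun p : Z * Z => (r2 - r1 - fst p, snd p + 1 + r2)%Z).
  assert (B1 : forall p, g1 (f1 p) = p) by (intros [x y]; unfold f1, g1; cbn [fst snd]; f_equal; lia).
  assert (B2 : forall p, f1 (g1 p) = p) by (intros [x y]; unfold f1, g1; cbn [fst snd]; f_equal; lia).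
  assert (B3 : forall p, g2 (f2 p) = p) by (intros [x y]; unfold f2, g2; cbn [fst snd]; f_equal; lia).
  assert (B4 : forall p, f2 (g2 p) = p) by (intros [x y]; unfold f2, g2; cbn [fst snd]; f_equal; lia).
  pose proof (has_sum_scal (zpow q (2 * (r1 * r1 + r2 * r2 - r1 * r2))) _ _
    (has_sum_plus _ _ _ _ (has_sum_bij f1 g1 _ _ B1 B2 H1) (has_sum_bij f2 g2 _ _ B3 B4 H2))) as H3.
  eapply has_sum_ext; [|exact H3].
  intros [a b]. unfold f1, f2, phi1, phi2, cterm. cbn [fst snd].
  set (e1 := (_ + _ * (B + (b - 1 - r1 + r2)))%Z).
  set (e2 := (_ + _ * (B + (r2 - r1 - a)))%Z).
  assert (X1 : (2 * (r1 * r1 + r2 * r2 - r1 * r2) + e1 = expo a b)%Z).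
  { unfold e1, A, B, expo. pose proof (tri_spec (2 * (a - b - r2) + 1)). nia. }
  assert (X2 : (2 * (r1 * r1 + r2 * r2 - r1 * r2) + e2 = expo a b)%Z).
  { unfold e2, A, B, expo. pose proof (tri_spec (2 * (b - 1 - r2) + 1 + 1)). nia. }
  rewrite sgn_add, !sgn_double, sgn_1.
  replace (A + (b - 1 - r1 + r2))%Z with (r1 + b - 1)%Z by (unfold A; lia).
  replace (A + (r2 - r1 - a))%Z with (r1 - a)%Z by (unfold A; lia).
  replace (B + (b - 1 - r1 + r2))%Z with (2 * r2 + b - 1)%Z by (unfold B; lia).
  replace (B + (r2 - r1 - a))%Z with (2 * r2 - a)%Z by (unfold B; lia).
  unfold cweight. rewrite minus_IZR, !mult_IZR, RtoC_minus, !RtoC_mult. fold (sgC (r1 + b - 1) (b - 1 - r1 + r2)).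
  unfold sgC. rewrite Cmult_plus_distr_l.
  transitivity (zpow q (2 * (r1 * r1 + r2 * r2 - r1 * r2)) * zpow q e1 *
     (RtoC (IZR (sg (r1 + b - 1) (b - 1 - r1 + r2))) * RtoC (IZR (sg (2 * (a - b - r2)) (2 * r2 + b - 1)))) -
    zpow q (2 * (r1 * r1 + r2 * r2 - r1 * r2)) * zpow q e2 *
     (RtoC (IZR (sg (r1 - a) (r2 - r1 - a))) * RtoC (IZR (sg (2 * (b - 1 - r2) + 1) (2 * r2 - a))))); [ring|].
  rewrite <- !zpow_add, X1, X2 by auto. ring.
Qed.

(** Only symmetrised weights agree, so each sum is added to its own reflected copy, the doubled sums
    are compared, and the factor 2 is removed. *)
Lemma fterm_lcoef (tau : C) r1 r2 : (0 < Im tau)%R ->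
  sumC (fterm (ee tau) r1 r2) =
  zpow (ee tau) (2 * (r1 * r1 + r2 * r2 - r1 * r2)) * lcoef (ee tau) (2 * r1 - r2) (r1 + r2).
Proof.
  intros Ht. pose proof (ee_nz tau) as Hq0. pose proof (Cmod_ee_lt_1 tau Ht) as Hq.
  pose proof (sumC_spec _ (fterm_summable (ee tau) r1 r2 Hq0 Hq)) as F.
  pose proof (lcoef_cweight tau r1 r2 Ht) as W.
  match type of W with has_sum _ ?l => set (L := l) in * end.
  set (s := fun p : Z * Z => (1 - snd p, 1 - fst p)%Z).
  assert (Bs : forall p, s (s p) = p) by (intros [x y]; unfold s; cbn [fst snd]; f_equal; lia).
  pose proof (has_sum_plus _ _ _ _ F (has_sum_bij s s _ _ Bs Bs F)) as F2.
  pose proof (has_sum_plus _ _ _ _ W (has_sum_bij s s _ _ Bs Bs W)) as W2.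
  assert (E : sumC (fterm (ee tau) r1 r2) + sumC (fterm (ee tau) r1 r2) = L + L).
  { apply (has_sum_unique _ _ _ F2). eapply has_sum_ext; [|exact W2].
    intros [a b]. unfold fterm, s. cbn [fst snd]. rewrite expo_sym.
    rewrite <- !Cmult_plus_distr_l, <- !RtoC_plus, <- !plus_IZR, weight_sym. reflexivity. }
  replace (sumC (fterm (ee tau) r1 r2)) with
    (/ 2 * (sumC (fterm (ee tau) r1 r2) + sumC (fterm (ee tau) r1 r2))) by field.
  rewrite E. field.
Qed.

Local Close Scope C_scope.

Theorem theorem3p1 :
  forall (tau : C), 0 < Im tau ->
  forall r1 r2 : Z,
    coeffF 2 tau r1 r2 =
    Cmult (Cmult (qpow tau (2 * Qf (IZR r1) (IZR r2)))
                 (Cdiv (Cpow (eta tau) 5) (eta (Cmult (RtoC 2) tau))))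
          (laurent_coeff_f tau (2 * r1 - r2)%Z (r1 + r2)%Z).
Proof.
  intros tau Ht r1 r2.
  pose proof (Cmod_ee_lt_1 tau Ht) as Hq. pose proof (qpinf_nz _ Hq) as N1.
  pose proof (qpinf_nz _ (Cmod_sq_lt _ Hq)) as N2.
  rewrite coeffF_fterm, fterm_lcoef, laurent_coeff_f_eq, !eta_qpinf, qpow_double, ee_double by auto.
  replace (2 * Qf (IZR r1) (IZR r2))%R with (IZR (2 * (r1 * r1 + r2 * r2 - r1 * r2)))
    by (rewrite mult_IZR, minus_IZR, plus_IZR, !mult_IZR; reflexivity).
  rewrite qpow_IZR.
  replace (2 * / 24)%R with (/ 24 + / 24)%R by lra. rewrite qpow_plus.
  (* η(τ)^5 / η(2τ) carries q^(5/24 - 2/24), f carries q^(3/8), and together they give the q^(1/2)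
     split off from F. *)
  replace (/ 2)%R with (/ 24 + / 24 + / 24 + 3 / 8)%R by lra. rewrite !qpow_plus.
  pose proof (qpow_nz tau (/ 24)). field. auto.
Qed.
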